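(* Let $|\cdot|_H$ and $|\cdot|_V$ be smooth norms on $\mathbf{R}^2$, with dual norms $|\cdot|_{H*}$ and $|\cdot|_{V*}$, and let $\|\cdot\|$ be the smooth norm on $\mathbf{R}^3$ of the form $$\|(a,b,c)\|=\bigl|\bigl(|(a,b)|_H,\,c\bigr)\bigr|_V,$$ with unit sphere $W=\{\|\xi\|=1\}$. For $p\in\mathbf{R}^2$ put $\Psi(p)=|p|_H$, $\Phi(p)=|p|_V$, $\Psi^*(p)=|p|_{H*}$, $\Phi^*(p)=|p|_{V*}$, and let $J(x,y)=(-y,x)$. Let $w=w(\Psi^*(x,y))$ be a solution of $$\mathrm{Div}_0\Bigl(\bigl[\nabla\Phi_{(\Psi(\nabla w),1)}\cdot(1,0)\bigr]\,\nabla\Psi|_{\nabla w}\Bigr)=0$$ (an anisotropic catenoid), and put $$g(\Psi^* )=\frac{\nabla\Phi|_{(w'(\Psi^* ),1)}\cdot(1,0)}{\Psi^*},$$ so that $\mathrm{Div}_0\bigl(g(\Psi^* )(x,y)\bigr)=0$. Let $\alpha$ be a function, which exists locally away from the origin, satisfying $$\nabla\alpha=g(\Psi^* )\,J(x,y)=g(\Psi^* )(-y,x).$$ Assume that $\Psi^*(Jv)=\Psi^*(v)$ holds for all $v\in\mathbf{R}^2$. Then, away from the origin, $\alpha$ satisfies the dual equation $$\mathrm{Div}_0\Bigl(\bigl[\nabla\Phi^*_{(\Psi^*(\nabla\alpha),1)}\cdot(1,0)\bigr]\,\nabla\Psi^*|_{\nabla\alpha}\Bigr)=0,$$ so the graph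 of $\alpha$ has zero anisotropic mean curvature for the functional with Wulff shape $W$. Furthermore, $\alpha$ is multivalued in any punctured neighborhood of the origin and the graph of $\alpha$ is ruled by horizontal lines.
   Context: $\mathrm{Div}_0$ is the divergence in $\mathbf{R}^2$, and $\nabla F_p$ or $\nabla F|_p$ denotes the gradient of $F$ at $p$. Smooth norm means smooth away from the origin. Dual norms are taken with respect to the standard inner product: $\|x\|_*=\sup_{\|\xi\|=1}\langle x,\xi\rangle$, and similarly in $\mathbf{R}^2$. The dual of $\|\cdot\|$ has the same form: $\|(A,B,C)\|_*=|(|(A,B)|_{H*},C)|_{V*}$. The functional with Wulff shape $W$ is $\mathcal{F}=\int_\Sigma\|\nu\|_*\,d\Sigma$, where $\nu$ is the unit normal of the oriented surface $\Sigma$; Wulff shapes are assumed to be smooth with uniformly positive curvature. The anisotropic mean curvature $\Lambda$ for $\mathcal{F}$ is defined by $\delta\mathcal{F}=-\int_\Sigma\Lambda\,\dot X\cdot\nu\,d\Sigma+$ boundary terms, for smooth variations $X+\epsilon\dot X+\dots$ of the surface. The dual functional is $\mathcal{F}^*=\int_\Sigma\|\nu\|\,d\Sigma$, with Wulff shape $W^*=\{\|x\|_*=1\}$; the equation required of $w$ expresses that the graph of $w$ has zero anisotropic mean curvature for $\mathcal{F}^*$. *)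

(* Defs.v *)
From Stdlib Require Import Reals.
From Coquelicot Require Import Coquelicot.
Open Scope R_scope.

Definition R2 : NormedModule R_AbsRing :=
  prod_NormedModule R_AbsRing R_NormedModule R_NormedModule.
(* The point (x, y, z) parses as ((x, y), z), so [fst] is the horizontal part. *)
Definition R3 : NormedModule R_AbsRing :=
  prod_NormedModule R_AbsRing R2 R_NormedModule.

Definition pt2 (x y : R) : R2 := (x, y).
Definition pt3 (x y z : R) : R3 := (pt2 x y, z).

Definition dot2 (p q : R2) : R := fst p * fst q + snd p * snd q.
Definition dot3 (p q : R3) : R := dot2 (fst p) (fst q) + snd p * snd q.
Definition enorm3 (p : R3) : R := sqrt (dot3 p p).
Definition cross (p q : R3) : R3 :=
  let '((a1, a2), a3) := p in
  let '((b1, b2), b3) := q in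
  pt3 (a2 * b3 - a3 * b2) (a3 * b1 - a1 * b3) (a1 * b2 - a2 * b1).

Definition J (p : R2) : R2 := pt2 (- snd p) (fst p).

(** * Differential calculus *)

Definition differentiable {V W : NormedModule R_AbsRing} (f : V -> W) (p : V) : Prop :=
  ex_filterdiff f (locally p).

(* Directional derivative of [f] at [x] along [v].  As [Derive] is total, it is
   only meaningful together with a differentiability condition. *)
Definition dder {V : NormedModule R_AbsRing} (v : V) (f : V -> R) (x : V) : R :=
  Derive (fun t => f (plus x (scal t v))) 0.

Definition grad2 (f : R2 -> R) (p : R2) : R2 :=
  pt2 (dder (pt2 1 0) f p) (dder (pt2 0 1) f p).
Definition grad3 (f : R3 -> R) (p : R3) : R3 :=
  pt3 (dder (pt3 1 0 0) f p) (dder (pt3 0 1 0) f p) (dder (pt3 0 0 1) f p).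

Definition div0 (F : R2 -> R2) (p : R2) : R :=
  dder (pt2 1 0) (fun q => fst (F q)) p + dder (pt2 0 1) (fun q => snd (F q)) p.

Definition divergence_free_at (F : R2 -> R2) (p : R2) : Prop :=
  differentiable F p /\ div0 F p = 0.

(* C^k on the open set [U], [V] finite-dimensional: all iterated directional
   derivatives of order at most [k] exist and are continuous on [U]. *)
Fixpoint class_C {V : NormedModule R_AbsRing} (k : nat) (U : V -> Prop) (f : V -> R) : Prop :=
  (forall x, U x -> continuous f x) /\
  match k with
  | O => True
  | S k' => forall v : V,
      (forall x, U x -> ex_derive (fun t => f (plus x (scal t v))) 0) /\
      class_C k' U (dder v f)
  end.

Definition smooth_on {V : NormedModule R_AbsRing} (U : V -> Prop) (f : V -> R) : Prop :=
  forall k, class_C k U f.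

(** * Norms *)

Definition is_norm {V : NormedModule R_AbsRing} (n : V -> R) : Prop :=
  (forall x, 0 <= n x) /\
  (forall x, n x = 0 -> x = zero) /\
  (forall t x, n (scal t x) = Rabs t * n x) /\
  (forall x y, n (plus x y) <= n x + n y).

Definition smooth_norm {V : NormedModule R_AbsRing} (n : V -> R) : Prop :=
  is_norm n /\ smooth_on (fun x => x <> zero) n.

(* For a norm on R^2 or R^3 the set below is nonempty and bounded, so [real]
   returns the actual supremum. *)
Definition dual_norm {V : NormedModule R_AbsRing} (dot : V -> V -> R) (n : V -> R) (x : V) : R :=
  real (Lub_Rbar (fun r => exists xi, n xi = 1 /\ r = dot x xi)).

Definition dual2 (n : R2 -> R) : R2 -> R := dual_norm dot2 n.
Definition dual3 (n : R3 -> R) : R3 -> R := dual_norm dot3 n.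

Definition norm_HV (H V : R2 -> R) (xi : R3) : R := V (pt2 (H (fst xi)) (snd xi)).

(* Curvature, in the tangent direction [v], of the level surface of [n] through
   [xi] with respect to the normal - grad n / |grad n|: the second fundamental
   form D^2 n (v, v) / |grad n| divided by |v|^2. *)
Definition normal_curvature (n : R3 -> R) (xi v : R3) : R :=
  dder v (dder v n) xi / (enorm3 (grad3 n xi) * dot3 v v).

Definition uniformly_positive_curvature (n : R3 -> R) : Prop :=
  exists kappa, 0 < kappa /\
    forall xi v : R3, n xi = 1 -> v <> zero -> dot3 (grad3 n xi) v = 0 ->
      kappa <= normal_curvature n xi v.

(** * The equation *)

Definition aniso_field (H V : R2 -> R) (u : R2 -> R) (q : R2) : R2 :=
  scal (dot2 (grad2 V (pt2 (H (grad2 u q)) 1)) (pt2 1 0)) (grad2 H (grad2 u q)).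

(* Classical solution on [U] of
     Div_0 ([grad V_(H(grad u), 1) . (1, 0)] grad H |_(grad u)) = 0.
   Every gradient that occurs is required to exist; as a norm is not
   differentiable at the origin, this includes grad u <> 0. *)
Definition aniso_solution (H V : R2 -> R) (U : R2 -> Prop) (u : R2 -> R) : Prop :=
  forall p, U p ->
    differentiable u p /\
    differentiable H (grad2 u p) /\
    differentiable V (pt2 (H (grad2 u p)) 1) /\
    divergence_free_at (aniso_field H V u) p.

Definition annulus (n : R2 -> R) (r0 : R) (r1 : Rbar) (p : R2) : Prop :=
  r0 < n p /\ Rbar_lt (n p) r1.

Definition catenoid_g (V : R2 -> R) (w : R -> R) (r : R) : R :=
  dot2 (grad2 V (pt2 (Derive w r) 1)) (pt2 1 0) / r.

Definition radial_field (n : R2 -> R) (g : R -> R) (q : R2) : R2 := scal (g (n q)) q.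
Definition rotated_field (n : R2 -> R) (g : R -> R) (q : R2) : R2 := scal (g (n q)) (J q).

(* The profile [w] of a catenoid never reaches r = 0: its equation gives
   g = c / r^2 with c <> 0, whereas r g(r) stays bounded where w exists.  Away
   from the origin, g denotes the function on (0, oo) that agrees with the
   formula where w is defined and satisfies Div_0 (g(n) (x, y)) = 0 everywhere
   off the origin. *)
Definition extends_catenoid_g (n V : R2 -> R) (w : R -> R) (r0 : R) (r1 : Rbar)
    (g : R -> R) : Prop :=
  (forall r, r0 < r -> Rbar_lt r r1 -> g r = catenoid_g V w r) /\
  (forall p : R2, p <> zero -> divergence_free_at (radial_field n g) p).

Definition has_gradient_on (U : R2 -> Prop) (alpha : R2 -> R) (F : R2 -> R2) : Prop :=
  forall p, U p -> differentiable alpha p /\ grad2 alpha p = F p.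

(** * Surfaces and anisotropic mean curvature *)

Definition dder_vec (v : R2) (X : R2 -> R3) (p : R2) : R3 :=
  pt3 (dder v (fun q => fst (fst (X q))) p)
      (dder v (fun q => snd (fst (X q))) p)
      (dder v (fun q => snd (X q)) p).

Definition normal_vec (X : R2 -> R3) (p : R2) : R3 :=
  cross (dder_vec (pt2 1 0) X p) (dder_vec (pt2 0 1) X p).
Definition unit_normal (X : R2 -> R3) (p : R2) : R3 :=
  scal (/ enorm3 (normal_vec X p)) (normal_vec X p).

(* Integral of [h] over the piece of [X] parametrized by [a, b] x [c, d]. *)
Definition surface_integral (X : R2 -> R3) (a b c d : R) (h : R2 -> R) : R :=
  RInt (fun u => RInt (fun v => h (pt2 u v) * enorm3 (normal_vec X (pt2 u v))) c d) a b.

Definition aniso_energy (gamma : R3 -> R) (X : R2 -> R3) (a b c d : R) : R :=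
  surface_integral X a b c d (fun p => gamma (unit_normal X p)).

Definition smooth_family (delta : R) (U : R2 -> Prop) (Y : R -> R2 -> R3) : Prop :=
  let D := fun z : prod_NormedModule R_AbsRing R_NormedModule R2 =>
             Rabs (fst z) < delta /\ U (snd z) in
  smooth_on D (fun z => fst (fst (Y (fst z) (snd z)))) /\
  smooth_on D (fun z => snd (fst (Y (fst z) (snd z)))) /\
  smooth_on D (fun z => snd (Y (fst z) (snd z))).

Definition velocity (Y : R -> R2 -> R3) (p : R2) : R3 :=
  pt3 (Derive (fun e => fst (fst (Y e p))) 0)
      (Derive (fun e => snd (fst (Y e p))) 0)
      (Derive (fun e => snd (Y e p)) 0).

(* [Lam] is the anisotropic mean curvature of X : U -> R^3 for the functional
   with integrand [gamma]: the first variation of the energy is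
   - int Lam (Xdot . nu) dSigma.  It is tested on the pieces of the surface over
   the closed rectangles contained in U and on the variations supported in the
   interior of the rectangle, for which there are no boundary terms. *)
Definition is_aniso_mean_curvature (gamma : R3 -> R) (U : R2 -> Prop) (X : R2 -> R3)
    (Lam : R2 -> R) : Prop :=
  forall a b c d : R, a < b -> c < d ->
  (forall u v, a <= u <= b -> c <= v <= d -> U (pt2 u v)) ->
  forall (Y : R -> R2 -> R3) (delta eta : R), 0 < delta -> 0 < eta ->
  smooth_family delta U Y ->
  (forall p, U p -> Y 0 p = X p) ->
  (forall e u v, Rabs e < delta -> U (pt2 u v) ->
     ~ (a + eta <= u <= b - eta /\ c + eta <= v <= d - eta) ->
     Y e (pt2 u v) = X (pt2 u v)) ->
  is_derive (fun e => aniso_energy gamma (Y e) a b c d) 0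
    (- surface_integral X a b c d
         (fun p => Lam p * dot3 (velocity Y p) (unit_normal X p))).

Definition graph_param (alpha : R2 -> R) (p : R2) : R3 := (p, alpha p).

Definition graph_on (U : R2 -> Prop) (alpha : R2 -> R) (P : R3) : Prop :=
  U (fst P) /\ snd P = alpha (fst P).

(* Through each point of the graph over the open set [U] there is a horizontal
   line which stays in the graph as long as its projection stays in [U]. *)
Definition ruled_by_horizontal_lines (U : R2 -> Prop) (alpha : R2 -> R) : Prop :=
  forall P, graph_on U alpha P ->
  exists d : R3, d <> zero /\ snd d = 0 /\
    forall t, (forall s, Rmin 0 t <= s <= Rmax 0 t -> U (fst (plus P (scal s d)))) ->
      graph_on U alpha (plus P (scal t d)).

(* The solutions of grad alpha = F are multivalued in [D]: continuing a local
   solution along some closed curve [gamma] of [D], with values [a], leads back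
   to the starting point with a different value. *)
Definition multivalued_in (D : R2 -> Prop) (F : R2 -> R2) : Prop :=
  exists (gamma : R -> R2) (a : R -> R),
    (forall t, 0 <= t <= 1 -> continuous gamma t /\ D (gamma t)) /\
    gamma 0 = gamma 1 /\
    (forall t, 0 <= t <= 1 -> exists (B : R2 -> Prop) (beta : R2 -> R),
       open B /\ B (gamma t) /\ has_gradient_on B beta F /\
       locally t (fun s => 0 <= s <= 1 -> a s = beta (gamma s))) /\
    a 0 <> a 1.

(* Main.v *)
Require Import Defs.
From Stdlib Require Import Reals Lra Psatz Classical ClassicalEpsilon.
From Coquelicot Require Import Coquelicot.
Open Scope R_scope.

(**
The data are a norm Psi of the plane, a second norm Phi that builds the norm of
space, and their duals.  Write n for the dual of Psi.

Strict curvature in space passes to both plane norms: the horizontal section of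
the Wulff shape is a copy of the unit circle of Psi, a vertical section is the
unit circle of Phi ([Psi_curved], [Phi_curved]).  As a norm of space is
symmetric, Phi is moreover symmetric in its first variable ([Phi_even]).

For a strictly curved norm the gradient of n^2 / 2 has an invertible
differential, so its inverse, which is the gradient of half the squared dual
norm, is again of class C1 ([grad_inv_C1]).  Hence the dual norms have C1
gradients away from the origin, and grad n (x) is the point of the unit circle
of Psi that maximises the pairing with x ([dual_norm_C2]).

The catenoid.  grad w(n) = w'(n) grad n, and grad Psi at grad n (p) is p / n(p).
The equation for w therefore says that g(n) p is divergence free, that is
r g' + 2 g = 0, so g = c / r^2.  The constant c is not 0: Psi has to be
differentiable at grad w(n), so w' does not vanish, and the horizontal
derivative of the symmetric norm Phi at (s, 1) vanishes only for s = 0.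

The potential alpha thus has gradient c J p / n(p)^2.  Since J p is orthogonal to
p, alpha is constant along rays, and these are the horizontal lines of the graph.
It is a function of the direction of p alone; its derivative along a circle is c
times a positive function, so a full turn changes its value.

The dual equation.  Invariance of n under J turns the dual field at alpha into
h(n) J grad n for a function h of one variable.  Its divergence is
h' (grad n . J grad n) plus h times the antisymmetric part of the Hessian of n,
and both vanish ([flux_divergence_free]).

The mean curvature.  Let S(p) be the point of the unit sphere of the spatial norm
at which the pairing with the normal of the graph at p is maximal.  For a
variation with normals N_e, the integrand gamma(N_e) equals
gamma(N_0) + S . (N_e - N_0) up to o(e), because S . N is at most gamma(N) for
every N with equality for the normal to which S belongs ([calibration_small]).
The normal is a cross product X_u x X_v, so the part of first order in the
displacement D is D_u . (X_v x S) + D_v . (S x X_u).  The pair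
(X_v x S, S x X_u) is divergence free: its horizontal part is the dual equation,
and S moves tangentially to the sphere ([div_free_rows]).  Integration by parts
over the rectangle kills the first order part, as D vanishes near the boundary,
and the remainder is o(e) uniformly by compactness ([zero_mean_curvature]).
*)

(** * Gradients and continuous differentiability in the plane *)

Definition is_grad (f : R2 -> R) (p d : R2) : Prop :=
  filterdiff f (locally p) (fun v => dot2 d v).

Definition C1_at (f : R2 -> R) (p : R2) : Prop :=
  exists d : R2 -> R2, continuous d p /\ locally p (fun q => is_grad f q (d q)).

Lemma R2_eq (p q : R2) : fst p = fst q -> snd p = snd q -> p = q.
Proof. destruct p, q; simpl; intros; subst; reflexivity. Qed.

(** Coordinates of points of [R2] are typed in the carrier of a normed module; ring and
    linear arithmetic need to see [R]. *)
Ltac toR := change (NormedModule.sort R_AbsRing R_NormedModule) with R in *.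
Ltac coords :=
  repeat progress (simpl; unfold dot2, J, pt2, minus, plus, scal, opp, zero, mult); toR.

Lemma is_linear_dot2 (d : R2) : is_linear (fun v : R2 => dot2 d v).
Proof.
  apply (is_linear_ext (fun v : R2 => plus (scal (fst d) (fst v)) (scal (snd d) (snd v)))).
  { intros v; reflexivity. }
  apply (is_linear_comp (fun v : R2 => (scal (fst d) (fst v), scal (snd d) (snd v)) : R2)
           (fun z : R2 => plus (fst z) (snd z))).
  - apply is_linear_prod.
    + apply (is_linear_comp (fun v : R2 => fst v) (fun t => scal (fst d) t)).
      apply is_linear_fst. apply (is_linear_scal_r (V:=R_NormedModule)). intros; apply Rmult_comm.
    + apply (is_linear_comp (fun v : R2 => snd v) (fun t => scal (snd d) t)).
      apply is_linear_snd. apply (is_linear_scal_r (V:=R_NormedModule)). intros; apply Rmult_comm.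
  - apply is_linear_plus.
Qed.

Lemma linear_is_dot2 (l : R2 -> R) : is_linear l ->
  forall v, l v = dot2 (pt2 (l (pt2 1 0)) (l (pt2 0 1))) v.
Proof.
  intros Hl v.
  replace v with (plus (scal (fst v) (pt2 1 0)) (scal (snd v) (pt2 0 1))) at 1.
  - rewrite (linear_plus l Hl), 2!(linear_scal l Hl).
    unfold dot2, pt2, plus, scal; simpl; unfold mult; simpl. ring.
  - apply R2_eq; unfold pt2, plus, scal; simpl; unfold scal; simpl; unfold mult, plus; simpl; ring.
Qed.

Lemma is_grad_ext_loc f g p d :
  locally p (fun q => f q = g q) -> is_grad f p d -> is_grad g p d.
Proof. intros H; apply filterdiff_ext_loc with (1:=H).
  intros y Hy. apply is_filter_lim_locally_unique in Hy. subst.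
  now apply locally_singleton in H. Qed.

Lemma is_grad_const c p : is_grad (fun _ => c) p (pt2 0 0).
Proof.
  apply filterdiff_ext_lin with (fun _ => zero). apply filterdiff_const.
  intros v; unfold dot2, pt2, zero; simpl; ring.
Qed.
Lemma is_grad_fst p : is_grad (fun q => fst q) p (pt2 1 0).
Proof.
  apply filterdiff_ext_lin with (fun v : R2 => fst v).
  apply filterdiff_linear, is_linear_fst.
  intros v; unfold dot2, pt2; simpl; ring.
Qed.
Lemma is_grad_snd p : is_grad (fun q => snd q) p (pt2 0 1).
Proof.
  apply filterdiff_ext_lin with (fun v : R2 => snd v).
  apply filterdiff_linear, is_linear_snd.
  intros v; unfold dot2, pt2; simpl; ring.
Qed.

Lemma is_grad_comp2 (F f g : R2 -> R) (p d df dg : R2) :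
  is_grad F (pt2 (f p) (g p)) d -> is_grad f p df -> is_grad g p dg ->
  is_grad (fun q => F (pt2 (f q) (g q))) p
    (pt2 (fst d * fst df + snd d * fst dg) (fst d * snd df + snd d * snd dg)).
Proof.
  intros HF Hf Hg.
  apply filterdiff_ext_lin with (fun v => dot2 d (pt2 (dot2 df v) (dot2 dg v))).
  - apply (filterdiff_comp'_2 f g (fun x y => F (pt2 x y)) p
      (fun v => dot2 df v) (fun v => dot2 dg v) (fun x y => dot2 d (pt2 x y))); trivial.
    apply filterdiff_ext with (f := F). { intros [a b]; reflexivity. }
    apply filterdiff_ext_lin with (1:=HF). intros [a b]; reflexivity.
  - intros v; unfold dot2, pt2; simpl; ring.
Qed.

Lemma is_grad_plus_bin p : is_grad (fun q => fst q + snd q) p (pt2 1 1).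
Proof.
  apply filterdiff_ext_lin with (fun v : R2 => plus (fst v) (snd v)).
  apply filterdiff_linear. apply is_linear_plus.
  intros v; unfold dot2, pt2, plus; simpl; ring.
Qed.
Lemma is_grad_mult_bin (p : R2) : is_grad (fun q => fst q * snd q) p (pt2 (snd p) (fst p)).
Proof.
  apply filterdiff_ext_lin with (fun t : R2 => plus (mult (fst t) (snd p)) (mult (fst p) (snd t))).
  apply (filterdiff_mult (F := locally (T := R2) p) p).
  intros P HP; exact HP. intros; apply Rmult_comm.
  intros v; unfold dot2, pt2, plus, mult; simpl; ring.
Qed.

Lemma is_grad_comp1 (phi : R -> R) (f : R2 -> R) p l df :
  is_derive phi (f p) l -> is_grad f p df ->
  is_grad (fun q => phi (f q)) p (pt2 (l * fst df) (l * snd df)).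
Proof.
  intros Hp Hf.
  apply filterdiff_ext_lin with (fun v => scal (dot2 df v) l).
  - apply (filterdiff_comp' f phi p (fun v => dot2 df v) (fun t => scal t l)); trivial.
  - intros v; unfold dot2, pt2, scal; simpl; unfold mult; simpl; ring.
Qed.

Lemma is_grad_path (f : R2 -> R) (x y : R -> R) t d dx dy :
  is_grad f (pt2 (x t) (y t)) d -> is_derive x t dx -> is_derive y t dy ->
  is_derive (fun s => f (pt2 (x s) (y s))) t (fst d * dx + snd d * dy).
Proof.
  intros HF Hx Hy.
  apply filterdiff_ext_lin with (fun v => dot2 d (pt2 (scal v dx) (scal v dy))).
  - apply (filterdiff_comp'_2 x y (fun x y => f (pt2 x y)) t
      (fun v => scal v dx) (fun v => scal v dy) (fun x y => dot2 d (pt2 x y))); trivial.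
    apply filterdiff_ext with (f := f). { intros [a b]; reflexivity. }
    apply filterdiff_ext_lin with (1:=HF). intros [a b]; reflexivity.
  - intros v; unfold dot2, pt2, scal; simpl; unfold mult; simpl; ring.
Qed.

Lemma is_derive_affine (a b t : R) : is_derive (fun s : R => a + s * b) t b.
Proof. auto_derive; trivial; ring. Qed.

Lemma is_grad_dder f p d v : is_grad f p d ->
  is_derive (fun t => f (plus p (scal t v))) 0 (dot2 d v).
Proof.
  intros H.
  replace (dot2 d v) with (fst d * fst v + snd d * snd v) by reflexivity.
  apply (is_derive_ext (fun t => f (pt2 (fst p + t * fst v) (snd p + t * snd v)))).
  { intros t. reflexivity. }
  apply is_grad_path.
  - replace (pt2 _ _) with p; trivial.
    apply R2_eq; simpl; ring.
  - apply is_derive_affine.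
  - apply is_derive_affine.
Qed.

Lemma dder_grad f p d v : is_grad f p d -> dder v f p = dot2 d v.
Proof. intros H. apply is_derive_unique, is_grad_dder, H. Qed.

Lemma grad2_is_grad f p d : is_grad f p d -> grad2 f p = d.
Proof.
  intros H. unfold grad2. rewrite 2!(dder_grad _ _ _ _ H).
  apply R2_eq; unfold dot2, pt2; simpl; ring.
Qed.

Lemma is_grad_unique f p d d' : is_grad f p d -> is_grad f p d' -> d = d'.
Proof. intros H H'. now rewrite <- (grad2_is_grad _ _ _ H), <- (grad2_is_grad _ _ _ H'). Qed.

Lemma is_grad_differentiable f p d : is_grad f p d -> differentiable f p.
Proof. intros H; eexists; apply H. Qed.

Lemma differentiable_is_grad (f : R2 -> R) p : differentiable f p -> is_grad f p (grad2 f p).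
Proof.
  intros [l Hl].
  assert (H : is_grad f p (pt2 (l (pt2 1 0)) (l (pt2 0 1)))).
  { apply filterdiff_ext_lin with (1:=Hl). intros v.
    apply linear_is_dot2. apply Hl. }
  now rewrite (grad2_is_grad _ _ _ H).
Qed.

Lemma is_grad_continuous f p d : is_grad f p d -> continuous f p.
Proof. intros H. apply (filterdiff_continuous (V:=R_NormedModule) f p). eexists; apply H. Qed.

Lemma differentiable_pair (F : R2 -> R2) p d1 d2 :
  is_grad (fun q => fst (F q)) p d1 -> is_grad (fun q => snd (F q)) p d2 ->
  differentiable F p.
Proof.
  intros H1 H2.
  exists (fun v => (dot2 d1 v, dot2 d2 v)).
  apply filterdiff_ext with (fun q => (fst (F q), snd (F q))).
  { intros q; destruct (F q); reflexivity. }
  apply (filterdiff_comp'_2 (V:=R_NormedModule) (fun q => fst (F q)) (fun q => snd (F q)) (fun x y => (x, y) : R2) p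
    (fun v => dot2 d1 v) (fun v => dot2 d2 v) (fun x y => (x, y))); trivial.
  apply filterdiff_ext with (fun z : R2 => z). { intros [a b]; reflexivity. }
  apply filterdiff_ext_lin with (fun z : R2 => z).
  apply filterdiff_id. intros [a b]; reflexivity.
Qed.

Lemma differentiable_components (F : R2 -> R2) p : differentiable F p ->
  differentiable (fun q => fst (F q)) p /\ differentiable (fun q => snd (F q)) p.
Proof.
  intros [l Hl]; split.
  - exists (fun v => fst (l v)).
    apply (filterdiff_comp' F (fun z : R2 => fst z) p l (fun z : R2 => fst z)); trivial.
    apply filterdiff_linear, is_linear_fst.
  - exists (fun v => snd (l v)).
    apply (filterdiff_comp' F (fun z : R2 => snd z) p l (fun z : R2 => snd z)); trivial.
    apply filterdiff_linear, is_linear_snd.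
Qed.

Lemma continuous_pt2 {U : UniformSpace} (f g : U -> R) p :
  continuous f p -> continuous g p -> continuous (fun q => pt2 (f q) (g q)) p.
Proof.
  intros Hf Hg.
  apply (continuous_comp_2 f g (fun x y => pt2 x y)); trivial.
  apply (continuous_ext (fun z : R2 => z)). { intros [a b]; reflexivity. }
  apply continuous_id.
Qed.
Lemma continuous_fst_R2 {U : UniformSpace} (f : U -> R2) p :
  continuous f p -> continuous (fun q => fst (f q)) p.
Proof. intros H. apply (continuous_comp f (fun z : R2 => fst z)); trivial.
  destruct (f p). apply continuous_fst. Qed.
Lemma continuous_snd_R2 {U : UniformSpace} (f : U -> R2) p :
  continuous f p -> continuous (fun q => snd (f q)) p.
Proof. intros H. apply (continuous_comp f (fun z : R2 => snd z)); trivial.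
  destruct (f p). apply continuous_snd. Qed.

Lemma cont_plus {U : UniformSpace} (f g : U -> R) p :
  continuous f p -> continuous g p -> continuous (fun q => f q + g q) p.
Proof. apply (continuous_plus (V := R_NormedModule)). Qed.
Lemma cont_minus {U : UniformSpace} (f g : U -> R) p :
  continuous f p -> continuous g p -> continuous (fun q => f q - g q) p.
Proof. apply (continuous_minus (V := R_NormedModule)). Qed.
Lemma cont_opp {U : UniformSpace} (f : U -> R) p :
  continuous f p -> continuous (fun q => - f q) p.
Proof. apply (continuous_opp (V := R_NormedModule)). Qed.
Lemma cont_mult {U : UniformSpace} (f g : U -> R) p :
  continuous f p -> continuous g p -> continuous (fun q => f q * g q) p.
Proof. apply (continuous_mult (K := R_AbsRing)). Qed.
Lemma cont_inv {U : UniformSpace} (f : U -> R) p :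
  continuous f p -> f p <> 0 -> continuous (fun q => / f q) p.
Proof. intros H Hn. apply (continuous_comp f Rinv); trivial.
  now apply continuous_Rinv. Qed.
Lemma cont_div {U : UniformSpace} (f g : U -> R) p :
  continuous f p -> continuous g p -> g p <> 0 -> continuous (fun q => f q / g q) p.
Proof. intros. apply cont_mult; trivial. now apply cont_inv. Qed.
Lemma cont_abs {U : UniformSpace} (f : U -> R) p :
  continuous f p -> continuous (fun q => Rabs (f q)) p.
Proof. intros H. apply (continuous_comp f Rabs); trivial. apply continuous_Rabs. Qed.

Lemma cont_gt {U : UniformSpace} (f : U -> R) p c :
  continuous f p -> c < f p -> locally p (fun q => c < f q).
Proof. intros H Hc. apply (H (fun y => c < y)). now apply open_gt. Qed.
Lemma cont_lt {U : UniformSpace} (f : U -> R) p c :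
  continuous f p -> f p < c -> locally p (fun q => f q < c).
Proof. intros H Hc. apply (H (fun y => y < c)). now apply open_lt. Qed.
Lemma cont_neq0 {U : UniformSpace} (f : U -> R) p :
  continuous f p -> f p <> 0 -> locally p (fun q => f q <> 0).
Proof. intros H Hc. apply (H (fun y => y <> 0)). now apply open_neq. Qed.
Lemma cont_close {U : UniformSpace} (f : U -> R) p eps :
  continuous f p -> 0 < eps -> locally p (fun q => Rabs (f q - f p) < eps).
Proof. intros H He. apply (H (fun y => Rabs (y - f p) < eps)).
  exists (mkposreal _ He). intros y Hy; exact Hy. Qed.
Lemma cont_of_close {U : UniformSpace} (f : U -> R) p :
  (forall eps, 0 < eps -> locally p (fun q => Rabs (f q - f p) < eps)) -> continuous f p.
Proof.
  intros H. apply filterlim_locally. intros eps.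
  generalize (H eps (cond_pos eps)). apply filter_imp. intros q Hq; exact Hq.
Qed.

Lemma R2_neq (p : R2) : p <> zero <-> (fst p <> 0 \/ snd p <> 0).
Proof.
  split.
  - intros H. destruct (Req_dec (fst p) 0); [right|now left].
    intros E; apply H. apply R2_eq; trivial.
  - intros [H|H] E; subst; simpl in H; now apply H.
Qed.
Lemma open_nonzero : open (fun p : R2 => p <> zero).
Proof.
  intros p Hp. apply R2_neq in Hp. destruct Hp as [H|H].
  - apply filter_imp with (fun q : R2 => fst q <> 0).
    + intros q Hq; apply R2_neq; now left.
    + apply (cont_neq0 (fun q : R2 => fst q)); trivial. apply continuous_fst_R2, continuous_id.
  - apply filter_imp with (fun q : R2 => snd q <> 0).
    + intros q Hq; apply R2_neq; now right.
    + apply (cont_neq0 (fun q : R2 => snd q)); trivial. apply continuous_snd_R2, continuous_id.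
Qed.

Lemma C1_at_grad f p : C1_at f p -> is_grad f p (grad2 f p).
Proof.
  intros [d [_ H]]. apply locally_singleton in H.
  now rewrite (grad2_is_grad _ _ _ H).
Qed.
Lemma C1_at_continuous f p : C1_at f p -> continuous f p.
Proof. intros H. eapply is_grad_continuous, C1_at_grad, H. Qed.

Lemma C1_at_locally f p : C1_at f p -> locally p (fun q => is_grad f q (grad2 f q)).
Proof.
  intros [d [_ H]]. apply filter_imp with (2:=H). intros q Hq.
  now rewrite (grad2_is_grad _ _ _ Hq).
Qed.
Lemma C1_at_cont_grad f p : C1_at f p -> continuous (grad2 f) p.
Proof.
  intros [d [Hd H]].
  apply (continuous_ext_loc _ d); trivial.
  apply filter_imp with (2:=H). intros q Hq. symmetry. now apply grad2_is_grad.
Qed.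

Lemma C1_at_ext_loc f g p : locally p (fun q => f q = g q) -> C1_at f p -> C1_at g p.
Proof.
  intros H [d [Hd Hf]]. exists d; split; trivial.
  apply locally_locally in H.
  generalize (filter_and _ _ H Hf). apply filter_imp. intros q [H1 H2].
  eapply is_grad_ext_loc; eauto.
Qed.

Lemma C1_at_const c p : C1_at (fun _ => c) p.
Proof. exists (fun _ => pt2 0 0). split. apply continuous_const.
  apply filter_forall. intros; apply is_grad_const. Qed.
Lemma C1_at_fst p : C1_at (fun q => fst q) p.
Proof. exists (fun _ => pt2 1 0). split. apply continuous_const.
  apply filter_forall. intros; apply is_grad_fst. Qed.
Lemma C1_at_snd p : C1_at (fun q => snd q) p.
Proof. exists (fun _ => pt2 0 1). split. apply continuous_const.
  apply filter_forall. intros; apply is_grad_snd. Qed.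

Lemma C1_at_comp2 (F f g : R2 -> R) p :
  C1_at F (pt2 (f p) (g p)) -> C1_at f p -> C1_at g p ->
  C1_at (fun q => F (pt2 (f q) (g q))) p.
Proof.
  intros [d [Hd HF]] Hf Hg.
  assert (cf := C1_at_continuous _ _ Hf). assert (cg := C1_at_continuous _ _ Hg).
  destruct Hf as [df [Hdf Hf]]. destruct Hg as [dg [Hdg Hg]].
  assert (cp : continuous (fun q => pt2 (f q) (g q)) p) by now apply continuous_pt2.
  assert (cd : continuous (fun q => d (pt2 (f q) (g q))) p)
    by now apply (continuous_comp (fun q => pt2 (f q) (g q)) d).
  exists (fun q => let d := d (pt2 (f q) (g q)) in
     pt2 (fst d * fst (df q) + snd d * fst (dg q)) (fst d * snd (df q) + snd d * snd (dg q))).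
  split.
  - assert (cd1 := continuous_fst_R2 _ _ cd). assert (cd2 := continuous_snd_R2 _ _ cd).
    assert (df1 := continuous_fst_R2 _ _ Hdf). assert (df2 := continuous_snd_R2 _ _ Hdf).
    assert (dg1 := continuous_fst_R2 _ _ Hdg). assert (dg2 := continuous_snd_R2 _ _ Hdg).
    apply (continuous_pt2
      (fun q => fst (d (pt2 (f q) (g q))) * fst (df q) + snd (d (pt2 (f q) (g q))) * fst (dg q))
      (fun q => fst (d (pt2 (f q) (g q))) * snd (df q) + snd (d (pt2 (f q) (g q))) * snd (dg q))).
    + exact (cont_plus _ _ _ (cont_mult _ _ _ cd1 df1) (cont_mult _ _ _ cd2 dg1)).
    + exact (cont_plus _ _ _ (cont_mult _ _ _ cd1 df2) (cont_mult _ _ _ cd2 dg2)).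
  - assert (HF' : locally p (fun q => is_grad F (pt2 (f q) (g q)) (d (pt2 (f q) (g q))))) by exact (cp _ HF).
    generalize (filter_and _ _ HF' (filter_and _ _ Hf Hg)). apply filter_imp.
    intros q [H1 [H2 H3]]. now apply is_grad_comp2.
Qed.

Lemma C1_at_plus f g p : C1_at f p -> C1_at g p -> C1_at (fun q => f q + g q) p.
Proof.
  intros Hf Hg. apply (C1_at_comp2 (fun z => fst z + snd z) f g); trivial.
  exists (fun _ => pt2 1 1). split. apply continuous_const.
  apply filter_forall. intros q; apply (is_grad_plus_bin q).
Qed.
Lemma C1_at_mult f g p : C1_at f p -> C1_at g p -> C1_at (fun q => f q * g q) p.
Proof.
  intros Hf Hg. apply (C1_at_comp2 (fun z => fst z * snd z) f g); trivial.
  exists (fun z => pt2 (snd z) (fst z)). split.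
  - apply (continuous_pt2 (fun z : R2 => snd z) (fun z : R2 => fst z)).
    apply continuous_snd_R2, continuous_id. apply continuous_fst_R2, continuous_id.
  - apply filter_forall. intros q; apply (is_grad_mult_bin q).
Qed.
Lemma C1_at_opp f p : C1_at f p -> C1_at (fun q => - f q) p.
Proof.
  intros H. apply (C1_at_ext_loc (fun q => (-1) * f q)).
  apply filter_forall; intros; ring. apply C1_at_mult; trivial. apply C1_at_const.
Qed.
Lemma C1_at_comp1 (phi phi' : R -> R) f p :
  locally (f p) (fun y => is_derive phi y (phi' y)) -> continuous phi' (f p) ->
  C1_at f p -> C1_at (fun q => phi (f q)) p.
Proof.
  intros Hphi Hc Hf. assert (cf := C1_at_continuous _ _ Hf).
  destruct Hf as [df [Hdf Hf]].
  assert (cd : continuous (fun q => phi' (f q)) p) by now apply (continuous_comp f phi').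
  exists (fun q => pt2 (phi' (f q) * fst (df q)) (phi' (f q) * snd (df q))). split.
  - apply (continuous_pt2 (fun q => phi' (f q) * fst (df q)) (fun q => phi' (f q) * snd (df q)));
    apply cont_mult; trivial; [now apply continuous_fst_R2 | now apply continuous_snd_R2].
  - assert (H1 : locally p (fun q => is_derive phi (f q) (phi' (f q)))) by exact (cf _ Hphi).
    generalize (filter_and _ _ H1 Hf). apply filter_imp.
    intros q [H2 H3]. now apply is_grad_comp1.
Qed.
Lemma C1_at_inv f p : C1_at f p -> f p <> 0 -> C1_at (fun q => / f q) p.
Proof.
  intros H Hn. apply (C1_at_comp1 Rinv (fun y => - / (y * y))); trivial.
  - apply filter_imp with (fun y : R => y <> 0).
    + intros y Hy. auto_derive; trivial. now field.
    + now apply open_neq.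
  - apply cont_opp, cont_inv.
    + apply cont_mult; apply continuous_id.
    + now apply Rmult_integral_contrapositive_currified.
Qed.
Lemma C1_at_div f g p : C1_at f p -> C1_at g p -> g p <> 0 -> C1_at (fun q => f q / g q) p.
Proof. intros. apply C1_at_mult; trivial. now apply C1_at_inv. Qed.

Lemma is_grad_plus f g p df dg : is_grad f p df -> is_grad g p dg ->
  is_grad (fun q => f q + g q) p (plus df dg).
Proof.
  intros Hf Hg.
  replace (plus df dg) with (pt2 (1 * fst df + 1 * fst dg) (1 * snd df + 1 * snd dg)).
  - apply (is_grad_comp2 (fun z => fst z + snd z) f g p (pt2 1 1)); trivial. apply is_grad_plus_bin.
  - apply R2_eq; unfold pt2, plus; simpl; unfold plus; simpl; ring.
Qed.
Lemma is_grad_mult f g p df dg : is_grad f p df -> is_grad g p dg ->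
  is_grad (fun q => f q * g q) p (pt2 (g p * fst df + f p * fst dg) (g p * snd df + f p * snd dg)).
Proof.
  intros Hf Hg.
  apply (is_grad_comp2 (fun z => fst z * snd z) f g p (pt2 (g p) (f p))); trivial.
  apply (is_grad_mult_bin (pt2 (f p) (g p))).
Qed.

Lemma norm_fst (z : R2) : Rabs (fst z) <= norm z.
Proof.
  change (norm z) with (sqrt (Rabs (fst z) ^ 2 + Rabs (snd z) ^ 2)).
  rewrite <- (Rabs_pos_eq (Rabs (fst z))) at 1 by apply Rabs_pos.
  rewrite <- sqrt_Rsqr_abs. apply sqrt_le_1_alt. unfold Rsqr. generalize (Rle_0_sqr (Rabs (snd z))).
  unfold Rsqr. simpl. lra.
Qed.
Lemma norm_snd (z : R2) : Rabs (snd z) <= norm z.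
Proof.
  change (norm z) with (sqrt (Rabs (fst z) ^ 2 + Rabs (snd z) ^ 2)).
  rewrite <- (Rabs_pos_eq (Rabs (snd z))) at 1 by apply Rabs_pos.
  rewrite <- sqrt_Rsqr_abs. apply sqrt_le_1_alt. unfold Rsqr. generalize (Rle_0_sqr (Rabs (fst z))).
  unfold Rsqr. simpl. lra.
Qed.

Lemma dot2_bound (a z : R2) e : Rabs (fst a) <= e -> Rabs (snd a) <= e ->
  Rabs (dot2 a z) <= (e + e) * norm z.
Proof.
  intros H1 H2. unfold dot2.
  eapply Rle_trans. apply Rabs_triang. rewrite 2!Rabs_mult.
  generalize (norm_fst z) (norm_snd z) (Rabs_pos (fst a)) (Rabs_pos (snd a))
    (Rabs_pos (fst z)) (Rabs_pos (snd z)). intros. nra.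
Qed.

(** The bound is |a(q) - d| |q - p| with a(q) tending to d, hence o(|q - p|).  It covers
    slopes that converge as well as functions caught between two linear functions. *)
Lemma is_grad_squeeze (f : R2 -> R) (p d : R2) (a : R2 -> R2) :
  continuous a p -> a p = d ->
  locally p (fun q => Rabs (f q - f p - dot2 d (minus q p)) <= Rabs (dot2 (minus (a q) d) (minus q p))) ->
  is_grad f p d.
Proof.
  intros Ha Hd H. split. { apply is_linear_dot2. }
  intros x Hx. apply is_filter_lim_locally_unique in Hx. subst x.
  intros eps.
  assert (He : 0 < eps / 2) by (generalize (cond_pos eps); lra).
  assert (H1 := cont_close _ _ _ (continuous_fst_R2 _ _ Ha) He).
  assert (H2 := cont_close _ _ _ (continuous_snd_R2 _ _ Ha) He).
  generalize (filter_and _ _ H (filter_and _ _ H1 H2)). apply filter_imp.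
  intros q [K [K1 K2]].
  change (norm (minus (minus (f q) (f p)) (dot2 d (minus q p)))) with
    (Rabs (f q - f p - dot2 d (minus q p))).
  eapply Rle_trans. apply K.
  replace (pos eps) with (eps/2 + eps/2) by field. rewrite Hd in *.
  apply dot2_bound.
  - change (fst (minus (a q) d)) with (fst (a q) - fst d). lra.
  - change (snd (minus (a q) d)) with (snd (a q) - snd d). lra.
Qed.

Lemma is_grad_carath (f : R2 -> R) (p d : R2) (a : R2 -> R2) :
  continuous a p -> a p = d ->
  locally p (fun q => f q - f p = dot2 (a q) (minus q p)) ->
  is_grad f p d.
Proof.
  intros Ha Hd H. apply (is_grad_squeeze f p d a); trivial.
  apply filter_imp with (2 := H). intros q Hq. rewrite Hq. right. f_equal.
  unfold dot2, minus, plus, opp; simpl; unfold plus, opp; simpl. ring.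
Qed.

Lemma sum_squares_eq0 (a b : R) : a * a + b * b = 0 -> a = 0 /\ b = 0.
Proof. intros; nra. Qed.

Lemma dot2_self_pos (z : R2) : z <> zero -> 0 < dot2 z z.
Proof. intros H; apply R2_neq in H. unfold dot2. destruct H as [H|H]; nra. Qed.

Lemma norm_sqr (z : R2) : norm z * norm z = dot2 z z.
Proof.
  change (norm z) with (sqrt (Rabs (fst z) ^ 2 + Rabs (snd z) ^ 2)).
  rewrite sqrt_sqrt. 2: generalize (pow2_ge_0 (Rabs (fst z))) (pow2_ge_0 (Rabs (snd z))); lra.
  rewrite 2!pow2_abs. unfold dot2; ring.
Qed.

(** Spreading the remainder along q - p gives slopes that depend continuously on q at p.
    In this form a derivative survives the inversion of a map of which only continuity
    of the inverse is known. *)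
Lemma is_grad_carath_inv (f : R2 -> R) (p d : R2) :
  is_grad f p d -> exists a : R2 -> R2, continuous a p /\ a p = d /\
    forall q, f q - f p = dot2 (a q) (minus q p).
Proof.
  intros [_ H].
  assert (Hp : is_filter_lim (locally p) p) by (intros P HP; exact HP).
  specialize (H p Hp).
  pose (r := fun q => f q - f p - dot2 d (minus q p)).
  (* at q = p the quotient has denominator 0, but it multiplies q - p = 0 *)
  exists (fun q => plus d (scal (r q / dot2 (minus q p) (minus q p)) (minus q p))).
  assert (E : plus d (scal (r p / dot2 (minus p p) (minus p p)) (minus p p)) = d).
  { set (k := r p / _). apply R2_eq.
    - coords; ring.
    - coords; ring. }
  assert (key : forall eps : posreal, locally p (fun q =>
     norm (scal (r q / dot2 (minus q p) (minus q p)) (minus q p)) <= eps)).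
  { intros eps. generalize (H eps). apply filter_imp. intros q Hq.
    change (Rabs (r q) <= eps * norm (minus q p)) in Hq.
    set (z := minus q p) in *.

    eapply Rle_trans. apply (norm_scal (r q / dot2 z z) z).
    change (Rabs (r q / dot2 z z) * norm z <= eps).
    destruct (Req_dec (norm z) 0) as [Z|Z].
    - rewrite Z, Rmult_0_r. apply Rlt_le, cond_pos.
    - assert (0 < norm z). { destruct (norm_ge_0 z) as [?|Hz]; trivial. exfalso; now apply Z. }
      rewrite <- norm_sqr. unfold Rdiv. rewrite Rabs_mult, Rabs_inv, Rabs_mult, (Rabs_pos_eq (norm z)) by lra.
      replace (Rabs (r q) * / (norm z * norm z) * norm z) with (Rabs (r q) / norm z) by (field; lra).
      apply Rle_div_l; lra. }
  split; [|split; trivial].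
  - apply filterlim_locally. intros eps. rewrite E.
    assert (He : 0 < eps / 2) by (generalize (cond_pos eps); lra).
    generalize (key (mkposreal _ He)). apply filter_imp. intros q Hq.
    simpl in Hq. clear E. set (v := scal (r q / _) _) in *.
    split.
    + change (Rabs (fst d + fst v - fst d) < eps).
      rewrite Rplus_minus_l.
      generalize (norm_fst v) (cond_pos eps). lra.
    + change (Rabs (snd d + snd v - snd d) < eps).
      rewrite Rplus_minus_l.
      generalize (norm_snd v) (cond_pos eps). lra.
  - intros q. set (z := minus q p) in *.
    replace (dot2 (plus d (scal (r q / dot2 z z) z)) z) with
      (dot2 d z + r q / dot2 z z * dot2 z z).
    2: { unfold dot2, plus, scal; simpl; unfold plus, scal; simpl; unfold mult; simpl; ring. }
    destruct (Req_dec (dot2 z z) 0) as [Z|Z].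
    + assert (q = p).
      { change ((fst q + - fst p) * (fst q + - fst p) + (snd q + - snd p) * (snd q + - snd p) = 0) in Z.
        destruct (sum_squares_eq0 _ _ Z) as [Z1 Z2].
        apply R2_eq; apply Rminus_diag_uniq; assumption. }
      subst q. rewrite Z.
      coords; ring.
    + unfold r. fold z. field. exact Z.
Qed.

Lemma plus_scal0 (p v : R2) : plus p (scal 0 v) = p.
Proof.
  apply R2_eq; coords; ring.
Qed.

Lemma is_grad_local_max f p d :
  is_grad f p d -> locally p (fun q => f q <= f p) -> d = zero.
Proof.
  intros H Hm.
  assert (K : forall v, dot2 d v = 0).
  { intros v. assert (Hd := is_grad_dder f p d v H).
    apply is_derive_Reals in Hd.
    assert (Hl : locally 0 (fun t => f (plus p (scal t v)) <= f p)).
    { assert (Hc : continuous (fun t : R => plus p (scal t v)) 0).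
      { apply (continuous_pt2 (fun t : R => fst p + t * fst v) (fun t : R => snd p + t * snd v));
        apply cont_plus; try apply continuous_const; apply cont_mult;
        try apply continuous_const; apply continuous_id. }
      apply (Hc (fun z => f z <= f p)). now rewrite plus_scal0. }
    destruct Hl as [e He].
    assert (pr : derivable_pt (fun t => f (plus p (scal t v))) 0) by (exists (dot2 d v); exact Hd).
    rewrite <- (derive_pt_eq_0 _ _ _ pr Hd).
    apply (deriv_maximum _ (-e) e 0).
    - generalize (cond_pos e); lra.
    - apply cond_pos.
    - intros x H1 H2.
      rewrite plus_scal0.
      apply He. change (Rabs (x - 0) < e). apply Rabs_def1; lra. }
  apply R2_eq.
  - assert (E := K (pt2 1 0)). change (fst d * 1 + snd d * 0 = 0) in E.
    rewrite Rmult_1_r, Rmult_0_r, Rplus_0_r in E. exact E.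
  - assert (E := K (pt2 0 1)). change (fst d * 0 + snd d * 1 = 0) in E.
    rewrite Rmult_1_r, Rmult_0_r, Rplus_0_l in E. exact E.
Qed.

(** * Directional derivatives and plane sections of the Wulff shape *)

Ltac rring := match goal with |- @eq _ ?a ?b => change (@eq R a b) end; ring.

Lemma class_C_continuous {V : NormedModule R_AbsRing} k (U : V -> Prop) f :
  class_C k U f -> forall x, U x -> continuous f x.
Proof. destruct k; intros [H _]; exact H. Qed.

Lemma class_C_ex_derive {V : NormedModule R_AbsRing} k (U : V -> Prop) f :
  class_C (S k) U f -> forall x v, U x -> ex_derive (fun t => f (plus x (scal t v))) 0.
Proof. intros [_ H] x v Hx. now apply (H v). Qed.

Lemma class_C_dder {V : NormedModule R_AbsRing} k (U : V -> Prop) f v :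
  class_C (S k) U f -> class_C k U (dder v f).
Proof. intros [_ H]. now apply (H v). Qed.

Lemma line_derive {V : NormedModule R_AbsRing} (f : V -> R) x v s :
  ex_derive (fun t => f (plus (plus x (scal s v)) (scal t v))) 0 ->
  is_derive (fun t => f (plus x (scal t v))) s (dder v f (plus x (scal s v))).
Proof.
  intros H. apply Derive_correct in H. fold (dder v f (plus x (scal s v))) in H.
  apply (is_derive_ext (fun t : R => (fun t => f (plus (plus x (scal s v)) (scal t v))) (t - s))).
  { intros t. f_equal. rewrite <- plus_assoc. f_equal.
    rewrite <- (scal_distr_r s (t - s) v). f_equal. unfold plus; simpl. ring. }
  replace (dder v f (plus x (scal s v))) with (scal 1 (dder v f (plus x (scal s v)))) by apply Rmult_1_l.
  apply (is_derive_comp (fun t : R => f (plus (plus x (scal s v)) (scal t v))) (fun t : R => t - s)).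
  - replace (s - s) with 0 by ring. exact H.
  - auto_derive; trivial; ring.
Qed.

(** f(x + tv + tw) - f(x + tv) is t times a derivative along w at a nearby point, by the
    mean value theorem, and this derivative is continuous. *)
Lemma dder_add {V : NormedModule R_AbsRing} (f : V -> R) x v w :
  ex_derive (fun t => f (plus x (scal t v))) 0 ->
  locally x (fun y => ex_derive (fun t => f (plus y (scal t w))) 0) ->
  continuous (dder w f) x ->
  dder (plus v w) f x = dder v f x + dder w f x.
Proof.
  intros Hv Hw Hc. apply is_derive_unique.
  apply Derive_correct in Hv. fold (dder v f x) in Hv.
  apply (is_derive_ext (fun t => f (plus x (scal t v)) +
     (f (plus (plus x (scal t v)) (scal t w)) - f (plus x (scal t v))))).
  { intros t. transitivity (f (plus (plus x (scal t v)) (scal t w))). rring.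
    f_equal. rewrite <- plus_assoc. f_equal. symmetry. apply (scal_distr_l (V := V) t v w). }
  apply (is_derive_plus (V := R_NormedModule)); trivial.
  split. apply is_linear_scal_l.
  intros z Hz. assert (Ez : (0 : R) = z) by exact (is_filter_lim_locally_unique (V := R_NormedModule) _ _ Hz). subst z.
  intros eps.
  assert (E0 : forall (y u : V), plus y (scal 0 u) = y).
  { intros y u. etransitivity; [|apply plus_zero_r]. f_equal. apply (scal_zero_l (V := V) u). }
  assert (K := filter_and _ _ Hw (cont_close _ _ eps Hc (cond_pos eps))).
  assert (Hcont : continuous (fun u : R * R => plus (plus x (scal (fst u) v)) (scal (snd u) w)) (0, 0)).
  { apply (continuous_plus (U := prod_UniformSpace R_UniformSpace R_UniformSpace)).
    apply (continuous_plus (U := prod_UniformSpace R_UniformSpace R_UniformSpace)).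
    - apply continuous_const.
    - apply (continuous_scal_l (U := prod_UniformSpace R_UniformSpace R_UniformSpace) (fun u => fst u)).
      apply continuous_fst.
    - apply (continuous_scal_l (U := prod_UniformSpace R_UniformSpace R_UniformSpace) (fun u => snd u)).
      apply continuous_snd. }
  assert (K' : locally (0,0) (fun u : R * R =>
    let y := plus (plus x (scal (fst u) v)) (scal (snd u) w) in
    ex_derive (fun t => f (plus y (scal t w))) 0 /\ Rabs (dder w f y - dder w f x) < eps)).
  { apply (Hcont (fun y => ex_derive (fun t => f (plus y (scal t w))) 0 /\ Rabs (dder w f y - dder w f x) < eps)).
    cbn [fst snd]. replace (plus (plus x (scal 0 v)) (scal 0 w)) with x. exact K.
    symmetry. etransitivity; [apply E0 | apply E0]. }
  destruct K' as [d Hd]. exists d. intros t Ht.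
  change (Rabs (t - 0) < d) in Ht. rewrite Rminus_0_r in Ht.
  change (Rabs ((f (plus (plus x (scal t v)) (scal t w)) - f (plus x (scal t v)))
    - (f (plus (plus x (scal 0 v)) (scal 0 w)) - f (plus x (scal 0 v))) - (t - 0) * dder w f x) <= eps * Rabs (t - 0)).
  assert (E1 : plus (plus x (scal 0 v)) (scal 0 w) = x) by (etransitivity; apply E0).
  rewrite E1, (E0 x v : plus x (scal 0 v) = x), Rminus_0_r.
  assert (Hs : forall s, Rmin 0 t <= s <= Rmax 0 t ->
     is_derive (fun s => f (plus (plus x (scal t v)) (scal s w))) s
        (dder w f (plus (plus x (scal t v)) (scal s w))) /\
     Rabs (dder w f (plus (plus x (scal t v)) (scal s w)) - dder w f x) < eps).
  { intros s Hs.
    assert (Hs' : Rabs s < d).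
    { apply Rabs_def2 in Ht. apply Rabs_def1; unfold Rmin, Rmax in Hs; destruct (Rle_dec 0 t); lra. }
    destruct (Hd (t, s)) as [H1 H2].
    { split; [change (Rabs (t - 0) < d)|change (Rabs (s - 0) < d)]; rewrite Rminus_0_r; trivial. }
    split; trivial. now apply line_derive. }
  destruct (MVT_gen (fun s => f (plus (plus x (scal t v)) (scal s w))) 0 t
     (fun s => dder w f (plus (plus x (scal t v)) (scal s w)))) as [c [Hc1 Hc2]].
  - intros s H. apply Hs. lra.
  - intros s H. apply continuity_pt_filterlim.
    apply (ex_derive_continuous (fun s : R => f (plus (plus x (scal t v)) (scal s w)))).
    eexists. apply Hs. exact H.
  - destruct (Hs c Hc1) as [_ H2].
    rewrite (E0 _ w : plus (plus x (scal t v)) (scal 0 w) = plus x (scal t v)) in Hc2.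
    match type of Hc2 with ?a = _ => change (Rabs (a - (f x - f x) - t * dder w f x) <= eps * Rabs t) end.
    rewrite Hc2.
    replace (_ - _ - _) with ((dder w f (plus (plus x (scal t v)) (scal c w)) - dder w f x) * t) by rring.
    rewrite Rabs_mult. apply Rmult_le_compat_r. apply Rabs_pos. lra.
Qed.

Lemma dder_scal {V : NormedModule R_AbsRing} (f : V -> R) x k v :
  ex_derive (fun t => f (plus x (scal t v))) 0 ->
  dder (scal k v) f x = k * dder v f x.
Proof.
  intros H. apply is_derive_unique.
  apply Derive_correct in H.
  apply (is_derive_ext (fun t : R => (fun t => f (plus x (scal t v))) (t * k))).
  { intros t. simpl. f_equal. f_equal. now rewrite scal_assoc. }
  apply (is_derive_comp (fun t : R => f (plus x (scal t v))) (fun t : R => t * k)).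
  - rewrite Rmult_0_l. exact H.
  - auto_derive; trivial; ring.
Qed.

Lemma R3_eq (p q : R3) : fst p = fst q -> snd p = snd q -> p = q.
Proof. destruct p, q; simpl; intros; subst; reflexivity. Qed.

Lemma grad3_dder (f : R3 -> R) (U : R3 -> Prop) x v :
  class_C 1 U f -> locally x U -> dot3 (grad3 f x) v = dder v f x.
Proof.
  intros Hf HU.
  assert (Hx : U x) by now apply locally_singleton in HU.
  assert (ex : forall w, ex_derive (fun t => f (plus x (scal t w))) 0)
    by (intros; eapply class_C_ex_derive; eauto).
  assert (exl : forall w, locally x (fun y => ex_derive (fun t => f (plus y (scal t w))) 0)).
  { intros w. apply filter_imp with (2 := HU). intros; eapply class_C_ex_derive; eauto. }
  assert (cc : forall w, continuous (dder w f) x).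
  { intros w. apply (class_C_continuous 0 U); trivial. now apply class_C_dder. }
  replace v with (plus (plus (scal (fst (fst v)) (pt3 1 0 0)) (scal (snd (fst v)) (pt3 0 1 0)))
     (scal (snd v) (pt3 0 0 1))).
  2:{ destruct v as [[a b] c]. apply R3_eq; [apply R2_eq|].
      - coords; ring.
      - coords; ring.
      - coords; ring. }
  rewrite !dder_add, !dder_scal; trivial.
  destruct v as [[a b] c].
  set (A := dder (pt3 1 0 0) f x). set (B := dder (pt3 0 1 0) f x). set (C := dder (pt3 0 0 1) f x).
  change (A * (a * 1 + b * 0 + c * 0) + B * (a * 0 + b * 1 + c * 0) + C * (a * 0 + b * 0 + c * 1) = a * A + b * B + c * C).
  ring.
Qed.

Lemma open_neq_R3 : open (fun p : R3 => p <> zero).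
Proof.
  intros p Hp.
  destruct (Classical_Prop.classic (fst p = zero)) as [E|E].
  - assert (H : snd p <> 0). { intros E'. apply Hp, R3_eq; trivial. }
    apply filter_imp with (fun q : R3 => snd q <> 0).
    + intros q Hq E'. apply Hq. now rewrite E'.
    + apply (cont_neq0 (fun q : R3 => snd q)); trivial. destruct p; apply continuous_snd.
  - apply filter_imp with (fun q : R3 => fst q <> zero).
    + intros q Hq E'. apply Hq. now rewrite E'.
    + assert (Hc : continuous (fun q : R3 => fst q) p) by (destruct p; apply continuous_fst).
      apply (Hc (fun z => z <> zero)). now apply open_nonzero.
Qed.

Lemma class_C_C1_at (f : R2 -> R) (U : R2 -> Prop) p :
  class_C 1 U f -> locally p U -> C1_at f p.
Proof.
  intros Hf HU.
  exists (grad2 f). split.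
  - assert (Hp : U p) by now apply locally_singleton in HU.
    apply (continuous_pt2 (dder (pt2 1 0) f) (dder (pt2 0 1) f));
    apply (class_C_continuous 0 U); trivial; now apply class_C_dder.
  - apply locally_locally in HU. apply filter_imp with (2 := HU). clear p HU.
    intros p HU.
    assert (Hp : U p) by now apply locally_singleton in HU.
    destruct p as [x y].
    apply filterdiff_ext_lin with (fun u : R2 => plus (scal (fst u) (dder (pt2 1 0) f (pt2 x y))) (scal (snd u) (dder (pt2 0 1) f (pt2 x y)))).
    2:{ intros [a b]. unfold dot2, grad2.
        coords; ring. }
    apply filterdiff_ext with (fun u : R2 => (fun a b => f (pt2 a b)) (fst u) (snd u)).
    { intros [a b]; reflexivity. }
    apply (is_derive_filterdiff (fun a b => f (pt2 a b)) x y (fun a b => dder (pt2 1 0) f (pt2 a b)) (dder (pt2 0 1) f (pt2 x y))).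
    + apply filter_imp with (2 := HU). intros [a b] Hab.
      apply (is_derive_ext (fun t : R => f (plus (pt2 0 b) (scal t (pt2 1 0))))).
      { intros t. f_equal. apply R2_eq.
        coords; ring. coords; ring. }
      assert (E : plus (pt2 0 b) (scal (a : R) (pt2 1 0)) = pt2 a b).
      { apply R2_eq. coords; ring. coords; ring. }
      simpl fst; simpl snd. rewrite <- E.
      apply line_derive. apply (class_C_ex_derive 0 U f Hf). refine (eq_ind_r U _ E). assumption.
    + apply (is_derive_ext (fun t : R => f (plus (pt2 x 0) (scal t (pt2 0 1))))).
      { intros t. f_equal. apply R2_eq.
        coords; ring. coords; ring. }
      assert (E : plus (pt2 x 0) (scal (y : R) (pt2 0 1)) = pt2 x y).
      { apply R2_eq. coords; ring. coords; ring. }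
      rewrite <- E.
      apply line_derive. apply (class_C_ex_derive 0 U f Hf). refine (eq_ind_r U _ E). assumption.
    + apply (continuous_ext (dder (pt2 1 0) f)). { intros [a b]; reflexivity. }
      apply (class_C_continuous 0 U); trivial; now apply class_C_dder.
Qed.

Lemma is_norm_zero {V : NormedModule R_AbsRing} (n : V -> R) : is_norm n -> n zero = 0.
Proof.
  intros (_ & _ & H & _). assert (K := H 0 zero).
  rewrite (scal_zero_l zero : scal 0 zero = zero), Rabs_R0, Rmult_0_l in K. exact K.
Qed.

(** On a tangent vector the normal curvature is the second derivative divided by a
    nonnegative quantity.  As [iota] is linear, derivatives of [n] along [v] are
    derivatives of [N] along [iota v], so strict curvature passes to plane sections of
    the unit sphere. *)
Lemma curvature_plane (N : R3 -> R) (n : R2 -> R) (iota : R2 -> R3) :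
  smooth_norm N -> uniformly_positive_curvature N ->
  (forall p q, iota (plus p q) = plus (iota p) (iota q)) ->
  (forall t p, iota (scal t p) = scal t (iota p)) ->
  (forall p, iota p = zero -> p = zero) ->
  (forall p, N (iota p) = n p) ->
  forall q v, n q = 1 -> v <> zero -> dder v n q = 0 -> 0 < dder v (dder v n) q.
Proof.
  intros [HN HS] [kap [Hk HK]] Hp Hs Hi Hn q v Hq Hv Hd.
  assert (E1 : forall z, dder v n z = dder (iota v) N (iota z)).
  { intros z. apply Derive_ext. intros t. now rewrite <- Hs, <- Hp, Hn. }
  assert (E2 : dder v (dder v n) q = dder (iota v) (dder (iota v) N) (iota q)).
  { apply Derive_ext. intros t. now rewrite <- Hs, <- Hp, E1. }
  assert (Hnz : iota q <> zero).
  { intros E. generalize (Hn q). rewrite E, (is_norm_zero _ HN). lra. }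
  rewrite E2.
  assert (K := HK (iota q) (iota v)).
  rewrite Hn in K. specialize (K Hq).
  assert (Hv' : iota v <> zero) by (intros E; apply Hv, Hi, E).
  specialize (K Hv').
  assert (T : dot3 (grad3 N (iota q)) (iota v) = 0).
  { rewrite (grad3_dder N (fun x => x <> zero)), <- E1; trivial.
    apply open_neq_R3, Hnz. }
  specialize (K T). unfold normal_curvature in K.
  set (D := dder (iota v) (dder (iota v) N) (iota q)) in *. set (e := enorm3 _) in *. set (w := dot3 (iota v) (iota v)) in *.
  assert (He : 0 <= e) by apply sqrt_pos.
  assert (Hw : 0 <= w).
  { unfold w, dot3, dot2. destruct (iota v) as [[a b] c].
    change (0 <= a * a + b * b + c * c). nra. }
  assert (Hi' : 0 <= / (e * w)).
  { destruct (Req_dec (e * w) 0) as [Z|Z]. rewrite Z, Rinv_0; lra.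
    apply Rlt_le, Rinv_0_lt_compat. nra. }
  unfold Rdiv in K. destruct (Rle_lt_dec D 0); trivial. nra.
Qed.

(** * Norms of the plane and their duals *)

Section Norm.
Variable n : R2 -> R.
Hypothesis Hn : is_norm n.

Lemma nrm_ge0 x : 0 <= n x.
Proof. apply Hn. Qed.
Lemma nrm_scal t x : n (scal t x) = Rabs t * n x.
Proof. apply Hn. Qed.
Lemma nrm_triang x y : n (plus x y) <= n x + n y.
Proof. apply Hn. Qed.
Lemma nrm_pos x : x <> zero -> 0 < n x.
Proof.
  intros H. destruct (nrm_ge0 x) as [|E]; trivial. exfalso; apply H, Hn. now symmetry.
Qed.
Lemma nrm_0 : n zero = 0.
Proof. now apply is_norm_zero. Qed.
Lemma nrm_nz x : n x <> 0 -> x <> zero.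
Proof. intros H E. apply H. subst. apply nrm_0. Qed.
Lemma nrm_opp x : n (opp x) = n x.
Proof.
  replace (opp x) with (scal (-1) x).
  - rewrite nrm_scal, Rabs_left by lra. ring.
  - apply R2_eq; coords; ring.
Qed.

Lemma nrm_le_l1 x : n x <= Rabs (fst x) * n (pt2 1 0) + Rabs (snd x) * n (pt2 0 1).
Proof.
  rewrite <- 2!nrm_scal.
  replace x with (plus (scal (fst x) (pt2 1 0)) (scal (snd x) (pt2 0 1))) at 1.
  - apply nrm_triang.
  - destruct x as [a b]. apply R2_eq; coords; ring.
Qed.

Lemma nrm_lip x y : Rabs (n x - n y) <= n (minus x y).
Proof.
  assert (H1 := nrm_triang (minus x y) y). assert (H2 := nrm_triang (minus y x) x).
  assert (E : forall a b : R2, plus (minus a b) b = a).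
  { intros a b. apply R2_eq; coords; ring. }
  rewrite !E in *.
  assert (H3 : n (minus y x) = n (minus x y)).
  { rewrite <- nrm_opp. f_equal. apply opp_minus. }
  apply Rabs_le. lra.
Qed.

Lemma nrm_continuous x : continuous n x.
Proof.
  apply cont_of_close. intros eps He.
  set (c := n (pt2 1 0) + n (pt2 0 1) + 1).
  assert (Hc : 0 < c) by (unfold c; generalize (nrm_ge0 (pt2 1 0)) (nrm_ge0 (pt2 0 1)); lra).
  assert (Hec : 0 < eps / c) by now apply Rdiv_lt_0_compat.
  assert (H1 := cont_close (fun q : R2 => fst q) x _ (continuous_fst_R2 _ x (continuous_id x)) Hec).
  assert (H2 := cont_close (fun q : R2 => snd q) x _ (continuous_snd_R2 _ x (continuous_id x)) Hec).
  generalize (filter_and _ _ H1 H2). apply filter_imp. intros q [K1 K2].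
  eapply Rle_lt_trans. apply nrm_lip.
  eapply Rle_lt_trans. apply nrm_le_l1.
  change (Rabs (fst q - fst x) * n (pt2 1 0) + Rabs (snd q - snd x) * n (pt2 0 1) < eps).
  replace eps with (eps / c * c) by (field; lra).
  set (e := eps / c) in *. unfold c.
  generalize (nrm_ge0 (pt2 1 0)) (nrm_ge0 (pt2 0 1)). intros. nra.
Qed.
End Norm.

(** Half of the unit sphere of the l1 norm: a compact arc that meets every line through
    the origin. *)
Definition l1arc (t : R) : R2 := pt2 t (1 - Rabs t).

Lemma l1arc_neq0 t : l1arc t <> zero.
Proof.
  apply R2_neq. unfold l1arc; simpl. destruct (Req_dec t 0); [right|now left].
  subst. rewrite Rabs_R0. lra.
Qed.
Lemma l1arc_continuous t : continuous l1arc t.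
Proof.
  apply (continuous_pt2 (fun t : R => t) (fun t : R => 1 - Rabs t)). apply continuous_id.
  apply cont_minus. apply continuous_const. apply continuous_Rabs.
Qed.
Lemma l1_polar (y : R2) : exists s t : R, Rabs s = Rabs (fst y) + Rabs (snd y) /\
  -1 <= t <= 1 /\ y = scal s (l1arc t).
Proof.
  destruct y as [a b]. simpl. change R in a, b.
  set (r := Rabs a + Rabs b).
  assert (Ha := Rabs_pos a). assert (Hb := Rabs_pos b).
  destruct (Req_dec r 0) as [Z|Z].
  - exists 0, 0. rewrite Rabs_R0. split. now symmetry. split. lra.
    unfold r in Z. apply R2_eq.
    + change (a = 0 * 0). rewrite Rmult_0_l. apply Rabs_eq_0. lra.
    + change (b = 0 * (1 - Rabs 0)). rewrite Rmult_0_l. apply Rabs_eq_0. lra.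
  - assert (Hr : 0 < r) by (unfold r in *; lra).
    assert (Har : 0 <= Rabs a / r <= 1).
    { split. apply Rdiv_le_0_compat; lra. apply Rle_div_l; unfold r in *; lra. }
    destruct (Rle_lt_dec 0 b) as [B|B].
    + exists r, (a / r). split; [apply Rabs_pos_eq; lra|].
      assert (E : Rabs (a / r) = Rabs a / r).
      { unfold Rdiv. rewrite Rabs_mult, Rabs_inv, (Rabs_pos_eq r); trivial; lra. }
      split. { apply Rabs_le_between. rewrite E. lra. }
      apply R2_eq.
      * coords; field. lra.
      * change (b = r * (1 - Rabs (a / r))). rewrite E.
        replace (r * (1 - Rabs a / r)) with (r - Rabs a) by (field; lra).
        unfold r. rewrite (Rabs_pos_eq b); trivial. ring.
    + exists (-r), (- a / r). split; [rewrite Rabs_Ropp; apply Rabs_pos_eq; lra|].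
      assert (E : Rabs (- a / r) = Rabs a / r).
      { unfold Rdiv. rewrite Rabs_mult, Rabs_inv, (Rabs_pos_eq r), Rabs_Ropp; trivial; lra. }
      split. { apply Rabs_le_between. rewrite E. lra. }
      apply R2_eq.
      * coords; field. lra.
      * change (b = -r * (1 - Rabs (- a / r))). rewrite E.
        replace (-r * (1 - Rabs a / r)) with (- (r - Rabs a)) by (field; lra).
        unfold r. rewrite (Rabs_left b); trivial. ring.
Qed.

Lemma dot2_plus_r (x y z : R2) : dot2 x (plus y z) = dot2 x y + dot2 x z.
Proof. unfold dot2, plus; simpl; unfold plus; simpl; ring. Qed.
Lemma dot2_scal_r (x y : R2) t : dot2 x (scal t y) = t * dot2 x y.
Proof. unfold dot2, scal; simpl; unfold scal; simpl; unfold mult; simpl; ring. Qed.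
Lemma dot2_plus_l (x y z : R2) : dot2 (plus x y) z = dot2 x z + dot2 y z.
Proof. unfold dot2, plus; simpl; unfold plus; simpl; ring. Qed.
Lemma dot2_scal_l (x y : R2) t : dot2 (scal t x) y = t * dot2 x y.
Proof. unfold dot2, scal; simpl; unfold scal; simpl; unfold mult; simpl; ring. Qed.
Lemma dot2_sym (x y : R2) : dot2 x y = dot2 y x.
Proof. unfold dot2; ring. Qed.
Lemma dot2_zero_l (x : R2) : dot2 zero x = 0.
Proof. unfold dot2. coords; ring. Qed.

Lemma cont_dot2 {U : UniformSpace} (f g : U -> R2) p :
  continuous f p -> continuous g p -> continuous (fun q => dot2 (f q) (g q)) p.
Proof.
  intros Hf Hg.
  exact (cont_plus _ _ _
    (cont_mult _ _ _ (continuous_fst_R2 _ _ Hf) (continuous_fst_R2 _ _ Hg))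
    (cont_mult _ _ _ (continuous_snd_R2 _ _ Hf) (continuous_snd_R2 _ _ Hg))).
Qed.

Lemma dual_norm_max {V : NormedModule R_AbsRing} (dot : V -> V -> R) (n : V -> R) x xi :
  n xi = 1 -> (forall eta, n eta = 1 -> dot x eta <= dot x xi) ->
  dual_norm dot n x = dot x xi.
Proof.
  intros H1 H2. unfold dual_norm.
  rewrite (is_lub_Rbar_unique _ (Finite (dot x xi))); trivial.
  split.
  - intros r [eta [He ->]]. now apply H2.
  - intros b Hb. apply Hb. now exists xi.
Qed.

Section Dual.
Variable n : R2 -> R.
Hypothesis Hn : is_norm n.

(** The quotient |x.y| / n(y) is constant on lines through the origin, so its maximum
    over the compact arc is a maximum over all directions. *)
Lemma dual2_attained x : exists xi, n xi = 1 /\ dual2 n x = dot2 x xi /\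
  forall eta, dot2 x eta <= dual2 n x * n eta.
Proof.
  destruct (continuity_ab_maj (fun t => Rabs (dot2 x (l1arc t)) / n (l1arc t)) (-1) 1) as [t0 [Ht0 _]].
  { lra. }
  { intros t _. apply continuity_pt_filterlim.
    apply (cont_div (fun t : R => Rabs (dot2 x (l1arc t))) (fun t : R => n (l1arc t))).
    - apply (cont_abs (fun t : R => dot2 x (l1arc t))), cont_dot2. apply continuous_const. apply l1arc_continuous.
    - apply (continuous_comp l1arc n). apply l1arc_continuous. apply (nrm_continuous n Hn).
    - apply Rgt_not_eq. apply (nrm_pos n Hn). apply l1arc_neq0. }
  set (M := Rabs (dot2 x (l1arc t0)) / n (l1arc t0)) in *.
  assert (P0 : 0 < n (l1arc t0)) by (apply nrm_pos; trivial; apply l1arc_neq0).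
  assert (HM : forall eta, dot2 x eta <= M * n eta).
  { intros eta. destruct (l1_polar eta) as (s & t & _ & Ht & ->).
    rewrite (nrm_scal n Hn), dot2_scal_r; trivial.
    specialize (Ht0 t Ht).
    assert (P : 0 < n (l1arc t)) by (apply nrm_pos; trivial; apply l1arc_neq0).
    apply (proj1 (Rle_div_l _ _ _ P)) in Ht0.
    eapply Rle_trans. apply Rle_abs. rewrite Rabs_mult.
    replace (M * (Rabs s * n (l1arc t))) with (Rabs s * (M * n (l1arc t))) by ring.
    apply Rmult_le_compat_l; trivial. apply Rabs_pos. }
  assert (Hxi : exists xi, n xi = 1 /\ dot2 x xi = M).
  { unfold M. destruct (Rle_lt_dec 0 (dot2 x (l1arc t0))) as [B|B].
    - exists (scal (/ n (l1arc t0)) (l1arc t0)).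
      rewrite (nrm_scal n Hn), dot2_scal_r, Rabs_inv, !Rabs_pos_eq; trivial; try lra.
      split; field; lra.
    - exists (scal (- / n (l1arc t0)) (l1arc t0)).
      rewrite (nrm_scal n Hn), dot2_scal_r, Rabs_Ropp, Rabs_inv, (Rabs_pos_eq (n _)), Rabs_left; trivial; try lra.
      split; field; lra. }
  destruct Hxi as [xi [H1 H2]]. exists xi.
  assert (E : dual2 n x = dot2 x xi).
  { apply dual_norm_max; trivial. intros eta He. specialize (HM eta). rewrite He in HM. lra. }
  split; trivial. split; trivial. intros eta. rewrite E, H2. apply HM.
Qed.

Lemma dual2_le x y : dot2 x y <= dual2 n x * n y.
Proof. destruct (dual2_attained x) as (xi & _ & _ & H). apply H. Qed.

Lemma dual2_eq x xi : n xi = 1 -> (forall eta, n eta = 1 -> dot2 x eta <= dot2 x xi) ->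
  dual2 n x = dot2 x xi.
Proof. apply dual_norm_max. Qed.

Lemma dual2_ge0 x : 0 <= dual2 n x.
Proof.
  destruct (dual2_attained x) as (xi & H1 & H2 & H3).
  assert (K := H3 (opp xi)). rewrite (nrm_opp n Hn), H1 in K; trivial.
  replace (dot2 x (opp xi)) with (- dot2 x xi) in K. lra.
  unfold dot2, opp; simpl; unfold opp; simpl; ring.
Qed.

Lemma dual2_is_norm : is_norm (dual2 n).
Proof.
  split; [exact dual2_ge0|split;[|split]].
  - intros x Hx. destruct (classic (x = zero)) as [|N]; trivial.
    assert (K := dual2_le x x). rewrite Hx, Rmult_0_l in K.
    apply dot2_self_pos in N. lra.
  - intros t x. destruct (dual2_attained x) as (xi & H1 & H2 & H3).
    destruct (Rle_lt_dec 0 t) as [T|T].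
    + rewrite Rabs_pos_eq; trivial. rewrite H2, <- dot2_scal_l.
      apply dual2_eq; trivial. intros eta He. rewrite !dot2_scal_l.
      apply Rmult_le_compat_l; trivial. rewrite <- H2. specialize (H3 eta). rewrite He in H3. lra.
    + rewrite Rabs_left; trivial. rewrite H2.
      replace (- t * dot2 x xi) with (dot2 (scal t x) (opp xi)).
      2:{ unfold dot2, opp, scal; simpl; unfold opp, scal; simpl; unfold mult; simpl; ring. }
      apply dual2_eq. { now rewrite (nrm_opp n Hn). } intros eta He. rewrite !dot2_scal_l.
      specialize (H3 (opp eta)). rewrite (nrm_opp n Hn), He in H3; trivial.
      replace (dot2 x (opp eta)) with (- dot2 x eta) in H3
       by (unfold dot2, opp; simpl; unfold opp; simpl; ring).
      replace (dot2 x (opp xi)) with (- dot2 x xi)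
       by (unfold dot2, opp; simpl; unfold opp; simpl; ring). nra.
  - intros x y. destruct (dual2_attained (plus x y)) as (xi & H1 & H2 & _).
    rewrite H2, dot2_plus_l. generalize (dual2_le x xi) (dual2_le y xi). rewrite H1. lra.
Qed.

(** Positivity of the second fundamental form of the unit circle. *)
Definition curved : Prop :=
  forall q v, n q = 1 -> v <> zero -> dder v n q = 0 -> 0 < dder v (dder v n) q.

(** If two unit vectors maximise the pairing with x, so does the segment between them,
    which then lies on the unit circle.  Along it the second derivative of [n] vanishes,
    against strict curvature. *)
Lemma dual2_max_unique x xi xi' : curved -> x <> zero -> n xi = 1 -> n xi' = 1 ->
  dot2 x xi = dual2 n x -> dot2 x xi' = dual2 n x -> xi = xi'.
Proof.
  intros K Hx H1 H1' H2 H2'.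
  destruct (classic (xi = xi')) as [|N]; trivial. exfalso.
  set (v := plus xi' (opp xi)).
  assert (Hv : v <> zero).
  { intros E. apply N. apply R2_eq.
    - apply (f_equal fst) in E. change (fst xi' + - fst xi = 0) in E. toR. lra.
    - apply (f_equal snd) in E. change (snd xi' + - snd xi = 0) in E. toR. lra. }
  set (m := plus (scal (1/2) xi) (scal (1/2) xi')).
  assert (HD : 0 < dual2 n x) by (apply nrm_pos; trivial; apply dual2_is_norm).
  assert (E1 : forall t, Rabs t < 1/2 -> n (plus m (scal t v)) = 1).
  { intros t Ht. apply Rabs_def2 in Ht.
    assert (E : plus m (scal t v) = plus (scal (1/2 - t) xi) (scal (1/2 + t) xi')).
    { apply R2_eq.
      - coords; ring.
      - coords; ring. }
    rewrite E. apply Rle_antisym.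
    - eapply Rle_trans. apply (nrm_triang n Hn); trivial.
      rewrite !(nrm_scal n Hn), H1, H1', !Rabs_pos_eq; trivial; lra.
    - assert (L := dual2_le x (plus (scal (1/2 - t) xi) (scal (1/2 + t) xi'))).
      rewrite dot2_plus_r, !dot2_scal_r, H2, H2' in L. nra. }
  assert (E2 : forall t, Rabs t < 1/2 -> dder v n (plus m (scal t v)) = 0).
  { intros t Ht. unfold dder. rewrite (Derive_ext_loc _ (fun _ => 1)). apply Derive_const.
    assert (P : 0 < 1/2 - Rabs t) by lra.
    exists (mkposreal _ P). intros s Hs. change (Rabs (s - 0) < 1/2 - Rabs t) in Hs.
    rewrite Rminus_0_r in Hs.
    refine (eq_trans (f_equal n (_ : _ = plus m (scal (t + s) v))) _).
    - rewrite <- plus_assoc. f_equal. symmetry. apply (scal_distr_r t s v).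
    - apply E1. eapply Rle_lt_trans. apply Rabs_triang. lra. }
  assert (E0 : plus m (scal 0 v) = m) by apply plus_scal0.
  assert (Z : Rabs 0 < 1/2) by (rewrite Rabs_R0; lra).
  assert (Hm : n m = 1) by (rewrite <- E0; now apply E1).
  assert (Hdm : dder v n m = 0) by (rewrite <- E0; now apply E2).
  assert (C := K m v Hm Hv Hdm).
  replace (dder v (dder v n) m) with 0 in C. lra.
  symmetry. unfold dder at 1. rewrite (Derive_ext_loc _ (fun _ => 0)). apply Derive_const.
  assert (P : 0 < 1/2) by lra.
  exists (mkposreal _ P). intros s Hs. apply E2.
  change (Rabs (s - 0) < 1/2) in Hs. now rewrite Rminus_0_r in Hs.
Qed.
End Dual.

(** * Gradient and Hessian of a norm *)

Lemma is_grad_lin a b p : is_grad (fun z => a * fst z + b * snd z) p (pt2 a b).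
Proof. apply filterdiff_linear. apply (is_linear_dot2 (pt2 a b)). Qed.

Lemma pt2_eta (p : R2) : pt2 (fst p) (snd p) = p.
Proof. now destruct p. Qed.

Lemma is_grad_matrix f a b c e p d :
  is_grad f (pt2 (a * fst p + b * snd p) (c * fst p + e * snd p)) d ->
  is_grad (fun z => f (pt2 (a * fst z + b * snd z) (c * fst z + e * snd z))) p
    (pt2 (fst d * a + snd d * c) (fst d * b + snd d * e)).
Proof.
  intros H.
  exact (is_grad_comp2 f (fun z => a * fst z + b * snd z) (fun z => c * fst z + e * snd z) p d _ _ H (is_grad_lin a b p) (is_grad_lin c e p)).
Qed.

Lemma scal_matrix k (z : R2) : pt2 (k * fst z + 0 * snd z) (0 * fst z + k * snd z) = scal k z.
Proof. destruct z as [a b]. apply R2_eq; coords; ring. Qed.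
Lemma J_matrix (z : R2) : pt2 (0 * fst z + (-1) * snd z) (1 * fst z + 0 * snd z) = J z.
Proof. destruct z as [a b]. apply R2_eq; coords; ring. Qed.

Lemma is_grad_scal_arg f k p d : is_grad f (scal k p) d ->
  is_grad (fun z => f (scal k z)) p (scal k d).
Proof.
  intros H. rewrite <- scal_matrix in H. apply is_grad_matrix in H.
  eapply is_grad_ext_loc.
  2: { replace (scal k d) with (pt2 (fst d * k + snd d * 0) (fst d * 0 + snd d * k)). exact H.
    destruct d as [a b]. apply R2_eq; coords; ring. }
  apply filter_forall. intros z. now rewrite scal_matrix.
Qed.

Lemma is_grad_J_arg f p d : is_grad f (J p) d -> is_grad (fun z => f (J z)) p (opp (J d)).
Proof.
  intros H. rewrite <- J_matrix in H. apply is_grad_matrix in H.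
  eapply is_grad_ext_loc.
  2: { replace (opp (J d)) with (pt2 (fst d * 0 + snd d * 1) (fst d * (-1) + snd d * 0)). exact H.
    destruct d as [a b]. apply R2_eq; coords; ring. }
  apply filter_forall. intros z. now rewrite J_matrix.
Qed.

Lemma is_grad_cmult k f p d : is_grad f p d -> is_grad (fun z => k * f z) p (scal k d).
Proof.
  intros H. replace (scal k d) with (pt2 (k * fst d) (k * snd d)) by reflexivity.
  apply (is_grad_comp1 (fun y => k * y) f); trivial.
  auto_derive; trivial; ring.
Qed.

Lemma scal_scal (a b : R) (p : R2) : scal a (scal b p) = scal (a * b) p.
Proof. now rewrite (scal_assoc a b p). Qed.
Lemma scal_1 (p : R2) : scal 1 p = p.
Proof. exact (scal_one p). Qed.
Lemma scal_neq0 k (p : R2) : k <> 0 -> p <> zero -> scal k p <> zero.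
Proof.
  intros Hk Hp E. apply Hp. rewrite <- (scal_1 p).
  replace 1 with (/ k * k) by now field. rewrite <- scal_scal, E.
  apply R2_eq; coords; ring.
Qed.

Section NormGrad.
Variable n : R2 -> R.
Hypothesis Hn : is_norm n.

(** n(q + tz) - n(q) is at most t n(z) for t > 0. *)
Lemma norm_grad_le q g z : is_grad n q g -> dot2 g z <= n z.
Proof.
  intros H. assert (Hd := is_grad_dder n q g z H).
  apply is_derive_Reals in Hd.
  apply Rnot_lt_le. intros L.
  assert (P : 0 < dot2 g z - n z) by lra.
  destruct (Hd _ P) as [d K].
  assert (Hd2 : 0 < d / 2) by (generalize (cond_pos d); lra).
  specialize (K (d/2)). rewrite Rplus_0_l in K.
  specialize (K ltac:(lra) ltac:(rewrite Rabs_pos_eq; lra)).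
  change (Rabs ((n (plus q (scal (d/2) z)) - n (plus q (scal 0 z))) / (d/2) - dot2 g z) < dot2 g z - n z) in K.
  rewrite plus_scal0 in K. apply Rabs_def2 in K. destruct K as [_ K].
  assert (T := nrm_triang n Hn q (scal (d/2) z)).
  rewrite (nrm_scal n Hn), Rabs_pos_eq in T by lra.
  assert ((n (plus q (scal (d / 2) z)) - n q) / (d / 2) <= n z).
  { apply Rle_div_l; lra. }
  lra.
Qed.

Lemma norm_grad_euler q g : is_grad n q g -> dot2 g q = n q.
Proof.
  intros H. rewrite <- (dder_grad n q g q H). unfold dder.
  rewrite (Derive_ext_loc _ (fun t => n q + t * n q)).
  - apply is_derive_unique, is_derive_affine.
  - assert (P : 0 < 1) by lra. exists (mkposreal _ P). intros t Hht.
    change (Rabs (t - 0) < 1) in Hht. rewrite Rminus_0_r in Hht. apply Rabs_def2 in Hht.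
    replace (n q + t * n q) with (Rabs (1 + t) * n q) by (rewrite Rabs_pos_eq; [ring|lra]).
    rewrite <- (nrm_scal n Hn). f_equal.
    apply R2_eq; coords; ring.
Qed.

Lemma norm_grad_scal t q g : t <> 0 -> is_grad n q g -> is_grad n (scal t q) (scal (Rabs t / t) g).
Proof.
  intros Ht H.
  apply is_grad_ext_loc with (fun z => Rabs t * n (scal (/ t) z)).
  - apply filter_forall. intros z. rewrite (nrm_scal n Hn), Rabs_inv.
    field. now apply Rabs_no_R0.
  - replace (scal (Rabs t / t) g) with (scal (Rabs t) (scal (/ t) g)) by apply scal_scal.
    apply is_grad_cmult. apply is_grad_scal_arg.
    rewrite scal_scal, Rinv_l, scal_1; trivial.
Qed.
End NormGrad.

(** Put F = (F1, F2).  Homogeneity of degree 0 gives DF(p) p = 0, and maximality of q ->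
    p . F(q) at p gives p DF(p) = 0.  A 2 x 2 matrix that kills p on both sides is a
    multiple of (J p) (J p)^T, hence symmetric. *)
Lemma symmetric_hessian (F1 F2 : R2 -> R) (p A B : R2) : p <> zero ->
  is_grad F1 p A -> is_grad F2 p B ->
  (forall t, 0 < t -> F1 (scal t p) = F1 p /\ F2 (scal t p) = F2 p) ->
  locally p (fun q => fst p * F1 q + snd p * F2 q <= fst p * F1 p + snd p * F2 p) ->
  exists lam, A = pt2 (lam * (snd p * snd p)) (- lam * (fst p * snd p)) /\
    B = pt2 (- lam * (fst p * snd p)) (lam * (fst p * fst p)).
Proof.
  intros Hp HA HB Hh Hm.
  assert (E : forall F D, is_grad F p D -> (forall t, 0 < t -> F (scal t p) = F p) -> dot2 D p = 0).
  { intros F D HF Ht. rewrite <- (dder_grad F p D p HF). unfold dder.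
    rewrite (Derive_ext_loc _ (fun _ => F p)). apply Derive_const.
    assert (P : 0 < 1) by lra. exists (mkposreal _ P). intros t Hht.
    change (Rabs (t - 0) < 1) in Hht. rewrite Rminus_0_r in Hht. apply Rabs_def2 in Hht.
    rewrite <- (Ht (1 + t)) by lra. f_equal.
    apply R2_eq; coords; ring. }
  assert (EA := E _ _ HA (fun t H => proj1 (Hh t H))).
  assert (EB := E _ _ HB (fun t H => proj2 (Hh t H))). clear E.
  assert (Hs := is_grad_local_max _ _ _ (is_grad_plus _ _ _ _ _ (is_grad_cmult (fst p) _ _ _ HA) (is_grad_cmult (snd p) _ _ _ HB)) Hm).
  assert (S1 := f_equal fst Hs). assert (S2 := f_equal snd Hs).
  destruct p as [x y], A as [a b], B as [b' c].
  change R in x, y, a, b, b', c.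
  change (a * x + b * y = 0) in EA. change (b' * x + c * y = 0) in EB.
  change (x * a + y * b' = 0) in S1. change (x * b + y * c = 0) in S2.
  assert (N : 0 < x * x + y * y) by (apply (dot2_self_pos (x, y)); trivial).
  (* the factor is the trace divided by |p|^2 *)
  exists ((a + c) / (x * x + y * y)).
  assert (b = b').
  { destruct (Req_dec y 0) as [Y|Y].
    - assert (X : x <> 0) by (intros X; rewrite X, Y in N; lra).
      apply Rmult_eq_reg_r with x; trivial. rewrite Y in *. lra.
    - apply Rmult_eq_reg_r with (y * y); [|nra].
      replace (b * (y * y)) with (y * (b * y)) by ring.
      replace (b * y) with (- (a * x)) by lra.
      replace (b' * (y * y)) with (y * (y * b')) by ring.
      replace (y * b') with (- (x * a)) by lra. ring. }
  subst b'.
  assert (e1 := f_equal (fun t => t * x) EA). assert (e2 := f_equal (fun t => t * y) EA).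
  assert (e3 := f_equal (fun t => t * x) EB). assert (e4 := f_equal (fun t => t * y) EB).
  cbv beta in e1, e2, e3, e4.
  assert (key : forall u k : R, u * (x * x + y * y) = (a + c) * k -> u = (a + c) / (x * x + y * y) * k).
  { intros u k Hu. replace ((a + c) / (x * x + y * y) * k) with (((a + c) * k) / (x * x + y * y)) by (field; lra).
    rewrite <- Hu. field. lra. }
  assert (ka := key a (y * y) ltac:(lra)). assert (kc := key c (x * x) ltac:(lra)).
  assert (kb := key (- b) (x * y) ltac:(lra)).
  split; apply R2_eq; unfold pt2; cbn [fst snd].
  - exact ka.
  - change (b = - ((a + c) / (x * x + y * y)) * (x * y)). lra.
  - change (b = - ((a + c) / (x * x + y * y)) * (x * y)). lra.
  - exact kc.
Qed.

(** The regularity shared by a strictly curved smooth norm and its dual. *)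
Definition C2_norm (n : R2 -> R) : Prop := is_norm n /\
  forall p, p <> zero -> is_grad n p (grad2 n p) /\
    C1_at (fun q => fst (grad2 n q)) p /\ C1_at (fun q => snd (grad2 n q)) p.

Lemma smooth_norm_C2 n : smooth_norm n -> C2_norm n.
Proof.
  intros [Hn Hs]. split; trivial. intros p Hp.
  assert (U : locally p (fun x : R2 => x <> zero)) by now apply open_nonzero.
  split; [|split].
  - apply C1_at_grad. exact (class_C_C1_at _ _ _ (Hs 1%nat) U).
  - exact (class_C_C1_at _ _ _ (class_C_dder _ _ _ (pt2 1 0) (Hs 2%nat)) U).
  - exact (class_C_C1_at _ _ _ (class_C_dder _ _ _ (pt2 0 1) (Hs 2%nat)) U).
Qed.

Lemma grad2_norm_scal n t q : C2_norm n -> q <> zero -> t <> 0 ->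
  grad2 n (scal t q) = scal (Rabs t / t) (grad2 n q).
Proof.
  intros [Hn H] Hq Ht. apply grad2_is_grad. apply norm_grad_scal; trivial. now apply H.
Qed.

Lemma grad2_norm_pscal n t q : C2_norm n -> q <> zero -> 0 < t ->
  grad2 n (scal t q) = grad2 n q.
Proof.
  intros H Hq Ht. rewrite grad2_norm_scal; trivial; [|lra].
  rewrite Rabs_pos_eq by lra. unfold Rdiv. rewrite Rinv_r by lra. apply scal_1.
Qed.

Lemma grad2_norm_euler n q : C2_norm n -> q <> zero -> dot2 (grad2 n q) q = n q.
Proof. intros [Hn H] Hq. apply norm_grad_euler; trivial. now apply H. Qed.
Lemma grad2_norm_le n q z : C2_norm n -> q <> zero -> dot2 (grad2 n q) z <= n z.
Proof. intros [Hn H] Hq. apply norm_grad_le with q; trivial. now apply H. Qed.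

(** The gradient at q pairs with p to at most n(p), with equality at q = p, so
    [symmetric_hessian] applies. *)
Lemma C2_norm_hess n p : C2_norm n -> p <> zero -> exists lam,
  grad2 (fun q => fst (grad2 n q)) p = pt2 (lam * (snd p * snd p)) (- lam * (fst p * snd p)) /\
  grad2 (fun q => snd (grad2 n q)) p = pt2 (- lam * (fst p * snd p)) (lam * (fst p * fst p)).
Proof.
  intros H Hp. destruct (proj2 H p Hp) as (H1 & H2 & H3).
  apply symmetric_hessian with (F1 := fun q => fst (grad2 n q)) (F2 := fun q => snd (grad2 n q)); trivial.
  - now apply C1_at_grad.
  - now apply C1_at_grad.
  - intros t Ht. now rewrite grad2_norm_pscal.
  - apply filter_imp with (2 := open_nonzero p Hp). intros q Hq.
    assert (K1 := grad2_norm_le n q p H Hq). assert (K2 := grad2_norm_euler n p H Hp).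
    unfold dot2 in K1, K2.
    rewrite (Rmult_comm (fst p) (fst (grad2 n q))), (Rmult_comm (fst p) (fst (grad2 n p))),
     (Rmult_comm (snd p) (snd (grad2 n q))), (Rmult_comm (snd p) (snd (grad2 n p))).
    eapply Rle_trans. apply K1. right. symmetry. exact K2.
Qed.

Lemma hessian_scal_fst n p s : C2_norm n -> p <> zero -> 0 < s ->
  grad2 (fun q => fst (grad2 n q)) (scal s p) = scal (/ s) (grad2 (fun q => fst (grad2 n q)) p).
Proof.
  intros H Hp Hs. apply grad2_is_grad.
  assert (Hsp : scal s p <> zero) by (apply scal_neq0; trivial; lra).
  apply is_grad_ext_loc with (fun q => fst (grad2 n (scal (/ s) q))).
  - apply filter_imp with (2 := open_nonzero _ Hsp). intros q Hq.
    rewrite grad2_norm_pscal; trivial. now apply Rinv_0_lt_compat.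
  - apply (is_grad_scal_arg (fun q => fst (grad2 n q))). rewrite scal_scal, Rinv_l, scal_1 by lra.
    apply C1_at_grad, H, Hp.
Qed.
Lemma hessian_scal_snd n p s : C2_norm n -> p <> zero -> 0 < s ->
  grad2 (fun q => snd (grad2 n q)) (scal s p) = scal (/ s) (grad2 (fun q => snd (grad2 n q)) p).
Proof.
  intros H Hp Hs. apply grad2_is_grad.
  assert (Hsp : scal s p <> zero) by (apply scal_neq0; trivial; lra).
  apply is_grad_ext_loc with (fun q => snd (grad2 n (scal (/ s) q))).
  - apply filter_imp with (2 := open_nonzero _ Hsp). intros q Hq.
    rewrite grad2_norm_pscal; trivial. now apply Rinv_0_lt_compat.
  - apply (is_grad_scal_arg (fun q => snd (grad2 n q))). rewrite scal_scal, Rinv_l, scal_1 by lra.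
    apply C1_at_grad, H, Hp.
Qed.

(** * The gradient of half the squared norm as a local diffeomorphism *)

(** With slopes A continuous at x one has z - x = A(z) (y(z) - y(x)), and Cramer's rule
    solves this for y(z) - y(x) with coefficients continuous at x. *)
Lemma inverse_is_grad (L1 L2 : R2 -> R) (y : R2 -> R2) (x A B : R2) :
  continuous y x -> is_grad L1 (y x) A -> is_grad L2 (y x) B ->
  fst A * snd B - snd A * fst B <> 0 ->
  locally x (fun z => L1 (y z) = fst z /\ L2 (y z) = snd z) ->
  let det := fst A * snd B - snd A * fst B in
  is_grad (fun z => fst (y z)) x (pt2 (snd B / det) (- snd A / det)) /\
  is_grad (fun z => snd (y z)) x (pt2 (- fst B / det) (fst A / det)).
Proof.
  intros Hy HA HB Hd HL det.
  destruct (is_grad_carath_inv _ _ _ HA) as (a & Ca & Ea & Ha).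
  destruct (is_grad_carath_inv _ _ _ HB) as (b & Cb & Eb & Hb).
  assert (Ca' : continuous (fun z => a (y z)) x) by now apply continuous_comp.
  assert (Cb' : continuous (fun z => b (y z)) x) by now apply continuous_comp.
  assert (Ca1 := continuous_fst_R2 _ _ Ca'). assert (Ca2 := continuous_snd_R2 _ _ Ca').
  assert (Cb1 := continuous_fst_R2 _ _ Cb'). assert (Cb2 := continuous_snd_R2 _ _ Cb').
  pose (dt := fun z => fst (a (y z)) * snd (b (y z)) - snd (a (y z)) * fst (b (y z))).
  assert (Edt : dt x = det) by (unfold dt; now rewrite Ea, Eb).
  assert (Cdt : continuous dt x) by (apply cont_minus; now apply cont_mult).
  assert (Ndt : locally x (fun z => dt z <> 0)) by (apply cont_neq0; trivial; now rewrite Edt).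
  assert (Hx := locally_singleton _ _ HL).
  assert (E : locally x (fun z =>
     dt z * (fst (y z) - fst (y x)) = snd (b (y z)) * (fst z - fst x) - snd (a (y z)) * (snd z - snd x) /\
     dt z * (snd (y z) - snd (y x)) = - fst (b (y z)) * (fst z - fst x) + fst (a (y z)) * (snd z - snd x))).
  { apply filter_imp with (2 := HL). intros z [H1 H2].
    destruct Hx as [H1' H2'].
    specialize (Ha (y z)). specialize (Hb (y z)). rewrite H1, H1' in Ha. rewrite H2, H2' in Hb.
    unfold dt.
    change (fst z - fst x = fst (a (y z)) * (fst (y z) - fst (y x)) + snd (a (y z)) * (snd (y z) - snd (y x))) in Ha.
    change (snd z - snd x = fst (b (y z)) * (fst (y z) - fst (y x)) + snd (b (y z)) * (snd (y z) - snd (y x))) in Hb.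
    rewrite Ha, Hb. toR. split; ring. }
  split.
  - apply is_grad_carath with (fun z => pt2 (snd (b (y z)) / dt z) (- snd (a (y z)) / dt z)).
    + apply (continuous_pt2 (fun z => snd (b (y z)) / dt z) (fun z => - snd (a (y z)) / dt z));
      apply cont_div; trivial; try (now rewrite Edt); now apply cont_opp.
    + rewrite Edt, Ea, Eb. reflexivity.
    + generalize (filter_and _ _ E Ndt). apply filter_imp. intros z [[E1 _] N].
      change (fst (y z) - fst (y x) = snd (b (y z)) / dt z * (fst z - fst x) + - snd (a (y z)) / dt z * (snd z - snd x)).
      apply Rmult_eq_reg_l with (dt z); trivial. rewrite E1. toR. field. exact N.
  - apply is_grad_carath with (fun z => pt2 (- fst (b (y z)) / dt z) (fst (a (y z)) / dt z)).
    + apply (continuous_pt2 (fun z => - fst (b (y z)) / dt z) (fun z => fst (a (y z)) / dt z));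
      apply cont_div; trivial; try (now rewrite Edt); now apply cont_opp.
    + rewrite Edt, Ea, Eb. reflexivity.
    + generalize (filter_and _ _ E Ndt). apply filter_imp. intros z [[_ E1] N].
      change (snd (y z) - snd (y x) = - fst (b (y z)) / dt z * (fst z - fst x) + fst (a (y z)) / dt z * (snd z - snd x)).
      apply Rmult_eq_reg_l with (dt z); trivial. rewrite E1. toR. field. exact N.
Qed.

Lemma inverse_C1 (L1 L2 : R2 -> R) (y : R2 -> R2) (x : R2) :
  locally x (fun z => continuous y z /\ L1 (y z) = fst z /\ L2 (y z) = snd z) ->
  C1_at L1 (y x) -> C1_at L2 (y x) ->
  fst (grad2 L1 (y x)) * snd (grad2 L2 (y x)) - snd (grad2 L1 (y x)) * fst (grad2 L2 (y x)) <> 0 ->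
  C1_at (fun z => fst (y z)) x /\ C1_at (fun z => snd (y z)) x.
Proof.
  intros H H1 H2 Hd.
  assert (Cy : continuous y x) by apply (locally_singleton _ _ H).
  assert (Cg1 := C1_at_cont_grad _ _ H1). assert (Cg2 := C1_at_cont_grad _ _ H2).
  assert (C1 : continuous (fun z => grad2 L1 (y z)) x) by now apply continuous_comp.
  assert (C2 : continuous (fun z => grad2 L2 (y z)) x) by now apply continuous_comp.
  assert (C11 := continuous_fst_R2 _ _ C1). assert (C12 := continuous_snd_R2 _ _ C1).
  assert (C21 := continuous_fst_R2 _ _ C2). assert (C22 := continuous_snd_R2 _ _ C2).
  set (det := fun z => fst (grad2 L1 (y z)) * snd (grad2 L2 (y z)) - snd (grad2 L1 (y z)) * fst (grad2 L2 (y z))).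
  assert (Cdet : continuous det x) by (apply cont_minus; now apply cont_mult).
  assert (Ndet : locally x (fun z => det z <> 0)) by (apply cont_neq0; trivial).
  assert (G1 : locally x (fun z => is_grad L1 (y z) (grad2 L1 (y z)))) by exact (Cy _ (C1_at_locally _ _ H1)).
  assert (G2 : locally x (fun z => is_grad L2 (y z) (grad2 L2 (y z)))) by exact (Cy _ (C1_at_locally _ _ H2)).
  assert (Hl := locally_locally _ _ H).
  assert (key : locally x (fun z =>
    is_grad (fun z => fst (y z)) z (pt2 (snd (grad2 L2 (y z)) / det z) (- snd (grad2 L1 (y z)) / det z)) /\
    is_grad (fun z => snd (y z)) z (pt2 (- fst (grad2 L2 (y z)) / det z) (fst (grad2 L1 (y z)) / det z)))).
  { generalize (filter_and _ _ (filter_and _ _ Hl Ndet) (filter_and _ _ G1 G2)).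
    apply filter_imp. intros z [[K1 K2] [K3 K4]].
    apply inverse_is_grad with (L1 := L1) (L2 := L2); trivial.
    - apply (locally_singleton _ _ K1).
    - apply filter_imp with (2 := K1). tauto. }
  split.
  - exists (fun z => pt2 (snd (grad2 L2 (y z)) / det z) (- snd (grad2 L1 (y z)) / det z)). split.
    + apply (continuous_pt2 (fun z => snd (grad2 L2 (y z)) / det z) (fun z => - snd (grad2 L1 (y z)) / det z));
      apply cont_div; trivial; now apply cont_opp.
    + apply filter_imp with (2 := key). tauto.
  - exists (fun z => pt2 (- fst (grad2 L2 (y z)) / det z) (fst (grad2 L1 (y z)) / det z)). split.
    + apply (continuous_pt2 (fun z => - fst (grad2 L2 (y z)) / det z) (fun z => fst (grad2 L1 (y z)) / det z));
      apply cont_div; trivial; now apply cont_opp.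
    + apply filter_imp with (2 := key). tauto.
Qed.

Section DualC2.
Variable n : R2 -> R.
Hypothesis Hn : C2_norm n.
Hypothesis Hc : curved n.
Let Nn : is_norm n := proj1 Hn.
Let D := dual2 n.
Let ND : is_norm D := dual2_is_norm n Nn.

Let L1 y := n y * fst (grad2 n y).
Let L2 y := n y * snd (grad2 n y).

Let gn p (Hp : p <> zero) : is_grad n p (grad2 n p) := proj1 (proj2 Hn p Hp).
Let gn1 p (Hp : p <> zero) := proj1 (proj2 (proj2 Hn p Hp)).
Let gn2 p (Hp : p <> zero) := proj2 (proj2 (proj2 Hn p Hp)).

Lemma norm_C1 p : p <> zero -> C1_at n p.
Proof.
  intros Hp. exists (grad2 n). split.
  - apply (continuous_ext (fun q => pt2 (fst (grad2 n q)) (snd (grad2 n q)))).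
    { intros q; apply pt2_eta. }
    apply (continuous_pt2 (fun q => fst (grad2 n q)) (fun q => snd (grad2 n q)));
    apply C1_at_continuous; [now apply gn1|now apply gn2].
  - apply filter_imp with (2 := open_nonzero p Hp). apply gn.
Qed.

(** On the unit circle, the tangent vector J (grad n) detects the sign of the factor;
    elsewhere the Hessian is homogeneous of degree -1. *)
Lemma curved_hess p : p <> zero -> exists lam, 0 < lam /\
  grad2 (fun q => fst (grad2 n q)) p = pt2 (lam * (snd p * snd p)) (- lam * (fst p * snd p)) /\
  grad2 (fun q => snd (grad2 n q)) p = pt2 (- lam * (fst p * snd p)) (lam * (fst p * fst p)).
Proof.
  assert (base : forall p, n p = 1 -> exists lam, 0 < lam /\
  grad2 (fun q => fst (grad2 n q)) p = pt2 (lam * (snd p * snd p)) (- lam * (fst p * snd p)) /\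
  grad2 (fun q => snd (grad2 n q)) p = pt2 (- lam * (fst p * snd p)) (lam * (fst p * fst p))).
  { intros q Hq. assert (Hq0 : q <> zero) by (apply nrm_nz with n; trivial; lra).
    destruct (C2_norm_hess n q Hn Hq0) as (lam & E1 & E2). exists lam. split; [|now split].
    (* J (grad n) is tangent to the unit circle *)
    set (v := pt2 (- snd (grad2 n q)) (fst (grad2 n q))).
    assert (Eu := grad2_norm_euler n q Hn Hq0). rewrite Hq in Eu.
    assert (Hv : v <> zero).
    { intros E. assert (e1 := f_equal fst E). assert (e2 := f_equal snd E).
      revert Eu e1 e2. unfold v. destruct (grad2 n q) as [g1 g2]. change R in g1, g2. intros Eu e1 e2.
      change (g1 * fst q + g2 * snd q = 1) in Eu. change (- g2 = 0) in e1. change (g1 = 0) in e2.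
      rewrite e2 in Eu. replace g2 with 0 in Eu by lra. lra. }
    assert (Hdv : dder v n q = 0).
    { rewrite (dder_grad n q _ v (gn q Hq0)). unfold v, dot2; simpl. toR; ring. }
    assert (K := Hc q v Hq Hv Hdv).
    assert (Hg : is_grad (dder v n) q (plus (scal (fst v) (grad2 (fun q => fst (grad2 n q)) q))
       (scal (snd v) (grad2 (fun q => snd (grad2 n q)) q)))).
    { apply is_grad_ext_loc with (fun z => fst v * fst (grad2 n z) + snd v * snd (grad2 n z)).
      - apply filter_imp with (2 := open_nonzero q Hq0). intros z Hz.
        rewrite (dder_grad n z _ v (gn z Hz)). unfold dot2. toR; ring.
      - apply is_grad_plus; apply is_grad_cmult; apply C1_at_grad; [now apply gn1|now apply gn2]. }
    rewrite (dder_grad _ _ _ v Hg), E1, E2 in K.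
    destruct q as [x y]. unfold dot2 in Eu.
    set (g1 := fst (grad2 n (x,y))) in *. set (g2 := snd (grad2 n (x,y))) in *.
    change R in x, y. change (g1 * x + g2 * y = 1) in Eu.
    change (0 < (- g2 * (lam * (y * y)) + g1 * (- lam * (x * y))) * - g2 +
        (- g2 * (- lam * (x * y)) + g1 * (lam * (x * x))) * g1) in K.
    replace (_ + _) with (lam * ((g1 * x + g2 * y) * (g1 * x + g2 * y))) in K by ring.
    rewrite Eu in K. lra. }
  intros Hp.
  assert (P := nrm_pos n Nn p Hp).
  assert (Hi := Rinv_0_lt_compat _ P).
  assert (H1 : n (scal (/ n p) p) = 1) by (rewrite (nrm_scal n Nn), Rabs_pos_eq by lra; field; lra).
  destruct (base _ H1) as (lam & Pl & E1 & E2).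
  rewrite (hessian_scal_fst n p _ Hn Hp Hi) in E1. rewrite (hessian_scal_snd n p _ Hn Hp Hi) in E2.
  exists (lam / (n p * (n p * n p))).
  assert (Pd : 0 < lam / (n p * (n p * n p))).
  { apply Rdiv_lt_0_compat; trivial. apply Rmult_lt_0_compat; trivial. now apply Rmult_lt_0_compat. }
  split; trivial.
  assert (S : forall (a b : R2), scal (/ / n p) a = b -> a = scal (/ n p) b).
  { intros a b <-. rewrite scal_scal. rewrite Rinv_r, scal_1; trivial. apply Rinv_neq_0_compat; lra. }
  apply S in E1. apply S in E2. rewrite E1, E2.
  assert (Pr : n p <> 0) by (apply Rgt_not_eq; exact P). clear -Pr.
  revert Pr. generalize (n p). intros r Pr. destruct p as [x y]. change R in x, y.
  split; apply R2_eq; coords; field; exact Pr.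
Qed.

Lemma half_sqr_grad_C1 p : p <> zero -> C1_at L1 p /\ C1_at L2 p.
Proof.
  intros Hp. split; apply (C1_at_mult n); try now apply norm_C1. now apply gn1. now apply gn2.
Qed.

(** The matrix is grad n (grad n)^T + n D^2 n.  With D^2 n = lam (J p) (J p)^T its
    determinant is n lam (p . grad n)^2 = lam n^3. *)
Lemma half_sqr_hessian_det p : p <> zero ->
  fst (grad2 L1 p) * snd (grad2 L2 p) - snd (grad2 L1 p) * fst (grad2 L2 p) <> 0.
Proof.
  intros Hp. destruct (curved_hess p Hp) as (lam & Pl & E1 & E2).
  assert (H1 := is_grad_mult _ _ _ _ _ (gn p Hp) (C1_at_grad _ _ (gn1 p Hp))).
  assert (H2 := is_grad_mult _ _ _ _ _ (gn p Hp) (C1_at_grad _ _ (gn2 p Hp))).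
  rewrite E1 in H1. rewrite E2 in H2.
  rewrite (grad2_is_grad _ _ _ H1 : grad2 L1 p = _), (grad2_is_grad _ _ _ H2 : grad2 L2 p = _).
  assert (Eu := grad2_norm_euler n p Hn Hp). assert (P := nrm_pos n Nn p Hp).
  destruct p as [x y]. unfold dot2 in Eu.
  set (g1 := fst (grad2 n (x,y))) in *. set (g2 := snd (grad2 n (x,y))) in *. set (r := n (x, y)) in *.
  change R in x, y. change (g1 * x + g2 * y = r) in Eu.
  change ((g1 * g1 + r * (lam * (y * y))) * (g2 * g2 + r * (lam * (x * x))) -
     (g1 * g2 + r * (- lam * (x * y))) * (g2 * g1 + r * (- lam * (x * y))) <> 0).
  replace (_ - _) with (r * lam * ((g1 * x + g2 * y) * (g1 * x + g2 * y))) by ring.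
  rewrite Eu. apply Rgt_not_eq. apply Rmult_lt_0_compat; apply Rmult_lt_0_compat; trivial.
Qed.
End DualC2.

(** * Regularity of the dual norm *)

Lemma convex_lt (a b m t : R) : a < m -> b < m -> 0 <= t <= 1 -> a * t + b * (1 - t) < m.
Proof.
  intros Ha Hb Ht. destruct (Req_dec t 0) as [->|N]; [lra|].
  assert (0 < (m - a) * t) by (apply Rmult_lt_0_compat; lra).
  assert (0 <= (m - b) * (1 - t)) by (apply Rmult_le_pos; lra). lra.
Qed.

Section Inverse.
Variable n : R2 -> R.
Hypothesis Hn : C2_norm n.
Hypothesis Hc : curved n.
Let Nn : is_norm n := proj1 Hn.
Let D := dual2 n.
Let ND : is_norm D := dual2_is_norm n Nn.

(** A maximiser of the pairing with [x] on the unit circle; it is the gradient of the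
    dual norm at [x]. *)
Definition dual_point (x : R2) : R2 :=
  epsilon (inhabits (zero : R2)) (fun xi => n xi = 1 /\ dot2 x xi = dual2 n x).

Lemma dual_point_spec x : n (dual_point x) = 1 /\ dot2 x (dual_point x) = D x.
Proof.
  unfold dual_point. apply epsilon_spec.
  destruct (dual2_attained n Nn x) as (xi & H1 & H2 & _). now exists xi.
Qed.

Lemma dual_point_neq0 x : dual_point x <> zero.
Proof. apply nrm_nz with n; trivial. rewrite (proj1 (dual_point_spec x)). lra. Qed.

(** The function y -> x . y - D(x) n(y) is maximal at [dual_point x], so its gradient
    vanishes there. *)
Lemma grad_dual_point x : x <> zero -> scal (D x) (grad2 n (dual_point x)) = x.
Proof.
  intros Hx. destruct (dual_point_spec x) as [H1 H2]. assert (H0 := dual_point_neq0 x).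
  assert (Hg := proj1 (proj2 Hn _ H0)).
  assert (K := is_grad_local_max _ _ _ (is_grad_plus _ _ _ _ _
    (is_grad_lin (fst x) (snd x) (dual_point x)) (is_grad_cmult (- D x) _ _ _ Hg))).
  assert (Z : plus (pt2 (fst x) (snd x)) (scal (- D x) (grad2 n (dual_point x))) = zero).
  { apply K. apply filter_forall. intros eta.
    change (dot2 x eta + - D x * n eta <= dot2 x (dual_point x) + - D x * n (dual_point x)).
    rewrite H1, H2. generalize (dual2_le n Nn x eta). fold D. lra. }
  assert (Z1 := f_equal fst Z). assert (Z2 := f_equal snd Z).
  destruct (grad2 n (dual_point x)) as [g1 g2]. destruct x as [a b]. change R in g1, g2, a, b.
  set (d := D (a, b)) in *.
  change (a + - d * g1 = 0) in Z1. change (b + - d * g2 = 0) in Z2.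
  apply R2_eq; [change (d * g1 = a)|change (d * g2 = b)]; lra.
Qed.

(** Gradient of half the squared dual norm, the Legendre transform of n^2 / 2; it
    inverts the gradient of n^2 / 2. *)
Definition grad_inv (x : R2) : R2 := scal (dual2 n x) (dual_point x).

Lemma dual_pos x : x <> zero -> 0 < D x.
Proof. now apply nrm_pos. Qed.

Lemma grad_inv_neq0 x : x <> zero -> grad_inv x <> zero.
Proof. intros Hx. apply scal_neq0. apply Rgt_not_eq. now apply dual_pos. apply dual_point_neq0. Qed.

Lemma grad_inv_norm x : n (grad_inv x) = D x.
Proof.
  unfold grad_inv. rewrite (nrm_scal n Nn), (proj1 (dual_point_spec x)), Rmult_1_r.
  apply Rabs_pos_eq. now apply nrm_ge0.
Qed.

Lemma grad_inv_dot x : dot2 x (grad_inv x) = D x * D x.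
Proof. unfold grad_inv. rewrite dot2_scal_r, (proj2 (dual_point_spec x)). reflexivity. Qed.

Lemma grad_inv_inverse x : x <> zero ->
  n (grad_inv x) * fst (grad2 n (grad_inv x)) = fst x /\
  n (grad_inv x) * snd (grad2 n (grad_inv x)) = snd x.
Proof.
  intros Hx. rewrite grad_inv_norm. unfold grad_inv at 1 2.
  rewrite (grad2_norm_pscal n _ _ Hn (dual_point_neq0 x)) by now apply dual_pos.
  assert (E := grad_dual_point x Hx).
  split; [rewrite <- E at 3 | rewrite <- E at 3]; reflexivity.
Qed.

Lemma grad_inv_min x z :
  - (D x * D x) / 2 <= n z * n z / 2 - dot2 x z.
Proof.
  generalize (dual2_le n Nn x z). fold D. intros.
  generalize (Rle_0_sqr (n z - D x)). unfold Rsqr. lra.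
Qed.

(** Equality must hold both in x . z <= D(x) n(z) and in 2 D(x) n(z) <= D(x)^2 + n(z)^2. *)
Lemma grad_inv_min_unique x z : x <> zero ->
  n z * n z / 2 - dot2 x z <= - (D x * D x) / 2 -> z = grad_inv x.
Proof.
  intros Hx Hz. assert (P := dual_pos x Hx).
  assert (L := dual2_le n Nn x z). fold D in L.
  assert (S := Rle_0_sqr (n z - D x)). unfold Rsqr in S.
  assert (E : n z = D x) by nra.
  assert (E2 : dot2 x z = D x * D x) by (rewrite E in *; lra).
  assert (Hz1 : scal (/ D x) z = dual_point x).
  { apply dual2_max_unique with n x; trivial.
    - rewrite (nrm_scal n Nn), E, Rabs_pos_eq. field; lra. apply Rlt_le. now apply Rinv_0_lt_compat.
    - apply dual_point_spec.
    - rewrite dot2_scal_r, E2. fold D. field. lra.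
    - apply dual_point_spec. }
  unfold grad_inv. rewrite <- Hz1, scal_scal. fold D. rewrite Rinv_r, scal_1; trivial. lra.
Qed.

Lemma half_sqr_convex a b tau : 0 <= tau <= 1 ->
  n (plus (scal (1 - tau) a) (scal tau b)) * n (plus (scal (1 - tau) a) (scal tau b)) <=
  (1 - tau) * (n a * n a) + tau * (n b * n b).
Proof.
  intros Ht.
  assert (T := nrm_triang n Nn (scal (1 - tau) a) (scal tau b)).
  rewrite !(nrm_scal n Nn), !Rabs_pos_eq in T by lra.
  set (c := n (plus _ _)) in *. assert (0 <= c) by (apply nrm_ge0; trivial).
  assert (Ha := nrm_ge0 n Nn a). assert (Hb := nrm_ge0 n Nn b).
  eapply Rle_trans. apply Rmult_le_compat. exact H. exact H. exact T. exact T.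
  assert (0 <= tau * (1 - tau) * ((n a - n b) * (n a - n b))).
  { apply Rmult_le_pos. apply Rmult_le_pos; lra. apply (Rle_0_sqr (n a - n b)). }
  lra.
Qed.

(** [grad_inv x] minimises the convex function n^2 / 2 - x . y.  On a small circle
    around the minimiser for x0 this function exceeds its minimum by a fixed amount, by
    compactness.  For x close to x0 the values on the circle still exceed the value at
    the centre, and by convexity the minimiser cannot lie beyond the circle. *)
Lemma grad_inv_continuous x0 : x0 <> zero -> continuous grad_inv x0.
Proof.
  intros Hx0. set (y0 := grad_inv x0).
  (* values on half of an l1 circle around y0 of radius |s|; the sign of s selects the half *)
  assert (gap : forall s, s <> 0 -> exists m, 0 < m /\ forall t, -1 <= t <= 1 ->
     let z := plus y0 (scal s (l1arc t)) in
     m <= n z * n z / 2 - dot2 x0 z + (D x0 * D x0) / 2).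
  { intros s Hs.
    assert (Cz : forall t, continuous (fun t => plus y0 (scal s (l1arc t))) t).
    { intros t. apply (continuous_plus (fun _ => y0) (fun t => scal s (l1arc t))).
      apply continuous_const. apply (continuous_scal_r s l1arc). apply l1arc_continuous. }
    destruct (continuity_ab_min (fun t => let z := plus y0 (scal s (l1arc t)) in
       n z * n z / 2 - dot2 x0 z + (D x0 * D x0) / 2) (-1) 1) as [t0 [H0 _]].
    { lra. }
    { intros t _. apply continuity_pt_filterlim.
      assert (Cn : continuous (fun t => n (plus y0 (scal s (l1arc t)))) t).
      { apply (continuous_comp (fun t => plus y0 (scal s (l1arc t))) n); trivial. now apply nrm_continuous. }
      apply (cont_plus (fun t => let z := plus y0 (scal s (l1arc t)) in n z * n z / 2 - dot2 x0 z) (fun _ => D x0 * D x0 / 2)).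
      2: apply continuous_const.
      apply (cont_minus (fun t => let z := plus y0 (scal s (l1arc t)) in n z * n z / 2) (fun t => dot2 x0 (plus y0 (scal s (l1arc t))))).
      - apply (cont_mult (fun t => let z := plus y0 (scal s (l1arc t)) in n z * n z) (fun _ => /2)).
        2: apply continuous_const. now apply cont_mult.
      - apply (cont_dot2 (fun _ => x0)). apply continuous_const. apply Cz. }
    set (z0 := plus y0 (scal s (l1arc t0))) in *.
    exists (n z0 * n z0 / 2 - dot2 x0 z0 + (D x0 * D x0) / 2). split; trivial.
    apply Rnot_le_lt. intros L.
    assert (E : z0 = y0) by (apply grad_inv_min_unique; trivial; lra).
    assert (Hz : scal s (l1arc t0) <> zero) by (apply scal_neq0; trivial; apply l1arc_neq0).
    apply Hz. apply R2_eq.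
    - apply (f_equal fst) in E. change (fst y0 + fst (scal s (l1arc t0)) = fst y0) in E. toR.
      change (@eq R (fst (scal s (l1arc t0))) 0). apply Rplus_eq_reg_l with (fst y0). rewrite Rplus_0_r. exact E.
    - apply (f_equal snd) in E. change (snd y0 + snd (scal s (l1arc t0)) = snd y0) in E. toR.
      change (@eq R (snd (scal s (l1arc t0))) 0). apply Rplus_eq_reg_l with (snd y0). rewrite Rplus_0_r. exact E. }
  assert (key : forall e, 0 < e -> locally x0 (fun x =>
     Rabs (fst (grad_inv x) - fst y0) + Rabs (snd (grad_inv x) - snd y0) < e)).
  { intros e He.
    destruct (gap e ltac:(lra)) as [m1 [P1 G1]]. destruct (gap (-e) ltac:(lra)) as [m2 [P2 G2]].
    set (m := Rmin m1 m2). assert (Pm : 0 < m) by now apply Rmin_glb_lt.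
    assert (Pme : 0 < m / e) by now apply Rdiv_lt_0_compat.
    assert (C1 := cont_close (fun q : R2 => fst q) x0 _ (continuous_fst_R2 _ x0 (continuous_id x0)) Pme).
    assert (C2 := cont_close (fun q : R2 => snd q) x0 _ (continuous_snd_R2 _ x0 (continuous_id x0)) Pme).
    generalize (filter_and _ _ (open_nonzero x0 Hx0) (filter_and _ _ C1 C2)).
    apply filter_imp. intros x [Hx [K1 K2]].
    apply Rnot_le_lt. intros L.
    destruct (l1_polar (minus (grad_inv x) y0)) as (s & t & Es & Ht & Ed).
    change (Rabs s = Rabs (fst (grad_inv x) - fst y0) + Rabs (snd (grad_inv x) - snd y0)) in Es.
    rewrite <- Es in L.
    assert (Hs0 : s <> 0) by (intros ->; rewrite Rabs_R0 in L; lra).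
    (* the segment from y0 to the minimiser for x crosses the circle of radius e *)
    assert (Hse : exists s', Rabs s' = e /\ 0 <= s' / s <= 1 /\
      (let z := plus y0 (scal s' (l1arc t)) in m <= n z * n z / 2 - dot2 x0 z + (D x0 * D x0) / 2)).
    { destruct (Rle_lt_dec 0 s) as [S|S].
      - rewrite Rabs_pos_eq in L by trivial. exists e. split. apply Rabs_pos_eq; lra. split.
        + split. apply Rdiv_le_0_compat; lra. apply Rle_div_l; lra.
        + eapply Rle_trans. apply Rmin_l. apply G1; trivial.
      - rewrite Rabs_left in L by trivial. exists (-e). split. rewrite Rabs_Ropp. apply Rabs_pos_eq; lra. split.
        + replace (- e / s) with (e / - s) by (field; lra).
          split. apply Rdiv_le_0_compat; lra. apply Rle_div_l; lra.
        + eapply Rle_trans. apply Rmin_r. apply G2; trivial. }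
    destruct Hse as (s' & Hs' & Htau & HG). set (tau := s' / s) in *. simpl in HG.
    set (z := plus y0 (scal s' (l1arc t))) in *.
    assert (Ez : z = plus (scal (1 - tau) y0) (scal tau (grad_inv x))).
    { unfold z. replace s' with (tau * s) by (unfold tau; field; trivial).
      rewrite <- scal_scal, <- Ed. destruct y0 as [a b], (grad_inv x) as [c d]. change R in a, b, c, d.
      apply R2_eq; coords; ring. }
    assert (CV := half_sqr_convex y0 (grad_inv x) tau Htau). rewrite <- Ez in CV.
    assert (Dz : dot2 x z = (1 - tau) * dot2 x y0 + tau * dot2 x (grad_inv x)).
    { now rewrite Ez, dot2_plus_r, !dot2_scal_r. }
    assert (M := grad_inv_min x y0).
    rewrite grad_inv_norm, grad_inv_dot in *.
    assert (V0 : n y0 * n y0 / 2 - dot2 x0 y0 + D x0 * D x0 / 2 = 0).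
    { unfold y0. rewrite grad_inv_norm, grad_inv_dot. lra. }
    assert (Dd : dot2 x z - dot2 x0 z - (dot2 x y0 - dot2 x0 y0) =
       s' * ((fst x - fst x0) * t + (snd x - snd x0) * (1 - Rabs t))).
    { unfold z. rewrite !dot2_plus_r. unfold dot2.
      change (fst (scal s' (l1arc t))) with (s' * t). coords; ring. }
    assert (B : Rabs (s' * ((fst x - fst x0) * t + (snd x - snd x0) * (1 - Rabs t))) < m).
    { rewrite Rabs_mult, Hs'.
      assert (At : 0 <= Rabs t <= 1) by (split; [apply Rabs_pos|apply Rabs_le; lra]).
      assert (At' : 0 <= 1 - Rabs t) by lra.
      assert (Rabs ((fst x - fst x0) * t + (snd x - snd x0) * (1 - Rabs t)) < m / e).
      { eapply Rle_lt_trans. apply Rabs_triang. rewrite !Rabs_mult, (Rabs_pos_eq (1 - Rabs t)) by exact At'.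
        now apply convex_lt. }
      replace m with (e * (m / e)) by (field; lra). apply Rmult_lt_compat_l; trivial. }
    apply Rabs_def2 in B.
    assert (tau * (n y0 * n y0 / 2 - dot2 x y0 + D x * D x / 2) >= 0).
    { apply Rle_ge, Rmult_le_pos; lra. }
    lra. }
  apply (continuous_ext (fun x => pt2 (fst (grad_inv x)) (snd (grad_inv x)))).
  { intros x. apply pt2_eta. }
  apply (continuous_pt2 (fun x => fst (grad_inv x)) (fun x => snd (grad_inv x))); apply cont_of_close; intros e He;
  apply filter_imp with (2 := key e He); intros x K; eapply Rle_lt_trans; try apply K; unfold y0.
  - generalize (Rabs_pos (snd (grad_inv x) - snd (grad_inv x0))). lra.
  - generalize (Rabs_pos (fst (grad_inv x) - fst (grad_inv x0))). lra.
Qed.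

Lemma grad_inv_C1 x : x <> zero ->
  C1_at (fun z => fst (grad_inv z)) x /\ C1_at (fun z => snd (grad_inv z)) x.
Proof.
  intros Hx. assert (H0 := grad_inv_neq0 x Hx).
  destruct (half_sqr_grad_C1 n Hn _ H0) as [C1 C2].
  apply (inverse_C1 _ _ grad_inv x) with (2 := C1) (3 := C2).
  - apply filter_imp with (2 := open_nonzero x Hx). intros z Hz.
    split. now apply grad_inv_continuous. now apply grad_inv_inverse.
  - now apply half_sqr_hessian_det.
Qed.

Lemma dual_point_eq x : x <> zero -> dual_point x = scal (/ D x) (grad_inv x).
Proof.
  intros Hx. unfold grad_inv. rewrite scal_scal. fold D. rewrite Rinv_l, scal_1; trivial.
  apply Rgt_not_eq. now apply dual_pos.
Qed.

(** D(x) - D(x0) lies between the pairings of x - x0 with the maximisers at x0 and at x. *)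
Lemma dual_is_grad x0 : x0 <> zero -> is_grad D x0 (dual_point x0).
Proof.
  intros Hx0.
  apply is_grad_squeeze with (fun x => scal (/ D x) (grad_inv x)).
  - apply (continuous_scal (fun x => / D x) grad_inv).
    + apply cont_inv. now apply nrm_continuous. apply Rgt_not_eq. now apply dual_pos.
    + now apply grad_inv_continuous.
  - symmetry. now apply dual_point_eq.
  - apply filter_imp with (2 := open_nonzero x0 Hx0). intros x Hx.
    rewrite <- dual_point_eq by trivial.
    destruct (dual_point_spec x0) as [N0 E0]. destruct (dual_point_spec x) as [N1 E1].
    assert (H1 := dual2_le n Nn x (dual_point x0)). assert (H2 := dual2_le n Nn x0 (dual_point x)).
    fold D in H1, H2. rewrite N0 in H1. rewrite N1 in H2. rewrite <- E0, <- E1 in *.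
    revert H1 H2.
    destruct (dual_point x0) as [a b], (dual_point x) as [c d], x0 as [u v], x as [s t]. change R in a,b,c,d,u,v,s,t.
    unfold dot2; cbn [fst snd]; toR. intros H1 H2.
    change (Rabs (s * c + t * d - (u * a + v * b) - (a * (s + - u) + b * (t + - v))) <= Rabs ((c + - a) * (s + - u) + (d + - b) * (t + - v))).
    rewrite 2!Rabs_pos_eq; lra.
Qed.

Theorem dual_norm_C2 : forall x, x <> zero ->
  n (grad2 D x) = 1 /\ is_grad D x (grad2 D x) /\ grad2 n (grad2 D x) = scal (/ D x) x /\
  C1_at (fun q => fst (grad2 D q)) x /\ C1_at (fun q => snd (grad2 D q)) x.
Proof.
  intros x Hx.
  assert (Hg : forall z, z <> zero -> grad2 D z = dual_point z) by (intros z Hz; now apply grad2_is_grad, dual_is_grad).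
  assert (CD : C1_at (fun q => / D q) x).
  { apply C1_at_inv. 2: apply Rgt_not_eq; now apply dual_pos.
    exists (fun x => scal (/ D x) (grad_inv x)). split.
    - apply (continuous_scal (fun x => / D x) grad_inv).
      + apply cont_inv. now apply nrm_continuous. apply Rgt_not_eq. now apply dual_pos.
      + now apply grad_inv_continuous.
    - apply filter_imp with (2 := open_nonzero x Hx). intros z Hz. rewrite <- dual_point_eq by trivial. now apply dual_is_grad. }
  destruct (grad_inv_C1 x Hx) as [K1 K2].
  rewrite !Hg by trivial. split; [apply dual_point_spec|split;[now apply dual_is_grad|split;[|split]]].
  - rewrite <- (grad_dual_point x Hx) at 3. rewrite scal_scal, Rinv_l, scal_1; trivial. apply Rgt_not_eq. now apply dual_pos.
  - apply C1_at_ext_loc with (fun z => / D z * fst (grad_inv z)).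
    2: now apply C1_at_mult.
    apply filter_imp with (2 := open_nonzero x Hx). intros z Hz. rewrite Hg, dual_point_eq by trivial. reflexivity.
  - apply C1_at_ext_loc with (fun z => / D z * snd (grad_inv z)).
    2: now apply C1_at_mult.
    apply filter_imp with (2 := open_nonzero x Hx). intros z Hz. rewrite Hg, dual_point_eq by trivial. reflexivity.
Qed.

Corollary dual_is_C2_norm : C2_norm D.
Proof.
  split; trivial. intros p Hp. destruct (dual_norm_C2 p Hp) as (_ & H1 & _ & H2 & H3). auto.
Qed.
End Inverse.

(** * Horizontal and vertical sections of the spatial norm *)

Definition even_fst (n : R2 -> R) : Prop := forall s c, n (pt2 (- s) c) = n (pt2 s c).

Lemma unit_exists (n : R2 -> R) : is_norm n -> exists p, n p = 1.
Proof.
  intros Hn. destruct (dual2_attained n Hn zero) as (xi & H & _). now exists xi.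
Qed.

Section Setting.
Variables Psi Phi : R2 -> R.
Hypothesis HPsi : smooth_norm Psi.
Hypothesis HPhi : smooth_norm Phi.
Hypothesis HN : smooth_norm (norm_HV Psi Phi).
Hypothesis HK : uniformly_positive_curvature (norm_HV Psi Phi).

(** The spatial norm takes the same value at (s p, c) and at (-s p, -c), which for s >=
    0 reads Phi(s, c) = Phi(s, -c).  The symmetry of [Phi] about the origin turns this
    into a reflection of the first variable. *)
Lemma Phi_even : even_fst Phi.
Proof.
  destruct HPsi as [NPsi _], HPhi as [NPhi _], HN as [NN _].
  destruct (unit_exists Psi NPsi) as [p Hp].
  assert (E1 : forall s c, 0 <= s -> Phi (pt2 s c) = Phi (pt2 s (- c))).
  { intros s c Hs.
    assert (K := proj1 (proj2 (proj2 NN)) (-1) (scal s p, c)).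
    unfold norm_HV in K. rewrite Rabs_left in K by lra. replace (- -1) with 1 in K by ring. rewrite Rmult_1_l in K.
    change (Phi (pt2 (Psi (scal (-1) (scal s p))) (-1 * c)) = Phi (pt2 (Psi (scal s p)) c)) in K.
    rewrite !(nrm_scal Psi NPsi), Hp, (Rabs_left (-1)), (Rabs_pos_eq s) in K by lra.
    replace (- -1 * (s * 1)) with s in K by ring. replace (s * 1) with s in K by ring.
    rewrite <- K. f_equal. f_equal. ring. }
  assert (E2 : forall s c, Phi (pt2 (- s) (- c)) = Phi (pt2 s c)).
  { intros s c. rewrite <- (nrm_opp Phi NPhi (pt2 s c)). reflexivity. }
  intros s c. destruct (Rle_lt_dec 0 s) as [S|S].
  - rewrite <- (Ropp_involutive c) at 1. rewrite E2. symmetry. now apply E1.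
  - rewrite (E1 (- s)) by lra. apply E2.
Qed.

Lemma Phi_abs s c : Phi (pt2 (Rabs s) c) = Phi (pt2 s c).
Proof. unfold Rabs. destruct (Rcase_abs s); trivial. apply Phi_even. Qed.

(** The horizontal section of the Wulff shape is a multiple of the unit circle of [Psi]. *)
Lemma Psi_curved : curved Psi.
Proof.
  assert (NPsi := proj1 HPsi). assert (NPhi := proj1 HPhi).
  set (k := Phi (pt2 1 0)).
  assert (Hk : 0 < k).
  { apply nrm_pos; trivial. apply R2_neq. left. simpl. lra. }
  intros q v. apply (curvature_plane (norm_HV Psi Phi) Psi (fun p => (scal (/ k) p, 0))); trivial.
  - intros x y. apply R3_eq; [apply R2_eq|].
    coords; ring.
    coords; ring.
    coords; ring.
  - intros t x. apply R3_eq; [apply R2_eq|].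
    coords; ring.
    coords; ring.
    coords; ring.
  - intros x E. apply (f_equal fst) in E. change (scal (/ k) x = zero) in E.
    destruct (classic (x = zero)) as [|N]; trivial. exfalso.
    apply (scal_neq0 (/ k) x); trivial. apply Rinv_neq_0_compat; lra.
  - intros x. unfold norm_HV. change (Phi (pt2 (Psi (scal (/ k) x)) 0) = Psi x).
    rewrite (nrm_scal Psi NPsi), Rabs_pos_eq by (apply Rlt_le, Rinv_0_lt_compat; trivial).
    replace (pt2 (/ k * Psi x) 0) with (scal (/ k * Psi x) (pt2 1 0)).
    2:{ apply R2_eq; coords; ring. }
    rewrite (nrm_scal Phi NPhi), Rabs_pos_eq. fold k. field; lra.
    apply Rmult_le_pos. apply Rlt_le, Rinv_0_lt_compat; trivial. now apply nrm_ge0.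
Qed.

(** The section by the plane spanned by a horizontal unit vector and the vertical axis
    is the unit circle of [Phi]; its half with s < 0 comes from the evenness of [Phi]. *)
Lemma Phi_curved : curved Phi.
Proof.
  assert (NPsi := proj1 HPsi). assert (NPhi := proj1 HPhi).
  destruct (unit_exists Psi NPsi) as [p Hp].
  assert (Hp0 : p <> zero) by (apply nrm_nz with Psi; trivial; lra).
  intros q v. apply (curvature_plane (norm_HV Psi Phi) Phi (fun z => (scal (fst z) p, snd z))); trivial.
  - intros x y. apply R3_eq; [apply R2_eq|].
    coords; ring.
    coords; ring.
    reflexivity.
  - intros t x. apply R3_eq; [apply R2_eq|].
    coords; ring.
    coords; ring.
    reflexivity.
  - intros x E. apply R2_eq.
    + apply (f_equal fst) in E. change (scal (fst x) p = zero) in E.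
      destruct (Req_dec (fst x) 0) as [|N]; trivial. exfalso.
      now apply (scal_neq0 (fst x) p).
    + apply (f_equal snd) in E. exact E.
  - intros x. unfold norm_HV. change (Phi (pt2 (Psi (scal (fst x) p)) (snd x)) = Phi x).
    rewrite (nrm_scal Psi NPsi), Hp, Rmult_1_r, Phi_abs, pt2_eta. reflexivity.
Qed.
End Setting.

(** Curvature is a condition on the primal norm; the dual norm then belongs to
    [C2_norm]. *)
Definition strict_C2_norm (n : R2 -> R) : Prop := C2_norm n /\ curved n.

Section Evenness.
Variable Phi : R2 -> R.
Hypothesis HPhi : strict_C2_norm Phi.
Hypothesis Hev : even_fst Phi.

Lemma even_fst_abs s c : Phi (pt2 (Rabs s) c) = Phi (pt2 s c).
Proof. unfold Rabs. destruct (Rcase_abs s); trivial. Qed.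

Lemma even_fst_grad s c : pt2 s c <> zero ->
  grad2 Phi (pt2 (- s) c) = pt2 (- fst (grad2 Phi (pt2 s c))) (snd (grad2 Phi (pt2 s c))).
Proof.
  intros H. apply grad2_is_grad.
  assert (G := proj1 (proj2 (proj1 HPhi) _ H)).
  apply is_grad_ext_loc with (fun z => Phi (pt2 ((-1) * fst z + 0 * snd z) (0 * fst z + 1 * snd z))).
  - apply filter_forall. intros [a b]. change R in a, b. rewrite <- Hev. f_equal.
    apply R2_eq; coords; ring.
  - replace (pt2 (- fst (grad2 Phi (pt2 s c))) (snd (grad2 Phi (pt2 s c)))) with (pt2 (fst (grad2 Phi (pt2 s c)) * (-1) + snd (grad2 Phi (pt2 s c)) * 0) (fst (grad2 Phi (pt2 s c)) * 0 + snd (grad2 Phi (pt2 s c)) * 1)).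
    2:{ destruct (grad2 Phi (pt2 s c)) as [a b]. change R in a, b. apply R2_eq; coords; ring. }
    apply is_grad_matrix.
    replace (pt2 (-1 * _ + _) _) with (pt2 s c); trivial.
    apply R2_eq; coords; ring.
Qed.

Lemma pt2_1_neq0 s : pt2 s 1 <> zero.
Proof. apply R2_neq. right. simpl. lra. Qed.

(** If the horizontal derivative vanished at (s, 1), the points (s, 1) and (-s, 1) would
    maximise the same linear form over the level curve through them. *)
Lemma even_fst_grad_neq0 s : s <> 0 -> fst (grad2 Phi (pt2 s 1)) <> 0.
Proof.
  intros Hs Z. destruct HPhi as [C K]. assert (Nn := proj1 C).
  set (y := pt2 s 1) in *. assert (Hy : y <> zero) by apply pt2_1_neq0.
  set (G := grad2 Phi y) in *.
  assert (P := nrm_pos Phi Nn y Hy).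
  assert (Eu : dot2 G y = Phi y) by now apply grad2_norm_euler.
  set (y' := pt2 (- s) 1).
  assert (Ey : Phi y' = Phi y) by apply Hev.
  assert (Eu' : dot2 G y' = Phi y).
  { rewrite <- Eu. unfold dot2, y, y'. rewrite Z. simpl. toR. ring. }
  assert (HG : G <> zero).
  { intros E. rewrite E, dot2_zero_l in Eu. lra. }
  assert (ED : dual2 Phi G = 1).
  { rewrite (dual2_eq Phi G (scal (/ Phi y) y)).
    - rewrite dot2_scal_r, Eu. field; lra.
    - rewrite (nrm_scal Phi Nn), Rabs_pos_eq. field; lra. apply Rlt_le; now apply Rinv_0_lt_compat.
    - intros eta He. rewrite dot2_scal_r, Eu, Rinv_l, <- He by lra. now apply grad2_norm_le. }
  assert (E : scal (/ Phi y) y = scal (/ Phi y) y').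
  { apply dual2_max_unique with Phi G; trivial.
    - rewrite (nrm_scal Phi Nn), Rabs_pos_eq. field; lra. apply Rlt_le; now apply Rinv_0_lt_compat.
    - rewrite (nrm_scal Phi Nn), Ey, Rabs_pos_eq. field; lra. apply Rlt_le; now apply Rinv_0_lt_compat.
    - rewrite dot2_scal_r, Eu, ED. field; lra.
    - rewrite dot2_scal_r, Eu', ED. field; lra. }
  apply (f_equal fst) in E. change (/ Phi y * s = / Phi y * - s) in E.
  apply Rmult_eq_reg_l in E. lra. apply Rinv_neq_0_compat; lra.
Qed.
End Evenness.

Section Dual3.
Variables Psi Phi : R2 -> R.
Hypothesis HPsi : is_norm Psi.
Hypothesis HPhi : is_norm Phi.
Hypothesis Hev : even_fst Phi.
Let N := norm_HV Psi Phi.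
Let Psis := dual2 Psi.
Let Phis := dual2 Phi.

Lemma dot3_HV_le (x eta : R3) :
  dot3 x eta <= Phis (pt2 (Psis (fst x)) (snd x)) * N eta.
Proof.
  unfold N, norm_HV. eapply Rle_trans. 2: apply (dual2_le Phi HPhi).
  unfold dot3. change (dot2 (fst x) (fst eta) + snd x * snd eta <=
    Psis (fst x) * Psi (fst eta) + snd x * snd eta).
  apply Rplus_le_compat_r. now apply dual2_le.
Qed.

(** Maximising over horizontal vectors of given Psi-norm first leaves a maximisation
    over the unit circle of [Phi]; the sign of the horizontal factor does not change its
    Phi-norm. *)
Lemma dual3_HV (x : R3) : dual3 N x = Phis (pt2 (Psis (fst x)) (snd x)).
Proof.
  destruct (dual2_attained Psi HPsi (fst x)) as (a & A1 & A2 & _).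
  destruct (dual2_attained Phi HPhi (pt2 (Psis (fst x)) (snd x))) as (b & B1 & B2 & _).
  set (zeta := (scal (fst b) a, snd b) : R3).
  assert (E : dot3 x zeta = Phis (pt2 (Psis (fst x)) (snd x))).
  { unfold Phis. rewrite B2. change (dot2 (fst x) (scal (fst b) a) + snd x * snd b = Psis (fst x) * fst b + snd x * snd b).
    rewrite dot2_scal_r, <- A2. unfold Psis. toR; ring. }
  unfold dual3. rewrite (dual_norm_max dot3 N x zeta); trivial.
  - unfold N, norm_HV, zeta. change (Phi (pt2 (Psi (scal (fst b) a)) (snd b)) = 1).
    rewrite (nrm_scal Psi HPsi), A1, Rmult_1_r, (even_fst_abs Phi Hev), pt2_eta. exact B1.
  - intros eta He. rewrite E. assert (K := dot3_HV_le x eta). rewrite He in K. lra.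
Qed.

(** For t < 0 the two coordinates change sign separately, so the symmetry of the dual of
    [Phi] in the second variable enters. *)
Lemma dual3_HV_scal (t : R) (x : R3) : dual3 N (scal t x) = Rabs t * dual3 N x.
Proof.
  rewrite !dual3_HV.
  change (Phis (pt2 (Psis (scal t (fst x))) (t * snd x)) = Rabs t * Phis (pt2 (Psis (fst x)) (snd x))).
  assert (NPs : is_norm Psis) by now apply dual2_is_norm.
  assert (NPh : is_norm Phis) by now apply dual2_is_norm.
  rewrite (nrm_scal Psis NPs), <- (nrm_scal Phis NPh).
  destruct (Rle_lt_dec 0 t) as [T|T].
  - rewrite Rabs_pos_eq; trivial.
  - rewrite Rabs_left; trivial.
    assert (ev : forall s c, Phis (pt2 s (- c)) = Phis (pt2 s c)).
    { assert (evl : forall s c, Phis (pt2 s (- c)) <= Phis (pt2 s c)).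
      { intros s c. destruct (dual2_attained Phi HPhi (pt2 s (-c))) as (b & B1 & B2 & _).
        unfold Phis. rewrite B2.
        replace (dot2 (pt2 s (- c)) b) with (dot2 (pt2 s c) (pt2 (fst b) (- snd b))).
        2:{ unfold dot2; simpl; toR; ring. }
        eapply Rle_trans. apply (dual2_le Phi HPhi).
        rewrite <- (nrm_opp Phi HPhi). replace (opp (pt2 (fst b) (- snd b))) with (pt2 (- fst b) (snd b)).
        rewrite Hev, pt2_eta, B1. lra.
        apply R2_eq; [reflexivity|]. coords; ring. }
      intros s c. apply Rle_antisym; trivial. rewrite <- (Ropp_involutive c) at 1. apply evl. }
    rewrite <- (nrm_opp Phis NPh).
    replace (opp (pt2 (- t * Psis (fst x)) (t * snd x))) with (pt2 (t * Psis (fst x)) (- (t * snd x))).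
    + rewrite ev. reflexivity.
    + apply R2_eq; [|reflexivity]. coords; ring.
Qed.
End Dual3.

(** * Radial fields and the catenoid *)

Lemma continuous_line (p v : R2) t : continuous (fun t : R => plus p (scal t v)) t.
Proof.
  apply (continuous_pt2 (fun t : R => fst p + t * fst v) (fun t : R => snd p + t * snd v));
  apply cont_plus; try apply continuous_const; apply cont_mult;
  try apply continuous_const; apply continuous_id.
Qed.

Lemma dder_ext_loc (v : R2) f g p : locally p (fun q => f q = g q) -> dder v f p = dder v g p.
Proof.
  intros H. apply Derive_ext_loc.
  apply (continuous_line p v 0 (fun z => f z = g z)). now rewrite plus_scal0.
Qed.

Lemma divergence_free_ext_loc F G p : locally p (fun q => F q = G q) ->
  divergence_free_at F p -> divergence_free_at G p.
Proof.
  intros H [[l Hl] Hd]. split.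
  - exists l. apply filterdiff_ext_loc with (f := F); trivial.
    + intros y Hy. apply is_filter_lim_locally_unique in Hy. subst. now apply locally_singleton in H.
  - rewrite <- Hd. unfold div0. symmetry. f_equal; apply dder_ext_loc;
    apply filter_imp with (2 := H); intros q ->; reflexivity.
Qed.

Lemma divergence_free_grads (F : R2 -> R2) p d1 d2 :
  is_grad (fun q => fst (F q)) p d1 -> is_grad (fun q => snd (F q)) p d2 ->
  fst d1 + snd d2 = 0 -> divergence_free_at F p.
Proof.
  intros H1 H2 H. split. now apply differentiable_pair with d1 d2.
  unfold div0. rewrite (dder_grad _ _ _ _ H1), (dder_grad _ _ _ _ H2).
  transitivity (fst d1 + snd d2); [|exact H]. clear. destruct d1 as [a b], d2 as [c d]. change R in a, b, c, d.
  coords; ring.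
Qed.

Lemma divergence_free_inv (F : R2 -> R2) p : divergence_free_at F p ->
  exists d1 d2, is_grad (fun q => fst (F q)) p d1 /\ is_grad (fun q => snd (F q)) p d2 /\
  fst d1 + snd d2 = 0.
Proof.
  intros [Hd H0]. destruct (differentiable_components F p Hd) as [H1 H2].
  apply differentiable_is_grad in H1. apply differentiable_is_grad in H2.
  eexists. eexists. split. exact H1. split. exact H2.
  rewrite <- H0. reflexivity.
Qed.

Section Radial.
Variable n : R2 -> R.
Hypothesis Hn : C2_norm n.
Let Nn : is_norm n := proj1 Hn.
Let gn p (Hp : p <> zero) : is_grad n p (grad2 n p) := proj1 (proj2 Hn p Hp).

(** On the ray through [p] the norm itself is, up to a factor, the parameter. *)
Lemma radial_profile (w : R -> R) p : p <> zero -> differentiable (fun q => w (n q)) p ->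
  is_derive w (n p) (Derive w (n p)) /\
  is_grad (fun q => w (n q)) p (scal (Derive w (n p)) (grad2 n p)).
Proof.
  intros Hp Hd. apply differentiable_is_grad in Hd.
  assert (P := nrm_pos n Nn p Hp).
  assert (H : ex_derive w (n p)).
  { eexists.
    apply (is_derive_ext_loc (fun s : R => w (n (pt2 (0 + s * (fst p / n p)) (0 + s * (snd p / n p)))))).
    - exists (mkposreal _ P). intros s Hs. change (Rabs (s - n p) < n p) in Hs.
      apply Rabs_def2 in Hs. f_equal.
      replace (pt2 _ _) with (scal (s / n p) p).
      + rewrite (nrm_scal n Nn), Rabs_pos_eq. field; lra. apply Rdiv_le_0_compat; lra.
      + apply R2_eq; coords; field; lra.
    - apply (is_grad_path (fun q => w (n q)) (fun s => 0 + s * (fst p / n p)) (fun s => 0 + s * (snd p / n p)) (n p) (grad2 (fun q => w (n q)) p) (fst p / n p) (snd p / n p)); try apply is_derive_affine.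
      replace (pt2 _ _) with p; trivial.
      apply R2_eq; coords; field; lra. }
  apply Derive_correct in H. split; trivial.
  apply (is_grad_comp1 w n p _ _ H). now apply gn.
Qed.

Lemma radial_grads (g : R -> R) p l : p <> zero -> is_derive g (n p) l ->
  is_grad (fun q => fst (radial_field n g q)) p (pt2 (g (n p) + fst p * (l * fst (grad2 n p))) (fst p * (l * snd (grad2 n p)))) /\
  is_grad (fun q => snd (radial_field n g q)) p (pt2 (snd p * (l * fst (grad2 n p))) (g (n p) + snd p * (l * snd (grad2 n p)))).
Proof.
  intros Hp Hl. assert (H := is_grad_comp1 g n p _ _ Hl (gn p Hp)). split.
  - assert (K := is_grad_mult _ _ _ _ _ H (is_grad_fst p)).
    match type of K with is_grad _ _ ?d => replace (pt2 (g (n p) + _) _) with d end. exact K.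
    destruct (grad2 n p) as [a b], p as [x y]. change R in a, b, x, y.
    apply R2_eq; coords; ring.
  - assert (K := is_grad_mult _ _ _ _ _ H (is_grad_snd p)).
    match type of K with is_grad _ _ ?d => replace (pt2 (snd p * _) _) with d end. exact K.
    destruct (grad2 n p) as [a b], p as [x y]. change R in a, b, x, y.
    apply R2_eq; coords; ring.
Qed.

(** By Euler's identity for [n], the divergence of g(n) p is 2 g(n) + n g'(n). *)
Lemma radial_field_div (g : R -> R) p : p <> zero ->
  (divergence_free_at (radial_field n g) p <-> is_derive g (n p) (- 2 * g (n p) / n p)).
Proof.
  intros Hp. assert (P := nrm_pos n Nn p Hp). split.
  - intros H.
    assert (Hd : differentiable (fun q => g (n q)) p).
    { destruct (divergence_free_inv _ _ H) as (d1 & d2 & H1 & H2 & _).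
      (* pairing the field with q / |q|^2 recovers g(n) *)
      set (f := fun q => (fst q * fst (radial_field n g q) + snd q * snd (radial_field n g q)) / dot2 q q).
      assert (Dp := dot2_self_pos p Hp).
      assert (G1 := is_grad_plus _ _ _ _ _ (is_grad_mult _ _ _ _ _ (is_grad_fst p) H1) (is_grad_mult _ _ _ _ _ (is_grad_snd p) H2)).
      assert (G2 : C1_at (fun q => / dot2 q q) p).
      { apply C1_at_inv; [|lra]. apply C1_at_plus; apply C1_at_mult; (apply C1_at_fst || apply C1_at_snd). }
      apply C1_at_grad in G2.
      eapply is_grad_differentiable, is_grad_ext_loc. 2: exact (is_grad_mult _ _ _ _ _ G1 G2).
      apply filter_imp with (2 := open_nonzero p Hp). intros q Hq.
      assert (Dq := dot2_self_pos q Hq).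
      change ((fst q * (g (n q) * fst q) + snd q * (g (n q) * snd q)) * / dot2 q q = g (n q)).
      replace (fst q * (g (n q) * fst q) + snd q * (g (n q) * snd q)) with (g (n q) * dot2 q q).
      field; lra. unfold dot2. toR; ring. }
    destruct (radial_profile g p Hp Hd) as [Hg _].
    destruct (radial_grads g p _ Hp Hg) as [K1 K2].
    assert (E := proj2 H). unfold div0 in E.
    rewrite (dder_grad _ _ _ _ K1), (dder_grad _ _ _ _ K2) in E.
    assert (Eu := grad2_norm_euler n p Hn Hp).
    replace (- 2 * g (n p) / n p) with (Derive g (n p)); trivial.
    revert E Eu P. clear. generalize (Derive g (n p)). generalize (g (n p)); generalize (n p). intros r gr l.
    destruct (grad2 n p) as [a b], p as [x y]. change R in a, b, x, y.
    intros E Eu P. change (a * x + b * y = r) in Eu.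
    change ((gr + x * (l * a)) * 1 + x * (l * b) * 0 + (y * (l * a) * 0 + (gr + y * (l * b)) * 1) = 0) in E.
    apply Rmult_eq_reg_r with r; [|lra].
    replace (- 2 * gr / r * r) with (- 2 * gr) by (field; lra). rewrite <- Eu. lra.
  - intros H. destruct (radial_grads g p _ Hp H) as [K1 K2].
    apply (divergence_free_grads _ _ _ _ K1 K2).
    assert (Eu := grad2_norm_euler n p Hn Hp).
    revert Eu P. clear. generalize (g (n p)); generalize (n p). intros r gr.
    destruct (grad2 n p) as [a b], p as [x y]. change R in a, b, x, y. intros Eu P.
    change (a * x + b * y = r) in Eu.
    change (gr + x * (- 2 * gr / r * a) + (gr + y * (- 2 * gr / r * b)) = 0).
    replace (_ + _) with (2 * gr - 2 * gr / r * (a * x + b * y)) by (field; lra).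
    rewrite Eu. field; lra.
Qed.

Lemma sphere_point r : 0 < r -> exists p, p <> zero /\ n p = r.
Proof.
  intros Hr. destruct (unit_exists n Nn) as [p Hp]. exists (scal r p).
  split. apply scal_neq0. lra. apply nrm_nz with n; trivial; lra.
  rewrite (nrm_scal n Nn), Hp, Rabs_pos_eq; lra.
Qed.
End Radial.

(** The equation says that r^2 g(r) has derivative 0. *)
Lemma inverse_square_unique (g : R -> R) a (b : Rbar) : 0 <= a ->
  (forall r, a < r -> Rbar_lt r b -> is_derive g r (- 2 * g r / r)) ->
  forall r s, a < r -> Rbar_lt r b -> a < s -> Rbar_lt s b -> r * r * g r = s * s * g s.
Proof.
  intros Ha H.
  assert (W : forall r s, a < r -> r <= s -> Rbar_lt s b -> r * r * g r = s * s * g s).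
  { intros r s Hr Hrs Hs.
    assert (Hd : forall t, r <= t <= s -> is_derive (fun t => t * t * g t) t 0).
    { intros t Ht. assert (K := H t ltac:(lra)).
      assert (Hb : Rbar_lt t b). { apply Rbar_le_lt_trans with s; trivial. simpl; lra. }
      specialize (K Hb).
      replace 0 with ((1 * t + t * 1) * g t + (t * t) * (- 2 * g t / t)) by (field; lra).
      apply (is_derive_mult (fun t => t * t) g t); trivial.
      - auto_derive; trivial; ring.
      - intros; apply Rmult_comm. }
    destruct (MVT_gen (fun t => t * t * g t) r s (fun _ => 0)) as [c [_ Hc]].
    - intros t Ht. rewrite Rmin_left, Rmax_right in Ht by lra. apply Hd; lra.
    - intros t Ht. rewrite Rmin_left, Rmax_right in Ht by lra. apply continuity_pt_filterlim.
      apply (ex_derive_continuous (fun t : R => t * t * g t)). eexists. now apply Hd.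
    - lra. }
  intros r s Hr Hr' Hs Hs'. destruct (Rle_lt_dec r s).
  - now apply W.
  - symmetry. apply W; trivial. lra.
Qed.

Lemma inverse_square_derive c r : r <> 0 -> is_derive (fun r => c / (r * r)) r (- 2 * (c / (r * r)) / r).
Proof. intros H. auto_derive. nra. field. trivial. Qed.

(** A gradient at the origin is odd by the symmetry of [n], hence 0, while [n] grows
    linearly along rays. *)
Lemma norm_not_differentiable (n : R2 -> R) : is_norm n -> ~ differentiable n (zero : R2).
Proof.
  intros Hn Hd. apply differentiable_is_grad in Hd. set (g := grad2 n zero) in *.
  destruct (unit_exists n Hn) as [p Hp].
  assert (K1 := norm_grad_le n Hn zero g p Hd).
  assert (E : dot2 g p = 0).
  { assert (G : is_grad n zero (opp g)).
    { apply is_grad_ext_loc with (fun z => n (scal (-1) z)).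
      - apply filter_forall. intros z. rewrite (nrm_scal n Hn), Rabs_left by lra. ring.
      - replace (opp g) with (scal (-1) g).
        + apply is_grad_scal_arg. refine (eq_ind_r (fun z => is_grad n z g) Hd _).
          apply R2_eq; coords; ring.
        + apply R2_eq; coords; ring. }
    assert (U := is_grad_unique _ _ _ _ Hd G).
    assert (U1 := f_equal fst U). assert (U2 := f_equal snd U).
    destruct g as [a b]. change R in a, b. change (a = - a) in U1. change (b = - b) in U2.
    change (a * fst p + b * snd p = 0). replace a with 0 by lra. replace b with 0 by lra. toR; ring. }
  assert (Hl := is_grad_dder n zero g p Hd). rewrite E in Hl.
  apply is_derive_Reals in Hl.
  destruct (Hl (1/2) ltac:(lra)) as [d Kd].
  assert (Hd2 : 0 < d / 2) by (generalize (cond_pos d); lra).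
  specialize (Kd (d/2) ltac:(lra) ltac:(rewrite Rabs_pos_eq; lra)).
  rewrite Rplus_0_l in Kd.
  change (Rabs ((n (plus zero (scal (d/2) p)) - n (plus zero (scal 0 p))) / (d/2) - 0) < 1/2) in Kd.
  assert (Z : n (plus zero (scal 0 p)) = 0) by (rewrite plus_scal0; apply (nrm_0 n Hn)).
  assert (Y : n (plus zero (scal (d/2) p)) = d / 2 * 1).
  { transitivity (n (scal (d/2) p)). { f_equal. apply plus_zero_l. }
    rewrite (nrm_scal n Hn), Hp, Rabs_pos_eq; lra. }
  rewrite Z, Y in Kd.
  replace ((d / 2 * 1 - 0) / (d / 2) - 0) with 1 in Kd by (field; lra).
  rewrite Rabs_R1 in Kd. lra.
Qed.

Section Catenoid.
Variables Psi Phi : R2 -> R.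
Hypothesis HPsi : strict_C2_norm Psi.
Hypothesis HPhi : strict_C2_norm Phi.
Hypothesis Hev : even_fst Phi.
Let n := dual2 Psi.
Let Hn : C2_norm n := dual_is_C2_norm Psi (proj1 HPsi) (proj2 HPsi).
Let NPsi : is_norm Psi := proj1 (proj1 HPsi).

Lemma annulus_open r0 r1 p : annulus n r0 r1 p -> locally p (annulus n r0 r1).
Proof.
  intros [H1 H2]. assert (Cn := nrm_continuous n (proj1 Hn) p).
  apply filter_and. now apply cont_gt.
  apply (Cn (fun y => Rbar_lt y r1)). now apply open_Rbar_lt.
Qed.

Lemma dual_grad_neq0 x : x <> zero -> grad2 n x <> zero.
Proof.
  intros Hx. destruct (dual_norm_C2 Psi (proj1 HPsi) (proj2 HPsi) x Hx) as (H & _).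
  apply nrm_nz with Psi; trivial. unfold n. rewrite H. lra.
Qed.

(** grad w(n) = w'(n) grad n, and the gradient of [Psi] there is the direction p / n(p)
    up to the sign of w', which also multiplies the derivative of [Phi].  At w' = 0 the
    norm [Psi] would have to be differentiable at the origin. *)
Lemma catenoid_field (w : R -> R) p : p <> zero ->
  differentiable (fun q => w (n q)) p -> differentiable Psi (grad2 (fun q => w (n q)) p) ->
  Derive w (n p) <> 0 /\
  aniso_field Psi Phi (fun q => w (n q)) p = radial_field n (catenoid_g Phi w) p.
Proof.
  intros Hp Hd HdP.
  destruct (radial_profile n Hn w p Hp Hd) as [Hw Hg].
  assert (P := nrm_pos n (proj1 Hn) p Hp).
  set (l := Derive w (n p)) in *.
  assert (Eg := grad2_is_grad _ _ _ Hg).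
  assert (Hl : l <> 0).
  { intros E. rewrite Eg, E in HdP. rewrite (scal_zero_l (grad2 n p) : scal 0 (grad2 n p) = zero) in HdP.
    now apply (norm_not_differentiable Psi NPsi). }
  split; trivial.
  unfold aniso_field, radial_field, catenoid_g. fold l. rewrite Eg.
  destruct (dual_norm_C2 Psi (proj1 HPsi) (proj2 HPsi) p Hp) as (E1 & _ & E3 & _).
  fold n in E1, E3.
  rewrite (nrm_scal Psi NPsi), E1, Rmult_1_r.
  rewrite (grad2_norm_scal Psi l); [|apply HPsi|now apply dual_grad_neq0|trivial].
  rewrite E3, !scal_scal. f_equal.
  assert (D1 : forall v, dot2 v (pt2 1 0) = fst v) by (intros v; unfold dot2; simpl; toR; ring).
  rewrite !D1.
  unfold Rabs. destruct (Rcase_abs l) as [L|L].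
  - rewrite (even_fst_grad Phi HPhi Hev) by apply pt2_1_neq0. simpl. toR. field. lra.
  - toR. field. lra.
Qed.

Lemma catenoid_solution (w : R -> R) r0 r1 : 0 <= r0 ->
  aniso_solution Psi Phi (annulus n r0 r1) (fun q => w (n q)) ->
  forall p, annulus n r0 r1 p ->
  Derive w (n p) <> 0 /\ divergence_free_at (radial_field n (catenoid_g Phi w)) p.
Proof.
  intros Hr0 H p Hp.
  assert (nz : forall q, annulus n r0 r1 q -> q <> zero).
  { intros q [Hq _]. apply nrm_nz with n; [exact (proj1 Hn)|]. lra. }
  destruct (H p Hp) as (H1 & H2 & H3 & H4).
  split. { apply (catenoid_field w p); auto. }
  apply divergence_free_ext_loc with (2 := H4).
  apply filter_imp with (2 := annulus_open _ _ _ Hp). intros q Hq.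
  destruct (H q Hq) as (K1 & K2 & _). apply catenoid_field; auto.
Qed.

Lemma Rbar_between (r0 : R) (r1 : Rbar) : Rbar_lt r0 r1 -> exists r, r0 < r /\ Rbar_lt r r1.
Proof.
  destruct r1 as [r1| |]; simpl; intros H.
  - exists ((r0 + r1) / 2). simpl. lra.
  - exists (r0 + 1). simpl. split; trivial; lra.
  - contradiction.
Qed.

(** The constant is r^2 g(r) = r times the horizontal derivative of [Phi] at (w'(r), 1),
    and w' does not vanish. *)
Lemma catenoid_g_formula (w : R -> R) r0 r1 : 0 <= r0 -> Rbar_lt r0 r1 ->
  aniso_solution Psi Phi (annulus n r0 r1) (fun q => w (n q)) ->
  exists c, c <> 0 /\ forall r, r0 < r -> Rbar_lt r r1 -> catenoid_g Phi w r = c / (r * r).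
Proof.
  intros Hr0 Hr H.
  assert (HD : forall r, r0 < r -> Rbar_lt r r1 -> Derive w r <> 0 /\
     is_derive (catenoid_g Phi w) r (- 2 * catenoid_g Phi w r / r)).
  { intros r H1 H2. destruct (sphere_point n Hn r) as (p & Hp & <-). lra.
    destruct (catenoid_solution w r0 r1 Hr0 H p (conj H1 H2)) as [K1 K2].
    split; trivial. now apply radial_field_div. }
  destruct (Rbar_between r0 r1 Hr) as (s & S1 & S2).
  exists (s * s * catenoid_g Phi w s). split.
  - destruct (HD s S1 S2) as [K _].
    assert (D1 : forall v, dot2 v (pt2 1 0) = fst v) by (intros v; unfold dot2; simpl; toR; ring).
    unfold catenoid_g. rewrite D1.
    assert (Z := even_fst_grad_neq0 Phi HPhi Hev _ K).
    set (z := fst _) in *. replace (s * s * (z / s)) with (s * z) by (field; lra).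
    apply Rmult_integral_contrapositive_currified; trivial. lra.
  - intros r H1 H2.
    rewrite <- (inverse_square_unique (catenoid_g Phi w) r0 r1 Hr0) with (r := r); trivial.
    + field. lra.
    + intros t T1 T2. now apply HD.
Qed.

Lemma extension_formula (w : R -> R) r0 r1 g c : 0 <= r0 -> Rbar_lt r0 r1 ->
  (forall r, r0 < r -> Rbar_lt r r1 -> catenoid_g Phi w r = c / (r * r)) ->
  extends_catenoid_g n Phi w r0 r1 g ->
  forall r, 0 < r -> g r = c / (r * r).
Proof.
  intros Hr0 Hr Hc [E1 E2] r Hrp.
  destruct (Rbar_between r0 r1 Hr) as (s & S1 & S2).
  assert (HD : forall t, 0 < t -> Rbar_lt t p_infty -> is_derive g t (- 2 * g t / t)).
  { intros t Ht _. destruct (sphere_point n Hn t Ht) as (p & Hp & <-).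
    apply radial_field_div; auto. }
  assert (K := inverse_square_unique g 0 p_infty (Rle_refl 0) HD r s Hrp I ltac:(lra) I).
  rewrite (E1 s S1 S2), (Hc s S1 S2) in K.
  replace (s * s * (c / (s * s))) with c in K by (field; lra).
  rewrite <- K. field. lra.
Qed.

Lemma extension_exists (w : R -> R) r0 r1 c : 0 <= r0 ->
  (forall r, r0 < r -> Rbar_lt r r1 -> catenoid_g Phi w r = c / (r * r)) ->
  extends_catenoid_g n Phi w r0 r1 (fun r => c / (r * r)).
Proof.
  intros Hr0 Hc. split.
  - intros r H1 H2. symmetry. now apply Hc.
  - intros p Hp. apply (radial_field_div n Hn); trivial. apply inverse_square_derive.
    apply Rgt_not_eq. apply nrm_pos; trivial. exact (proj1 Hn).
Qed.
End Catenoid.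

(** * The conjugate potential *)

Lemma RInt_primitive (f : R -> R) (a b : R) : (forall t, continuous f t) ->
  is_derive (fun s : R => RInt f a s) b (f b).
Proof.
  intros Hf. apply (is_derive_RInt f (fun s => RInt f a s) a).
  - apply filter_forall. intros s. apply (RInt_correct f).
    apply (ex_RInt_continuous (V := R_CompleteNormedModule)). intros; apply Hf.
  - apply Hf.
Qed.

Lemma const_of_derive_0 (f : R -> R) a b :
  (forall s, Rmin a b <= s <= Rmax a b -> is_derive f s 0) -> f b = f a.
Proof.
  intros H. destruct (MVT_gen f a b (fun _ => 0)) as [c [_ Hc]].
  - intros s Hs. apply H. lra.
  - intros s Hs. apply continuity_pt_filterlim. apply (ex_derive_continuous f). eexists. now apply H.
  - lra.
Qed.

(** Gradient of the conjugate potential, [rotated_field] with g(r) = c / r^2. *)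
Definition inverse_square_field (n : R2 -> R) (c : R) (q : R2) : R2 :=
  scal (c / (n q * n q)) (J q).

Lemma J_neq0 p : p <> zero -> J p <> zero.
Proof.
  intros H. apply R2_neq in H. apply R2_neq. destruct p as [a b]. change R in a, b.
  change (a <> 0 \/ b <> 0) in H. change (- b <> 0 \/ a <> 0). lra.
Qed.

Section Potential.
Variable n : R2 -> R.
Hypothesis Nn : is_norm n.
Variable c : R.

(** The field is homogeneous of degree -1 and orthogonal to rays, so the potential
    depends on the direction of p alone.  Directions in the half plane around p0 are
    recorded by the slope s of p with respect to p0 and J p0, and along the line p0 + s
    J p0 the derivative of the potential is c |p0|^2 / n^2. *)
Lemma local_potential p0 : p0 <> zero -> exists alpha : R2 -> R,
  forall p, 0 < dot2 p0 p -> is_grad alpha p (inverse_square_field n c p).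
Proof.
  intros Hp0.
  set (line := fun t : R => plus p0 (scal t (J p0))).
  assert (D0 := dot2_self_pos p0 Hp0).
  assert (Ldot : forall t, dot2 p0 (line t) = dot2 p0 p0).
  { intros t. unfold line. rewrite dot2_plus_r, dot2_scal_r. destruct p0 as [a b]. change R in a, b.
    coords; ring. }
  assert (Lnz : forall t, line t <> zero).
  { intros t E. specialize (Ldot t). rewrite E, dot2_sym, dot2_zero_l in Ldot. lra. }
  assert (Lpos : forall t, 0 < n (line t)) by (intros t; now apply nrm_pos).
  set (f := fun t => c * dot2 p0 p0 / (n (line t) * n (line t))).
  assert (Cf : forall t, continuous f t).
  { intros t. apply (cont_div (fun _ => c * dot2 p0 p0) (fun t => n (line t) * n (line t))).
    - apply continuous_const.
    - assert (Cn : continuous (fun t => n (line t)) t).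
      { apply (continuous_comp line n). apply continuous_line. now apply nrm_continuous. }
      now apply cont_mult.
    - generalize (Lpos t). intros; nra. }
  exists (fun p => RInt f 0 ((fst (J p0) * fst p + snd (J p0) * snd p) * / (fst p0 * fst p + snd p0 * snd p))).
  intros p Hp.
  assert (Hden : fst p0 * fst p + snd p0 * snd p <> 0) by (unfold dot2 in Hp; apply Rgt_not_eq; exact Hp).
  assert (G1 := is_grad_lin (fst (J p0)) (snd (J p0)) p).
  assert (G2 := is_grad_lin (fst p0) (snd p0) p).
  set (d2 := fst p0 * fst p + snd p0 * snd p) in *.
  assert (G3 : is_grad (fun q => / (fst p0 * fst q + snd p0 * snd q)) p
     (pt2 (- / (d2 * d2) * fst (pt2 (fst p0) (snd p0))) (- / (d2 * d2) * snd (pt2 (fst p0) (snd p0))))).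
  { apply (is_grad_comp1 Rinv (fun q => fst p0 * fst q + snd p0 * snd q)); trivial.
    auto_derive. exact Hden. fold d2. field. exact Hden. }
  assert (G4 := is_grad_mult _ _ _ _ _ G1 G3).
  assert (G5 := is_grad_comp1 (fun s => RInt f 0 s) _ p _ _ (RInt_primitive f 0 _ Cf) G4).
  cbv beta in G5.
  match type of G5 with is_grad _ _ ?d => replace (inverse_square_field n c p) with d end. exact G5.
  clear G1 G2 G3 G4 G5.
  set (s := (fst (J p0) * fst p + snd (J p0) * snd p) * / (fst p0 * fst p + snd p0 * snd p)).
  assert (Ep : p = scal (d2 / dot2 p0 p0) (line s)).
  { unfold line, s, d2. destruct p0 as [a b], p as [x y]. change R in a, b, x, y.
    change (0 < a * a + b * b) in D0. change (a * x + b * y <> 0) in Hden.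
    apply R2_eq; coords; field; lra. }
  assert (En : n p = d2 / dot2 p0 p0 * n (line s)).
  { rewrite Ep at 1. rewrite (nrm_scal n Nn), Rabs_pos_eq; trivial.
    apply Rdiv_le_0_compat; trivial. apply Rlt_le, Hp. }
  unfold f, inverse_square_field. fold s. rewrite En.
  assert (PN := Lpos s). revert PN. generalize (n (line s)). intros N PN.
  clear -D0 Hp PN Hden. unfold d2 in *. clear d2.
  destruct p0 as [a b], p as [x y]. change R in a, b, x, y.
  change (0 < a * a + b * b) in D0. change (0 < a * x + b * y) in Hp. clear Hden.
  apply R2_eq; coords; field; repeat split; lra.
Qed.

Lemma half_plane_open (p0 : R2) : open (fun p => 0 < dot2 p0 p).
Proof.
  intros p Hp. apply cont_gt; trivial. apply (cont_dot2 (fun _ => p0) (fun p => p)).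
  apply continuous_const. apply continuous_id.
Qed.

Lemma circle_derive (rho t : R) :
  is_derive (fun t => rho * cos (2 * PI * t)) t (rho * (- (2 * PI) * sin (2 * PI * t))) /\
  is_derive (fun t => rho * sin (2 * PI * t)) t (rho * ((2 * PI) * cos (2 * PI * t))).
Proof. split; auto_derive; trivial; ring. Qed.

Lemma circle_neq0 s : pt2 (cos s) (sin s) <> zero.
Proof.
  intros E. assert (E1 := f_equal fst E). assert (E2 := f_equal snd E).
  change (cos s = 0) in E1. change (sin s = 0) in E2.
  generalize (sin2_cos2 s). rewrite E1, E2. unfold Rsqr. lra.
Qed.

(** Along a circle around the origin the continuation has derivative c times a positive
    function, so a full turn changes its value. *)
Lemma inverse_square_multivalued (O : R2 -> Prop) (F : R2 -> R2) : c <> 0 ->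
  locally (zero : R2) O -> (forall p, p <> zero -> F p = inverse_square_field n c p) ->
  multivalued_in (fun p => O p /\ p <> zero) F.
Proof.
  intros Hc [rho HO] HF.
  set (e := fun t => pt2 (cos (2 * PI * t)) (sin (2 * PI * t))).
  set (r := rho / 2). assert (Hr : 0 < r) by (unfold r; generalize (cond_pos rho); lra).
  set (gamma := fun t => pt2 (r * cos (2 * PI * t)) (r * sin (2 * PI * t))).
  assert (Ege : forall t, gamma t = scal r (e t)) by reflexivity.
  assert (gnz : forall t, gamma t <> zero).
  { intros t. rewrite Ege. apply scal_neq0. lra. apply circle_neq0. }
  assert (Cg : forall t, continuous gamma t).
  { intros t. apply (continuous_pt2 (fun t => r * cos (2 * PI * t)) (fun t => r * sin (2 * PI * t)));
    apply (ex_derive_continuous (V := R_NormedModule)); eexists;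
    [exact (proj1 (circle_derive r t)) | exact (proj2 (circle_derive r t))]. }
  assert (Ce : forall t, continuous e t).
  { intros t. apply (continuous_pt2 (fun t => cos (2 * PI * t)) (fun t => sin (2 * PI * t)));
    apply (ex_derive_continuous (V := R_NormedModule)); auto_derive; trivial. }
  assert (Pe : forall t, 0 < n (e t)) by (intros t; apply nrm_pos; trivial; apply circle_neq0).
  set (K := fun t => 2 * PI / (n (e t) * n (e t))).
  assert (CK : forall t, continuous K t).
  { intros t. apply (cont_div (fun _ => 2 * PI) (fun t => n (e t) * n (e t))).
    - apply continuous_const.
    - assert (Cn : continuous (fun t => n (e t)) t).
      { apply (continuous_comp e n). apply Ce. now apply nrm_continuous. }
      now apply cont_mult.
    - generalize (Pe t). intros; nra. }
  assert (PK : forall t, 0 < K t).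
  { intros t. apply Rdiv_lt_0_compat. generalize PI_RGT_0; lra. apply Rmult_lt_0_compat; apply Pe. }
  set (a := fun t => c * RInt K 0 t).
  assert (Da : forall t, is_derive a t (c * K t)).
  { intros t. apply (is_derive_scal (fun t => RInt K 0 t)). now apply RInt_primitive. }
  exists gamma, a. split; [|split; [|split]].
  - intros t _. split; [apply Cg|]. split; [|apply gnz].
    apply HO. assert (Hrho : r < rho) by (unfold r; generalize (cond_pos rho); lra).
    split.
    + change (Rabs (r * cos (2 * PI * t) - 0) < rho). rewrite Rminus_0_r, Rabs_mult, Rabs_pos_eq by lra.
      assert (Rabs (cos (2 * PI * t)) <= 1) by (apply Rabs_le, COS_bound). nra.
    + change (Rabs (r * sin (2 * PI * t) - 0) < rho). rewrite Rminus_0_r, Rabs_mult, Rabs_pos_eq by lra.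
      assert (Rabs (sin (2 * PI * t)) <= 1) by (apply Rabs_le, SIN_bound). nra.
  - unfold gamma. rewrite !Rmult_0_r, !Rmult_1_r, cos_0, sin_0, cos_2PI, sin_2PI. reflexivity.
  - intros t _. destruct (local_potential (gamma t) (gnz t)) as [alpha Ha].
    exists (fun p => 0 < dot2 (gamma t) p), (fun p => alpha p + (a t - alpha (gamma t))).
    split; [apply half_plane_open|split; [now apply dot2_self_pos|split]].
    + intros p Hp. assert (Hp0 : p <> zero).
      { intros ->. rewrite dot2_sym, dot2_zero_l in Hp. lra. }
      assert (G : is_grad (fun p => alpha p + (a t - alpha (gamma t))) p (inverse_square_field n c p)).
      { replace (inverse_square_field n c p) with (plus (inverse_square_field n c p) (pt2 0 0)) by (apply (plus_zero_r (inverse_square_field n c p))).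
        apply is_grad_plus. now apply Ha. apply is_grad_const. }
      split. now apply is_grad_differentiable with (1 := G).
      rewrite HF by trivial. now apply grad2_is_grad.
    + assert (Hloc : locally t (fun s => 0 < dot2 (gamma t) (gamma s))).
      { apply (Cg t (fun p => 0 < dot2 (gamma t) p)). apply half_plane_open. now apply dot2_self_pos. }
      destruct Hloc as [d Hd]. exists d. intros s Hs _.
      assert (E : alpha (gamma s) - a s = alpha (gamma t) - a t).
      { apply (const_of_derive_0 (fun s => alpha (gamma s) - a s)).
        intros u Hu.
        assert (Hu' : Rabs (u - t) < d).
        { change (Rabs (s - t) < d) in Hs. apply Rabs_def2 in Hs. apply Rabs_def1;
          unfold Rmin, Rmax in Hu; destruct (Rle_dec t s); lra. }
        assert (Hg := Ha _ (Hd u Hu')).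
        destruct (circle_derive r u) as [D1 D2].
        assert (Hpath := is_grad_path alpha _ _ u _ _ _ Hg D1 D2).
        assert (Hm := is_derive_minus _ _ _ _ _ Hpath (Da u)).
        replace 0 with (minus
          (fst (inverse_square_field n c (gamma u)) * (r * (- (2 * PI) * sin (2 * PI * u))) +
          snd (inverse_square_field n c (gamma u)) * (r * (2 * PI * cos (2 * PI * u)))) (c * K u)).
        exact Hm.
        unfold inverse_square_field. rewrite Ege at 1 2 4 5. rewrite (nrm_scal n Nn), Rabs_pos_eq by lra.
        unfold K. assert (Pu := Pe u). revert Pu. generalize (n (e u)). intros N PN.
        assert (T := sin2_cos2 (2 * PI * u)). unfold Rsqr in T.
        change (c / (r * N * (r * N)) * - (r * sin (2 * PI * u)) * (r * (- (2 * PI) * sin (2 * PI * u))) +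
         c / (r * N * (r * N)) * (r * cos (2 * PI * u)) * (r * (2 * PI * cos (2 * PI * u))) - c * (2 * PI / (N * N)) = 0).
        set (S := sin (2 * PI * u)) in *. set (C := cos (2 * PI * u)) in *.
        replace (c * (2 * PI / (N * N))) with (c * (2 * PI / (N * N)) * (S * S + C * C)) by (rewrite T; ring).
        field. split; lra. }
      lra.
  - unfold a. rewrite RInt_point.
    assert (P : 0 < RInt K 0 1).
    { apply RInt_gt_0. lra. intros; apply PK. intros; apply CK. }
    change (c * 0 <> c * RInt K 0 1). rewrite Rmult_0_r. intros E. symmetry in E.
    apply Rmult_integral in E. destruct E; [easy|lra].
Qed.

(** J q is orthogonal to q, so alpha does not change along the ray through q. *)
Lemma inverse_square_ruled (U : R2 -> Prop) (alpha : R2 -> R) :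
  (forall p, U p -> p <> zero) ->
  (forall p, U p -> is_grad alpha p (inverse_square_field n c p)) ->
  ruled_by_horizontal_lines U alpha.
Proof.
  intros HU Ha P [HP1 HP2]. set (p := fst P) in *.
  exists ((p, 0) : R3). split; [|split; [reflexivity|]].
  - intros E. apply (HU p HP1). exact (f_equal fst E).
  - intros t Ht.
    assert (Ht' : forall s, Rmin 0 t <= s <= Rmax 0 t -> U (plus p (scal s p))) by exact Ht.
    split.
    + apply (Ht' t). split. apply Rmin_r. apply Rmax_r.
    + change (snd P + t * 0 = alpha (plus p (scal t p))). rewrite HP2, Rmult_0_r, Rplus_0_r. symmetry.
      replace (alpha p) with (alpha (plus p (scal 0 p))) by now rewrite plus_scal0.
      apply (const_of_derive_0 (fun s => alpha (plus p (scal s p)))).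
      intros s Hs.
      assert (Hg := Ha _ (Ht' s Hs)).
      assert (K : is_derive (fun s => alpha (pt2 (fst p + s * fst p) (snd p + s * snd p))) s
        (fst (inverse_square_field n c (plus p (scal s p))) * fst p + snd (inverse_square_field n c (plus p (scal s p))) * snd p)).
      { apply is_grad_path; try apply is_derive_affine. exact Hg. }
      replace 0 with (fst (inverse_square_field n c (plus p (scal s p))) * fst p + snd (inverse_square_field n c (plus p (scal s p))) * snd p).
      exact K.
      unfold inverse_square_field. set (k := c / _). clearbody k. clear. clearbody p.
      destruct p as [x y]. change R in x, y.
      coords; ring.
Qed.
End Potential.

(** * The dual equation *)

Section DualEquation.
Variables n phi : R2 -> R.
Hypothesis Hn : C2_norm n.
Hypothesis Hphi : C2_norm phi.
Hypothesis HJ : forall v, n (J v) = n v.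
Variable c : R.
Hypothesis Hc : c <> 0.
Let Nn : is_norm n := proj1 Hn.

(** Differentiate n (J p) = n p. *)
Lemma grad2_J p : p <> zero -> grad2 n (J p) = J (grad2 n p).
Proof.
  intros Hp. assert (G := proj1 (proj2 Hn (J p) (J_neq0 p Hp))).
  apply is_grad_J_arg in G.
  assert (G' : is_grad n p (opp (J (grad2 n (J p))))).
  { apply is_grad_ext_loc with (2 := G). apply filter_forall. intros q; apply HJ. }
  rewrite (grad2_is_grad _ _ _ G'). destruct (grad2 n (J p)) as [a b]. change R in a, b.
  apply R2_eq; coords; ring.
Qed.

Lemma inverse_square_norm p : p <> zero -> n (inverse_square_field n c p) = Rabs c / n p.
Proof.
  intros Hp. assert (P := nrm_pos n Nn p Hp). unfold inverse_square_field.
  rewrite (nrm_scal n Nn), HJ. unfold Rdiv. rewrite Rabs_mult, Rabs_inv, Rabs_mult, (Rabs_pos_eq (n p)) by lra.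
  field. lra.
Qed.

Lemma inverse_square_grad p : p <> zero ->
  grad2 n (inverse_square_field n c p) = scal (Rabs c / c) (J (grad2 n p)).
Proof.
  intros Hp. assert (P := nrm_pos n Nn p Hp). unfold inverse_square_field.
  assert (P2 : 0 < n p * n p) by now apply Rmult_lt_0_compat.
  rewrite grad2_norm_scal, grad2_J; trivial.
  - f_equal. unfold Rdiv. rewrite Rabs_mult, Rabs_inv, (Rabs_pos_eq (n p * n p)) by lra. field. split; trivial. lra.
  - now apply J_neq0.
  - apply Rmult_integral_contrapositive_currified; trivial. apply Rinv_neq_0_compat; lra.
Qed.

Lemma inverse_square_neq0 p : p <> zero -> inverse_square_field n c p <> zero.
Proof.
  intros Hp. apply nrm_nz with n; trivial. rewrite inverse_square_norm by trivial.
  assert (P := nrm_pos n Nn p Hp). apply Rmult_integral_contrapositive_currified.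
  now apply Rabs_no_R0. apply Rinv_neq_0_compat; lra.
Qed.

(** The point at which the gradient of the dual of the vertical norm enters the dual
    equation: [n (inverse_square_field n c q)] is |c| / n q. *)
Definition slope_point (q : R2) : R2 := pt2 (Rabs c / n q) 1.

Lemma slope_point_neq0 q : slope_point q <> zero.
Proof. apply pt2_1_neq0. Qed.

Lemma dual_field_formula (alpha : R2 -> R) q : q <> zero -> grad2 alpha q = inverse_square_field n c q ->
  aniso_field n phi alpha q = scal (fst (grad2 phi (slope_point q)) * (Rabs c / c)) (J (grad2 n q)).
Proof.
  intros Hq Ha. unfold aniso_field. rewrite Ha, inverse_square_norm, inverse_square_grad, scal_scal by trivial.
  f_equal. f_equal. unfold dot2, slope_point. simpl. toR; ring.
Qed.

Lemma n_C1 p : p <> zero -> C1_at n p.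
Proof. now apply norm_C1. Qed.

Lemma slope_C1 p : p <> zero -> C1_at (fun q => Rabs c / n q) p.
Proof.
  intros Hp. apply C1_at_div. apply C1_at_const. now apply n_C1.
  apply Rgt_not_eq. now apply nrm_pos.
Qed.

Lemma slope_comp_C1 (f : R2 -> R) p : p <> zero -> C1_at f (slope_point p) ->
  C1_at (fun q => f (slope_point q)) p.
Proof.
  intros Hp Hf. apply (C1_at_comp2 f (fun q => Rabs c / n q) (fun _ => 1)); trivial.
  now apply slope_C1. apply C1_at_const.
Qed.

Lemma slope_comp_grad (f : R2 -> R) p : p <> zero -> C1_at f (slope_point p) ->
  exists mu, is_grad (fun q => f (slope_point q)) p (scal mu (grad2 n p)).
Proof.
  intros Hp Hf. assert (P := nrm_pos n Nn p Hp).
  assert (G1 : is_grad (fun q => Rabs c / n q) p (pt2 (- Rabs c / (n p * n p) * fst (grad2 n p)) (- Rabs c / (n p * n p) * snd (grad2 n p)))).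
  { apply (is_grad_comp1 (fun t => Rabs c / t) n).
    - auto_derive. lra. field. lra.
    - now apply (proj2 Hn). }
  assert (G := is_grad_comp2 f (fun q => Rabs c / n q) (fun _ => 1) p _ _ _ (C1_at_grad _ _ Hf) G1 (is_grad_const 1 p)).
  exists (fst (grad2 f (slope_point p)) * (- Rabs c / (n p * n p))).
  match type of G with is_grad _ _ ?d => replace (scal _ (grad2 n p)) with d end. exact G.
  change (pt2 (Rabs c / n p) 1) with (slope_point p).
  destruct (grad2 f (slope_point p)) as [a b], (grad2 n p) as [x y]. change R in a, b, x, y.
  apply R2_eq; coords; ring.
Qed.

Definition flux (q : R2) : R2 := scal (fst (grad2 phi (slope_point q)) * (Rabs c / c)) (J (grad2 n q)).

Lemma flux_C1 p : p <> zero -> C1_at (fun q => fst (flux q)) p /\ C1_at (fun q => snd (flux q)) p.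
Proof.
  intros Hp. destruct (proj2 Hn p Hp) as (_ & C1 & C2).
  assert (Ch : C1_at (fun q => fst (grad2 phi (slope_point q)) * (Rabs c / c)) p).
  { apply C1_at_mult. 2: apply C1_at_const. apply (slope_comp_C1 (fun z => fst (grad2 phi z))); trivial.
    apply (proj2 Hphi), slope_point_neq0. }
  split.
  - apply (C1_at_mult (fun q => fst (grad2 phi (slope_point q)) * (Rabs c / c)) (fun q => - snd (grad2 n q))); trivial.
    now apply C1_at_opp.
  - now apply (C1_at_mult (fun q => fst (grad2 phi (slope_point q)) * (Rabs c / c)) (fun q => fst (grad2 n q))).
Qed.

(** For the field h(n) J (grad n), the derivative of h contributes h' (grad n . J grad
    n) = 0, and the remaining term is h times the antisymmetric part of the Hessian of
    n. *)
Lemma flux_divergence_free p : p <> zero -> divergence_free_at flux p.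
Proof.
  intros Hp. destruct (proj2 Hn p Hp) as (_ & C1 & C2).
  assert (Cphi : C1_at (fun z => fst (grad2 phi z)) (slope_point p)) by apply (proj2 Hphi), slope_point_neq0.
  destruct (slope_comp_grad (fun z => fst (grad2 phi z)) p Hp Cphi) as [mu Gh].
  destruct (C2_norm_hess n p Hn Hp) as (lam & E1 & E2).
  assert (G1 := C1_at_grad _ _ C1). assert (G2 := C1_at_grad _ _ C2). rewrite E1 in G1. rewrite E2 in G2.
  set (sg := Rabs c / c).
  assert (K1 := is_grad_mult _ _ _ _ _ (is_grad_cmult sg _ _ _ Gh) (is_grad_cmult (-1) _ _ _ G2)).
  assert (K2 := is_grad_mult _ _ _ _ _ (is_grad_cmult sg _ _ _ Gh) G1).
  refine (divergence_free_grads flux p _ _ (is_grad_ext_loc _ _ _ _ _ K1) (is_grad_ext_loc _ _ _ _ _ K2) _).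
  - apply filter_forall. intros q. unfold flux. fold sg.
    coords; ring.
  - apply filter_forall. intros q. unfold flux. fold sg.
    coords; ring.
  - generalize (fst (grad2 phi (slope_point p))). intros h. destruct (grad2 n p) as [a b], p as [x y].
    change R in a, b, x, y, h. clearbody sg. clear.
    coords; ring.
Qed.

Lemma inverse_square_solution (U : R2 -> Prop) (alpha : R2 -> R) :
  open U -> (forall p, U p -> p <> zero) ->
  (forall p, U p -> is_grad alpha p (inverse_square_field n c p)) ->
  aniso_solution n phi U alpha.
Proof.
  intros HU Hnz Ha p Hp. assert (Hp0 := Hnz p Hp).
  assert (Eg := grad2_is_grad _ _ _ (Ha p Hp)).
  split; [|split; [|split]].
  - now apply is_grad_differentiable with (1 := Ha p Hp).
  - rewrite Eg. eapply is_grad_differentiable. apply (proj2 Hn). now apply inverse_square_neq0.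
  - eapply is_grad_differentiable. apply (proj2 Hphi). apply pt2_1_neq0.
  - apply divergence_free_ext_loc with (2 := flux_divergence_free p Hp0).
    apply filter_imp with (2 := HU p Hp). intros q Hq. symmetry. apply dual_field_formula.
    now apply Hnz. now apply grad2_is_grad, Ha.
Qed.
End DualEquation.

(** * Double integrals over a rectangle *)

(** Parameter of a variation together with the parameters of the surface. *)
Definition RxR2 : NormedModule R_AbsRing := prod_NormedModule R_AbsRing R_NormedModule R2.

(** By compactness of the rectangle, bounds on the parameter that hold near each point
    have a common positive lower bound. *)
Lemma rect_uniform (Q : R -> R2 -> Prop) a b c d :
  (forall u v, a <= u <= b -> c <= v <= d ->
     locally ((0, pt2 u v) : RxR2) (fun z : RxR2 => Q (fst z) (snd z))) ->
  exists eta, 0 < eta /\ forall e u v, Rabs e < eta -> a <= u <= b -> c <= v <= d -> Q e (pt2 u v).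
Proof.
  intros H.
  assert (Hd : forall u v, exists delta : posreal, a <= u <= b -> c <= v <= d ->
     forall e x y, Rabs e < delta -> Rabs (x - u) < delta -> Rabs (y - v) < delta -> Q e (pt2 x y)).
  { intros u v. destruct (classic (a <= u <= b /\ c <= v <= d)) as [[Hu Hv]|N].
    - destruct (H u v Hu Hv) as [delta K]. exists delta. intros _ _ e x y He Hx Hy.
      apply (K ((e, pt2 x y) : RxR2)).
      split; [|split].
      + change (Rabs (e - 0) < delta). now rewrite Rminus_0_r.
      + exact Hx.
      + exact Hy.
    - exists (mkposreal 1 Rlt_0_1). tauto. }
  set (delta := fun u v => proj1_sig (constructive_indefinite_description _ (Hd u v))).
  destruct (compactness_value_2d a b c d delta) as [eta Heta].
  exists eta. split. apply cond_pos.
  intros e u v He Hu Hv. apply NNPP. intros HQ. apply (Heta u v Hu Hv).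
  intros (x & y & Hx & Hy & H1 & H2 & H3). apply HQ.
  assert (K := proj2_sig (constructive_indefinite_description _ (Hd x y))). fold (delta x y) in K.
  change (proj1_sig (constructive_indefinite_description _ (Hd x y))) with (delta x y) in K.
  apply (K Hx Hy); trivial. lra.
Qed.

Lemma cont_slice_l (f : R2 -> R) (x : R) y : continuous f (pt2 x y) -> continuous (fun v : R => f (pt2 x v)) y.
Proof.
  intros H. apply (continuous_comp (fun v : R => pt2 x v) f); trivial.
  apply (continuous_pt2 (fun _ : R => x) (fun v : R => v)). apply continuous_const. apply continuous_id.
Qed.

Section Rectangle.
Variables a b c d : R.
Hypothesis Hab : a < b.
Hypothesis Hcd : c < d.

Definition rect_integral (f : R2 -> R) : R := RInt (fun u => RInt (fun v => f (pt2 u v)) c d) a b.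

Lemma rect_integral_ext f g : (forall u v, a < u < b -> c < v < d -> f (pt2 u v) = g (pt2 u v)) -> rect_integral f = rect_integral g.
Proof.
  intros H. unfold rect_integral. apply RInt_ext. intros u Hu. rewrite Rmin_left, Rmax_right in Hu by lra.
  apply RInt_ext. intros v Hv. rewrite Rmin_left, Rmax_right in Hv by lra. now apply H.
Qed.

Lemma inner_ex (f : R2 -> R) : (forall p, continuous f p) -> forall u, ex_RInt (fun v => f (pt2 u v)) c d.
Proof.
  intros H u. apply (ex_RInt_continuous (V := R_CompleteNormedModule)). intros v _.
  apply cont_slice_l, H.
Qed.

Lemma inner_continuous (f : R2 -> R) : (forall p, continuous f p) ->
  forall u, continuous (fun u => RInt (fun v => f (pt2 u v)) c d) u.
Proof.
  intros H u0. apply cont_of_close. intros eps He.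
  set (m := eps / (2 * (d - c))). assert (Hm : 0 < m) by (apply Rdiv_lt_0_compat; lra).
  (* uniformity in v comes from the degenerate rectangle over the point u0 *)
  destruct (rect_uniform (fun e p => Rabs (f (pt2 (u0 + e) (snd p)) - f (pt2 u0 (snd p))) < m) u0 u0 c d) as (eta & P & K).
  { intros u v _ _.
    assert (Cs : continuous (fun z : RxR2 => snd (snd z)) ((0, pt2 u v) : RxR2)).
    { apply (continuous_comp (fun z : RxR2 => snd z) (fun p : R2 => snd p)); apply continuous_snd. }
    assert (Cf : continuous (fun z : RxR2 => f (pt2 (u0 + fst z) (snd (snd z))) - f (pt2 u0 (snd (snd z)))) ((0, pt2 u v) : RxR2)).
    { apply (cont_minus (fun z : RxR2 => f (pt2 (u0 + fst z) (snd (snd z)))) (fun z : RxR2 => f (pt2 u0 (snd (snd z))))).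
      - apply (continuous_comp (fun z : RxR2 => pt2 (u0 + fst z) (snd (snd z))) f); [|apply H].
        apply (continuous_pt2 (fun z : RxR2 => u0 + fst z) (fun z : RxR2 => snd (snd z))); trivial.
        apply (cont_plus (fun z : RxR2 => u0) (fun z : RxR2 => fst z)). apply continuous_const. apply continuous_fst.
      - apply (continuous_comp (fun z : RxR2 => pt2 u0 (snd (snd z))) f); [|apply H].
        apply (continuous_pt2 (fun z : RxR2 => u0) (fun z : RxR2 => snd (snd z))); trivial. apply continuous_const. }
    apply (cont_lt (fun z : RxR2 => Rabs (f (pt2 (u0 + fst z) (snd (snd z))) - f (pt2 u0 (snd (snd z)))))).
    now apply cont_abs.
    change (Rabs (f (pt2 (u0 + 0) v) - f (pt2 u0 v)) < m).
    rewrite Rplus_0_r, Rminus_diag_eq, Rabs_R0; trivial. }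
  exists (mkposreal _ P). intros u Hu. change R in u. change (Rabs (u - u0) < eta) in Hu.
  assert (E : RInt (fun v => f (pt2 u v)) c d - RInt (fun v => f (pt2 u0 v)) c d =
     RInt (fun v => f (pt2 u v) - f (pt2 u0 v)) c d).
  { symmetry. apply (RInt_minus (V := R_CompleteNormedModule)); now apply inner_ex. }
  rewrite E. apply Rle_lt_trans with ((d - c) * m).
  - apply abs_RInt_le_const. lra.
    apply (ex_RInt_minus (V := R_CompleteNormedModule)); now apply inner_ex.
    intros v Hv. apply Rlt_le. specialize (K (u - u0) u0 v Hu ltac:(lra) Hv).
    simpl in K. now replace (u0 + (u - u0)) with u in K by ring.
  - unfold m. replace ((d - c) * (eps / (2 * (d - c)))) with (eps / 2) by (field; lra). lra.
Qed.

Lemma outer_ex (f : R2 -> R) : (forall p, continuous f p) -> ex_RInt (fun u => RInt (fun v => f (pt2 u v)) c d) a b.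
Proof.
  intros H. apply (ex_RInt_continuous (V := R_CompleteNormedModule)). intros u _. now apply inner_continuous.
Qed.

(** Nearest point of the interval from [l] to [r]. *)
Definition clamp (l r t : R) : R := (l + r + Rabs (t - l) - Rabs (t - r)) / 2.

Lemma clamp_in l r t : l <= t <= r -> clamp l r t = t.
Proof. intros H. unfold clamp. rewrite Rabs_pos_eq, Rabs_left1 by lra. field. Qed.
Lemma clamp_bounds l r t : l <= r -> l <= clamp l r t <= r.
Proof.
  intros H. unfold clamp. unfold Rabs. destruct (Rcase_abs (t - l)), (Rcase_abs (t - r)); lra.
Qed.
Lemma clamp_continuous l r t : continuous (clamp l r) t.
Proof.
  apply (cont_mult (fun t : R => l + r + Rabs (t - l) - Rabs (t - r)) (fun _ => / 2)).
  2: apply continuous_const.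
  apply cont_minus. apply cont_plus. apply continuous_const.
  all: apply (cont_abs (fun t : R => t - _)), cont_minus; [apply continuous_id|apply continuous_const].
Qed.

(** Composition with the projection onto the rectangle: the integral is unchanged and
    the function becomes continuous on the whole plane, so that continuity at the points
    of the closed rectangle suffices. *)
Definition clamped (f : R2 -> R) (p : R2) : R := f (pt2 (clamp a b (fst p)) (clamp c d (snd p))).

Definition continuous_on_rect (f : R2 -> R) : Prop :=
  forall u v, a <= u <= b -> c <= v <= d -> continuous f (pt2 u v).

Lemma clamped_continuous f : continuous_on_rect f -> forall p, continuous (clamped f) p.
Proof.
  intros H p.
  apply (continuous_comp (fun p : R2 => pt2 (clamp a b (fst p)) (clamp c d (snd p))) f).
  - apply (continuous_pt2 (fun p : R2 => clamp a b (fst p)) (fun p : R2 => clamp c d (snd p))).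
    + apply (continuous_comp (fun p : R2 => fst p) (clamp a b)). apply continuous_fst_R2, continuous_id. apply clamp_continuous.
    + apply (continuous_comp (fun p : R2 => snd p) (clamp c d)). apply continuous_snd_R2, continuous_id. apply clamp_continuous.
  - apply H; apply clamp_bounds; lra.
Qed.

Lemma clamped_eq f u v : a <= u <= b -> c <= v <= d -> clamped f (pt2 u v) = f (pt2 u v).
Proof. intros Hu Hv. unfold clamped. simpl. now rewrite !clamp_in. Qed.

Lemma rect_integral_clamped f : rect_integral (clamped f) = rect_integral f.
Proof. apply rect_integral_ext. intros u v Hu Hv. apply clamped_eq; lra. Qed.

Lemma rect_integral_lin f g k : continuous_on_rect f -> continuous_on_rect g ->
  rect_integral (fun p => f p + k * g p) = rect_integral f + k * rect_integral g.
Proof.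
  intros Hf Hg. rewrite <- (rect_integral_clamped f), <- (rect_integral_clamped g).
  assert (Cf := clamped_continuous f Hf). assert (Cg := clamped_continuous g Hg).
  transitivity (rect_integral (fun p => clamped f p + k * clamped g p)).
  { apply rect_integral_ext. intros u v Hu Hv. now rewrite !clamped_eq by lra. }
  revert Cf Cg. generalize (clamped f) (clamped g). clear f g Hf Hg. intros f g Cf Cg.
  unfold rect_integral.
  rewrite (RInt_ext _ (fun u => plus (RInt (fun v => f (pt2 u v)) c d) (scal k (RInt (fun v => g (pt2 u v)) c d)))).
  - rewrite (RInt_plus (V := R_CompleteNormedModule)).
    + rewrite (RInt_scal (V := R_CompleteNormedModule)). reflexivity. now apply outer_ex.
    + now apply outer_ex.
    + apply (ex_RInt_scal (V := R_CompleteNormedModule)). now apply outer_ex.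
  - intros u _. rewrite <- (RInt_scal (V := R_CompleteNormedModule)) by now apply inner_ex.
    rewrite <- (RInt_plus (V := R_CompleteNormedModule)).
    + reflexivity.
    + now apply inner_ex.
    + apply (ex_RInt_scal (V := R_CompleteNormedModule)). now apply inner_ex.
Qed.

Lemma rect_integral_bound f m : continuous_on_rect f ->
  (forall u v, a <= u <= b -> c <= v <= d -> Rabs (f (pt2 u v)) <= m) ->
  Rabs (rect_integral f) <= (b - a) * ((d - c) * m).
Proof.
  intros Hf Hm. rewrite <- rect_integral_clamped. assert (Cf := clamped_continuous f Hf).
  unfold rect_integral. apply abs_RInt_le_const. lra. now apply outer_ex.
  intros u Hu. apply abs_RInt_le_const. lra. now apply inner_ex.
  intros v Hv. rewrite clamped_eq by lra. now apply Hm.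
Qed.

Lemma rect_integral_0 : rect_integral (fun _ => 0) = 0.
Proof.
  unfold rect_integral. rewrite (RInt_ext _ (fun _ => 0)).
  - rewrite RInt_const. unfold scal; simpl; unfold mult; simpl. ring.
  - intros u _. rewrite RInt_const. unfold scal; simpl; unfold mult; simpl. ring.
Qed.

Lemma rect_integral_estimate f g l m : continuous_on_rect f -> continuous_on_rect g -> continuous_on_rect l ->
  rect_integral l = 0 ->
  (forall u v, a <= u <= b -> c <= v <= d -> Rabs (f (pt2 u v) - g (pt2 u v) - l (pt2 u v)) <= m) ->
  Rabs (rect_integral f - rect_integral g) <= (b - a) * ((d - c) * m).
Proof.
  intros Hf Hg Hl H0 H.
  assert (Hgl : continuous_on_rect (fun p => g p + 1 * l p)).
  { intros u v Hu Hv. apply (cont_plus g). now apply Hg. apply (cont_mult (fun _ => 1)). apply continuous_const. now apply Hl. }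
  replace (rect_integral f - rect_integral g) with (rect_integral (fun p => f p + (-1) * (g p + 1 * l p))).
  - apply rect_integral_bound.
    + intros u v Hu Hv. apply (cont_plus f). now apply Hf. apply (cont_mult (fun _ => -1)). apply continuous_const. now apply Hgl.
    + intros u v Hu Hv. replace (_ + _) with (f (pt2 u v) - g (pt2 u v) - l (pt2 u v)) by ring. now apply H.
  - rewrite (rect_integral_lin f (fun p => g p + 1 * l p)), (rect_integral_lin g l), H0 by trivial. ring.
Qed.

Section Stokes.
Variables P Q : R2 -> R.
Hypothesis HP : forall p, C1_at P p.
Hypothesis HQ : forall p, C1_at Q p.
Hypothesis P0 : forall u v, ~ (a < u < b /\ c < v < d) -> P (pt2 u v) = 0.
Hypothesis Q0 : forall u v, ~ (a < u < b /\ c < v < d) -> Q (pt2 u v) = 0.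

Lemma partial1 f p : C1_at f p -> is_derive (fun z => f (pt2 z (snd p))) (fst p) (dder (pt2 1 0) f p).
Proof.
  intros H. apply C1_at_grad in H.
  replace (dder (pt2 1 0) f p) with (fst (grad2 f p) * 1 + snd (grad2 f p) * 0).
  - apply (is_grad_path f (fun z => z) (fun _ => snd p)).
    + now rewrite pt2_eta.
    + apply (is_derive_id (K := R_AbsRing)).
    + apply (is_derive_const (V := R_NormedModule)).
  - rewrite Rmult_1_r, Rmult_0_r, Rplus_0_r. reflexivity.
Qed.
Lemma partial2 f p : C1_at f p -> is_derive (fun z => f (pt2 (fst p) z)) (snd p) (dder (pt2 0 1) f p).
Proof.
  intros H. apply C1_at_grad in H.
  replace (dder (pt2 0 1) f p) with (fst (grad2 f p) * 0 + snd (grad2 f p) * 1).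
  - apply (is_grad_path f (fun _ => fst p) (fun z => z)).
    + now rewrite pt2_eta.
    + apply (is_derive_const (V := R_NormedModule)).
    + apply (is_derive_id (K := R_AbsRing)).
  - rewrite Rmult_1_r, Rmult_0_r, Rplus_0_l. reflexivity.
Qed.
Lemma partial1_continuous f p : C1_at f p -> continuous (dder (pt2 1 0) f) p.
Proof. intros H. exact (continuous_fst_R2 _ _ (C1_at_cont_grad f p H)). Qed.
Lemma partial2_continuous f p : C1_at f p -> continuous (dder (pt2 0 1) f) p.
Proof. intros H. exact (continuous_snd_R2 _ _ (C1_at_cont_grad f p H)). Qed.

Lemma rect_integral_partial2 : rect_integral (dder (pt2 0 1) Q) = 0.
Proof.
  unfold rect_integral. rewrite (RInt_ext _ (fun _ => 0)).
  - rewrite RInt_const. unfold scal; simpl; unfold mult; simpl. ring.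
  - intros u _. transitivity (minus (Q (pt2 u d)) (Q (pt2 u c))).
    + apply is_RInt_unique. apply (is_RInt_derive (V := R_CompleteNormedModule) (fun v => Q (pt2 u v))).
      * intros v _. exact (partial2 Q (pt2 u v) (HQ _)).
      * intros v _. apply cont_slice_l. now apply partial2_continuous.
    + rewrite !Q0 by lra. apply Rminus_0_r.
Qed.

(** The derivative is taken under the inner integral and the fundamental theorem is
    applied to the outer one. *)
Lemma rect_integral_partial1 : rect_integral (dder (pt2 1 0) P) = 0.
Proof.
  assert (CP : forall p, continuous P p) by (intros; now apply C1_at_continuous).
  assert (DP : forall u v, is_derive (fun z => P (pt2 z v)) u (dder (pt2 1 0) P (pt2 u v))).
  { intros u v. exact (partial1 P (pt2 u v) (HP _)). }
  unfold rect_integral.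
  set (I := fun u => RInt (fun v => P (pt2 u v)) c d).
  transitivity (minus (I b) (I a)).
  - apply is_RInt_unique. apply (is_RInt_derive (V := R_CompleteNormedModule) I).
    + intros u _. unfold I.
      rewrite (RInt_ext _ (fun v => Derive (fun z => P (pt2 z v)) u)).
      2:{ intros v _. symmetry. apply is_derive_unique, DP. }
      apply (is_derive_RInt_param (fun u v => P (pt2 u v))).
      * apply filter_forall. intros x t _. eexists; apply DP.
      * intros t _. apply continuity_2d_pt_filterlim.
        assert (K : continuous (fun z : R2 => Derive (fun z0 => P (pt2 z0 (snd z))) (fst z)) (pt2 u t)).
        { apply (continuous_ext (dder (pt2 1 0) P)).
          - intros [x y]. symmetry. apply is_derive_unique, DP.
          - now apply partial1_continuous. }
        exact K.
      * apply filter_forall. intros x. now apply inner_ex.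
    + intros u _. apply inner_continuous. intros p. now apply partial1_continuous.
  - assert (Z : forall u, ~ a < u < b -> I u = 0).
    { intros u Hu. unfold I. rewrite (RInt_ext _ (fun _ => 0)).
      - rewrite RInt_const. unfold scal; simpl; unfold mult; simpl. ring.
      - intros v _. apply P0. tauto. }
    rewrite !Z by lra. apply Rminus_0_r.
Qed.

Lemma rect_integral_divergence_0 : rect_integral (fun p => dder (pt2 1 0) P p + dder (pt2 0 1) Q p) = 0.
Proof.
  rewrite (rect_integral_ext _ (fun p => dder (pt2 1 0) P p + 1 * dder (pt2 0 1) Q p)).
  - rewrite rect_integral_lin, rect_integral_partial1, rect_integral_partial2. ring.
    + intros u v _ _. now apply partial1_continuous.
    + intros u v _ _. now apply partial2_continuous.
  - intros; ring.
Qed.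
End Stokes.

Definition open_rect (p : R2) : Prop := a < fst p < b /\ c < snd p < d.

Lemma open_rect_open : open open_rect.
Proof.
  intros p [[H1 H2] [H3 H4]].
  assert (C1 : continuous (fun p : R2 => fst p) p) by apply continuous_fst_R2, continuous_id.
  assert (C2 : continuous (fun p : R2 => snd p) p) by apply continuous_snd_R2, continuous_id.
  apply filter_and; apply filter_and; (apply cont_gt || apply cont_lt); trivial.
Qed.

(** A function that vanishes near the boundary of the rectangle stays C1 when it is
    replaced by 0 outside. *)
Definition cut (f : R2 -> R) (p : R2) : R :=
  if excluded_middle_informative (open_rect p) then f p else 0.

Lemma cut_in f p : open_rect p -> cut f p = f p.
Proof. unfold cut. destruct (excluded_middle_informative _); tauto. Qed.
Lemma cut_out f p : ~ open_rect p -> cut f p = 0.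
Proof. unfold cut. destruct (excluded_middle_informative _); tauto. Qed.

Definition inner_rect (eta : R) (p : R2) : Prop :=
  a + eta <= fst p <= b - eta /\ c + eta <= snd p <= d - eta.

Lemma inner_rect_closed eta p : ~ inner_rect eta p -> locally p (fun q => ~ inner_rect eta q).
Proof.
  intros H.
  assert (C1 : continuous (fun p : R2 => fst p) p) by apply continuous_fst_R2, continuous_id.
  assert (C2 : continuous (fun p : R2 => snd p) p) by apply continuous_snd_R2, continuous_id.
  destruct (Rlt_dec (fst p) (a + eta)) as [L|L].
  { apply filter_imp with (2 := cont_lt _ _ _ C1 L). unfold inner_rect. intros; lra. }
  destruct (Rlt_dec (b - eta) (fst p)) as [L2|L2].
  { apply filter_imp with (2 := cont_gt _ _ _ C1 L2). unfold inner_rect. intros; lra. }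
  destruct (Rlt_dec (snd p) (c + eta)) as [L3|L3].
  { apply filter_imp with (2 := cont_lt _ _ _ C2 L3). unfold inner_rect. intros; lra. }
  destruct (Rlt_dec (d - eta) (snd p)) as [L4|L4].
  { apply filter_imp with (2 := cont_gt _ _ _ C2 L4). unfold inner_rect. intros; lra. }
  exfalso. apply H. unfold inner_rect. lra.
Qed.

Lemma cut_C1 f eta : 0 < eta -> (forall p, open_rect p -> C1_at f p) ->
  (forall p, open_rect p -> ~ inner_rect eta p -> f p = 0) -> forall p, C1_at (cut f) p.
Proof.
  intros He Hf H0 p. destruct (classic (open_rect p)) as [H|H].
  - apply C1_at_ext_loc with f; [|now apply Hf].
    apply filter_imp with (2 := open_rect_open p H). intros q Hq. now rewrite cut_in.
  - apply C1_at_ext_loc with (fun _ => 0); [|apply C1_at_const].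
    assert (Hi : ~ inner_rect eta p). { intros K. apply H. unfold open_rect, inner_rect in *. lra. }
    apply filter_imp with (2 := inner_rect_closed eta p Hi). intros q Hq.
    destruct (classic (open_rect q)) as [K|K].
    + rewrite cut_in by trivial. symmetry. now apply H0.
    + now rewrite cut_out.
Qed.

Lemma rect_integral_divergence_compact P Q eta : 0 < eta ->
  (forall p, open_rect p -> C1_at P p /\ C1_at Q p) ->
  (forall p, open_rect p -> ~ inner_rect eta p -> P p = 0 /\ Q p = 0) ->
  rect_integral (fun p => dder (pt2 1 0) P p + dder (pt2 0 1) Q p) = 0.
Proof.
  intros He HC H0.
  transitivity (rect_integral (fun p => dder (pt2 1 0) (cut P) p + dder (pt2 0 1) (cut Q) p)).
  - apply rect_integral_ext. intros u v Hu Hv.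
    assert (K : locally (pt2 u v) open_rect) by (apply open_rect_open; now split).
    f_equal; apply dder_ext_loc; apply filter_imp with (2 := K); intros q Hq; now rewrite cut_in.
  - apply rect_integral_divergence_0.
    + apply cut_C1 with eta; trivial; intros; [now apply HC|now apply H0].
    + apply cut_C1 with eta; trivial; intros; [now apply HC|now apply H0].
    + intros u v H. apply cut_out. exact H.
    + intros u v H. apply cut_out. exact H.
Qed.
End Rectangle.

(** * Expansion to first order in the parameter of a variation *)

Definition zpt (e : R) (p : R2) : RxR2 := (e, p).
(** The same point of the surface at parameter value 0. *)
Definition flat (z : RxR2) : RxR2 := zpt 0 (snd z).

Lemma flat_continuous z : continuous flat z.
Proof.
  apply (continuous_comp_2 (fun _ : RxR2 => 0 : R) (fun z : RxR2 => snd z) zpt).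
  - apply continuous_const.
  - destruct z; apply continuous_snd.
  - apply (continuous_ext (fun z : RxR2 => z)). intros [e p]; reflexivity. apply continuous_id.
Qed.

Lemma zpt_plus_scal (e s l : R) (p v : R2) :
  plus (zpt e p) (scal s (zpt l v)) = zpt (e + s * l) (plus p (scal s v)).
Proof. reflexivity. Qed.

Lemma plus_scal_zero (p : R2) (s : R) : plus p (scal s zero) = p.
Proof.
  apply R2_eq; coords; ring.
Qed.

Lemma derive_0_criterion (f : R -> R) :
  (forall eps, 0 < eps -> exists eta, 0 < eta /\ forall e, Rabs e < eta -> Rabs (f e - f 0) <= eps * Rabs e) ->
  is_derive f 0 0.
Proof.
  intros H. split. apply is_linear_scal_l.
  intros z Hz. assert (Ez : (0 : R) = z) by exact (is_filter_lim_locally_unique (V := R_NormedModule) _ _ Hz). subst z.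
  intros eps. destruct (H eps (cond_pos eps)) as (eta & P & K).
  exists (mkposreal _ P). intros t Ht. change (Rabs (t - 0) < eta) in Ht.
  change (Rabs (f t - f 0 - (t - 0) * 0) <= eps * Rabs (t - 0)).
  rewrite Rminus_0_r in *. rewrite Rmult_0_r, Rminus_0_r. now apply K.
Qed.

Section Local.
Variable p0 : R2.
Let z0 : RxR2 := zpt 0 p0.

(** K = O(e) near (0, p0), for functions K of (e, p). *)
Definition order_e (K : RxR2 -> R) : Prop :=
  exists M, 0 < M /\ locally z0 (fun z => Rabs (K z) <= M * Rabs (fst z)).
(** K = o(e) at (0, p0), in the locally uniform sense that compactness of the rectangle
    requires. *)
Definition small_e (K : RxR2 -> R) : Prop :=
  forall eps, 0 < eps -> locally z0 (fun z => Rabs (K z) <= eps * Rabs (fst z)).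
Definition lip_e (W : RxR2 -> R) : Prop :=
  continuous W z0 /\ order_e (fun z => W z - W (flat z)).

Lemma comp_flat_continuous (W : RxR2 -> R) : continuous W z0 -> continuous (fun z => W (flat z)) z0.
Proof. intros H. apply (continuous_comp flat W). apply flat_continuous. exact H. Qed.

Lemma locally_flat (P : RxR2 -> Prop) : locally z0 P -> locally z0 (fun z => P (flat z)).
Proof. intros H. exact (flat_continuous z0 P H). Qed.

Lemma bounded_near (W : RxR2 -> R) : continuous W z0 -> locally z0 (fun z => Rabs (W z) <= Rabs (W z0) + 1).
Proof.
  intros H. apply filter_imp with (2 := cont_close W z0 1 H Rlt_0_1). intros z Hz.
  replace (W z) with ((W z - W z0) + W z0) by ring. eapply Rle_trans. apply Rabs_triang. lra.
Qed.

Lemma order_e_plus K1 K2 : order_e K1 -> order_e K2 -> order_e (fun z => K1 z + K2 z).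
Proof.
  intros (M1 & P1 & H1) (M2 & P2 & H2). exists (M1 + M2). split. lra.
  generalize (filter_and _ _ H1 H2). apply filter_imp. intros z [A1 A2].
  eapply Rle_trans. apply Rabs_triang. rewrite Rmult_plus_distr_r. lra.
Qed.

Lemma order_e_bounded K B : order_e K -> continuous B z0 -> order_e (fun z => B z * K z).
Proof.
  intros (M & P & H) HB. assert (Q := Rabs_pos (B z0)). exists ((Rabs (B z0) + 1) * M).
  split. { apply Rmult_lt_0_compat; lra. }
  generalize (filter_and _ _ H (bounded_near B HB)). apply filter_imp. intros z [A1 A2].
  rewrite Rabs_mult, Rmult_assoc. apply Rmult_le_compat; trivial; apply Rabs_pos.
Qed.

Lemma order_e_ext K K' : (forall z, K z = K' z) -> order_e K -> order_e K'.
Proof.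
  intros E (M & P & H). exists M. split; trivial. apply filter_imp with (2 := H).
  intros z. now rewrite E.
Qed.

Lemma lip_e_minus W1 W2 : lip_e W1 -> lip_e W2 -> lip_e (fun z => W1 z - W2 z).
Proof.
  intros [C1 H1] [C2 H2]. split. now apply cont_minus.
  apply order_e_ext with (fun z => (W1 z - W1 (flat z)) + (-1) * (W2 z - W2 (flat z))).
  - intros; ring.
  - apply order_e_plus; trivial. apply order_e_bounded; trivial. apply continuous_const.
Qed.

Lemma lip_e_mult W1 W2 : lip_e W1 -> lip_e W2 -> lip_e (fun z => W1 z * W2 z).
Proof.
  intros [C1 H1] [C2 H2]. split. now apply cont_mult.
  apply order_e_ext with (fun z => W2 z * (W1 z - W1 (flat z)) + W1 (flat z) * (W2 z - W2 (flat z))).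
  - intros; ring.
  - apply order_e_plus; apply order_e_bounded; trivial. now apply comp_flat_continuous.
Qed.

Lemma small_e_plus K1 K2 : small_e K1 -> small_e K2 -> small_e (fun z => K1 z + K2 z).
Proof.
  intros H1 H2 eps He. assert (He2 : 0 < eps / 2) by lra.
  generalize (filter_and _ _ (H1 _ He2) (H2 _ He2)). apply filter_imp. intros z [A1 A2].
  eapply Rle_trans. apply Rabs_triang. lra.
Qed.

Lemma small_e_prod K1 K2 : continuous K1 z0 -> K1 z0 = 0 -> order_e K2 -> small_e (fun z => K1 z * K2 z).
Proof.
  intros C E (M & P & H) eps He. assert (Hm : 0 < eps / M) by now apply Rdiv_lt_0_compat.
  generalize (filter_and _ _ H (cont_close K1 z0 _ C Hm)). apply filter_imp. intros z [A1 A2].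
  rewrite E, Rminus_0_r in A2. rewrite Rabs_mult.
  replace (eps * Rabs (fst z)) with (eps / M * (M * Rabs (fst z))) by (field; lra).
  apply Rmult_le_compat; try apply Rabs_pos; lra.
Qed.

Lemma small_e_le K K' : locally z0 (fun z => Rabs (K z) <= Rabs (K' z)) -> small_e K' -> small_e K.
Proof.
  intros H H' eps He. generalize (filter_and _ _ H (H' eps He)). apply filter_imp. intros z [A1 A2]. lra.
Qed.

(** Mean value theorem in the parameter, whose derivative is bounded near (0, p0). *)
Lemma class_C_lip_e (D : RxR2 -> Prop) (W : RxR2 -> R) : class_C 1 D W -> locally z0 D -> lip_e W.
Proof.
  intros HW HD. assert (D0 : D z0) by now apply locally_singleton in HD.
  split. { apply (class_C_continuous 1 D); trivial. }
  set (v := zpt 1 zero).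
  assert (Cv : continuous (dder v W) z0).
  { apply (class_C_continuous 0 D); trivial. now apply class_C_dder. }
  set (M := Rabs (dder v W z0) + 1).
  assert (HM : 0 < M) by (unfold M; generalize (Rabs_pos (dder v W z0)); lra).
  exists M. split; trivial.
  destruct (filter_and _ _ HD (bounded_near _ Cv)) as [r Hr].
  exists r. intros [e p] [He Hp]. change (Rabs (e - 0) < r) in He. rewrite Rminus_0_r in He.
  change R in e. change (Rabs (W (zpt e p) - W (zpt 0 p)) <= M * Rabs e).
  assert (L : forall s, plus (zpt 0 p) (scal s v) = zpt s p).
  { intros s. unfold v. rewrite zpt_plus_scal, plus_scal_zero. f_equal. ring. }
  assert (Hs : forall s, Rmin 0 e <= s <= Rmax 0 e ->
    is_derive (fun s => W (zpt s p)) s (dder v W (zpt s p)) /\ Rabs (dder v W (zpt s p)) <= M).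
  { intros s Hs.
    assert (Hs' : Rabs s < r).
    { apply Rabs_def2 in He. apply Rabs_def1; unfold Rmin, Rmax in Hs; destruct (Rle_dec 0 e); lra. }
    destruct (Hr (zpt s p)) as [K1 K2].
    { split; trivial. change (Rabs (s - 0) < r). now rewrite Rminus_0_r. }
    split; trivial.
    apply (is_derive_ext (fun s => W (plus (zpt 0 p) (scal s v)))).
    { intros t. now rewrite L. }
    refine (eq_ind (plus (zpt 0 p) (scal s v))
      (fun y => is_derive (fun t => W (plus (zpt 0 p) (scal t v))) s (dder v W y))
      (line_derive W (zpt 0 p) v s _) _ (L s)).
    refine (eq_ind_r (fun y => ex_derive (fun t => W (plus y (scal t v))) 0) _ (L s)).
    now apply (class_C_ex_derive 0 D). }
  destruct (MVT_gen (fun s => W (zpt s p)) 0 e (fun s => dder v W (zpt s p))) as [x [Hx Ex]].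
  - intros s H. apply Hs. lra.
  - intros s H. apply continuity_pt_filterlim. apply (ex_derive_continuous (fun s : R => W (zpt s p))).
    eexists. now apply Hs.
  - rewrite Ex, Rabs_mult, Rminus_0_r. apply Rmult_le_compat_r. apply Rabs_pos. now apply Hs.
Qed.

Section Calibration.
Variable gamma : R3 -> R.
Variable zeta : R3 -> R3.
Variable regular : R3 -> Prop.
Hypothesis regular_open : open regular.
Hypothesis zeta_le : forall x m, regular x -> dot3 (zeta x) m <= gamma m.
Hypothesis zeta_eq : forall x, regular x -> dot3 (zeta x) x = gamma x.
Hypothesis zeta_c1 : forall x, regular x -> continuous (fun x => fst (fst (zeta x))) x.
Hypothesis zeta_c2 : forall x, regular x -> continuous (fun x => snd (fst (zeta x))) x.
Hypothesis zeta_c3 : forall x, regular x -> continuous (fun x => snd (zeta x)) x.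
Variables W1 W2 W3 : RxR2 -> R.
Hypothesis HW1 : lip_e W1.
Hypothesis HW2 : lip_e W2.
Hypothesis HW3 : lip_e W3.
Let w z : R3 := pt3 (W1 z) (W2 z) (W3 z).
Hypothesis Hgood : regular (w z0).

Lemma w_continuous : continuous w z0.
Proof.
  apply (continuous_comp_2 (fun z => pt2 (W1 z) (W2 z)) W3 (fun a b => (a, b) : R3)).
  - apply (continuous_pt2 W1 W2). apply HW1. apply HW2.
  - apply HW3.
  - apply (continuous_ext (fun x : R3 => x)). intros [x y]; reflexivity. apply continuous_id.
Qed.

(** Write N for w z and N' for its value at parameter 0.  As zeta(N) . N = gamma(N)
    while zeta(x) . N <= gamma(N) for every regular x, the quantity lies between 0 and
    (zeta(N) - zeta(N')) . (N - N'), a product of a factor tending to 0 with a factor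
    O(e). *)
Lemma calibration_small : small_e (fun z => gamma (w z) - gamma (w (flat z)) - dot3 (zeta (w (flat z))) (minus (w z) (w (flat z)))).
Proof.
  assert (G1 : locally z0 (fun z => regular (w z))) by (apply w_continuous, regular_open, Hgood).
  assert (G2 := locally_flat _ G1).
  assert (S : forall (f : R3 -> R) (W : RxR2 -> R), continuous f (w z0) -> lip_e W ->
    small_e (fun z => (f (w z) - f (w (flat z))) * (W z - W (flat z)))).
  { intros f W Cf [_ HW]. apply small_e_prod; trivial.
    - assert (Cfw : continuous (fun z => f (w z)) z0) by (apply (continuous_comp w f); trivial; apply w_continuous).
      apply cont_minus; trivial. now apply (comp_flat_continuous (fun z => f (w z))).
    - change (f (w z0) - f (w z0) = 0). ring. }
  apply small_e_le with (2 := small_e_plus _ _ (small_e_plus _ _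
    (S _ _ (zeta_c1 _ Hgood) HW1) (S _ _ (zeta_c2 _ Hgood) HW2)) (S _ _ (zeta_c3 _ Hgood) HW3)).
  generalize (filter_and _ _ G1 G2). apply filter_imp. intros z [H1 H2].
  assert (L1 := zeta_le _ (w z) H2). assert (L2 := zeta_le _ (w (flat z)) H1).
  assert (E1 := zeta_eq _ H1). assert (E2 := zeta_eq _ H2).
  revert L1 L2 E1 E2. generalize (gamma (w z)) (gamma (w (flat z))). intros ga gb.
  destruct (zeta (w z)) as [[a1 a2] a3], (zeta (w (flat z))) as [[b1 b2] b3].
  change R in a1, a2, a3, b1, b2, b3. unfold w.
  generalize (W1 z) (W2 z) (W3 z) (W1 (flat z)) (W2 (flat z)) (W3 (flat z)). intros x1 x2 x3 y1 y2 y3.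
  intros L1 L2 E1 E2.
  change (b1 * x1 + b2 * x2 + b3 * x3 <= ga) in L1.
  change (a1 * y1 + a2 * y2 + a3 * y3 <= gb) in L2.
  change (a1 * x1 + a2 * x2 + a3 * x3 = ga) in E1.
  change (b1 * y1 + b2 * y2 + b3 * y3 = gb) in E2.
  change (Rabs (ga - gb - (b1 * (x1 + - y1) + b2 * (x2 + - y2) + b3 * (x3 + - y3))) <=
    Rabs ((a1 - b1) * (x1 - y1) + (a2 - b2) * (x2 - y2) + (a3 - b3) * (x3 - y3))).
  rewrite 2!Rabs_pos_eq; lra.
Qed.
End Calibration.
End Local.

Lemma slice_dder (F : RxR2 -> R) e (p v : R2) : dder v (fun q => F (zpt e q)) p = dder (zpt 0 v) F (zpt e p).
Proof.
  apply Derive_ext. intros t. rewrite zpt_plus_scal. f_equal. f_equal. toR. rring.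
Qed.

Lemma zpt_continuous e p : continuous (fun q : R2 => zpt e q) p.
Proof.
  apply (continuous_comp_2 (fun _ : R2 => e : R) (fun q : R2 => q) zpt).
  apply continuous_const. apply continuous_id.
  apply (continuous_ext (fun z : RxR2 => z)). intros [x y]; reflexivity. apply continuous_id.
Qed.

Lemma slice_class_C (D : RxR2 -> Prop) (U : R2 -> Prop) (F : RxR2 -> R) e :
  class_C 1 D F -> (forall q, U q -> D (zpt e q)) -> class_C 1 U (fun q => F (zpt e q)).
Proof.
  intros HF HU. split.
  - intros q Hq. apply (continuous_comp (fun q : R2 => zpt e q) F). apply zpt_continuous.
    apply (class_C_continuous 1 D); auto.
  - intros v. split.
    + intros q Hq. apply (ex_derive_ext (fun t => F (plus (zpt e q) (scal t (zpt 0 v))))).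
      * intros t. rewrite zpt_plus_scal. f_equal. f_equal. toR. rring.
      * apply (class_C_ex_derive 0 D); auto.
    + split; trivial. intros q Hq.
      apply (continuous_ext (fun q => dder (zpt 0 v) F (zpt e q))). { intros; symmetry; apply slice_dder. }
      apply (continuous_comp (fun q : R2 => zpt e q) (dder (zpt 0 v) F)). apply zpt_continuous.
      apply (class_C_continuous 0 D); auto. now apply class_C_dder.
Qed.

(** * Support points along the graph *)

Section SupportPoint.
Variables Psi Phi : R2 -> R.
Hypothesis HPsi : strict_C2_norm Psi.
Hypothesis HPhi : strict_C2_norm Phi.
Hypothesis Hev : even_fst Phi.
Let n := dual2 Psi.
Let phi := dual2 Phi.
Let Hn : C2_norm n := dual_is_C2_norm Psi (proj1 HPsi) (proj2 HPsi).
Let Hphi : C2_norm phi := dual_is_C2_norm Phi (proj1 HPhi) (proj2 HPhi).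
Let NPsi : is_norm Psi := proj1 (proj1 HPsi).
Let NPhi : is_norm Phi := proj1 (proj1 HPhi).

(** The pair to which the vertical norm is applied. *)
Definition height_point (n : R2 -> R) (x : R3) : R2 := pt2 (n (fst x)) (snd x).
(** The point of the Wulff shape with outer normal [x], for [n] and [phi] the dual
    norms: the gradient of the dual spatial norm at [x], by the chain rule. *)
Definition support_point (n phi : R2 -> R) (x : R3) : R3 :=
  (scal (fst (grad2 phi (height_point n x))) (grad2 n (fst x)), snd (grad2 phi (height_point n x))).

Lemma height_point_neq0 x : fst x <> zero -> height_point n x <> zero.
Proof.
  intros Hx. apply R2_neq. left. apply Rgt_not_eq. apply (nrm_pos n (proj1 Hn)). exact Hx.
Qed.

Lemma support_point_eq x : fst x <> zero ->
  dot3 (support_point n phi x) x = dual3 (norm_HV Psi Phi) x.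
Proof.
  intros Hx. rewrite dual3_HV by trivial. fold n phi. fold (height_point n x).
  rewrite <- (grad2_norm_euler phi _ Hphi (height_point_neq0 x Hx)).
  change (dot2 (scal (fst (grad2 phi (height_point n x))) (grad2 n (fst x))) (fst x) + snd (grad2 phi (height_point n x)) * snd x =
    fst (grad2 phi (height_point n x)) * n (fst x) + snd (grad2 phi (height_point n x)) * snd x).
  rewrite dot2_scal_l, (grad2_norm_euler n (fst x) Hn Hx). reflexivity.
Qed.

(** The support point has spatial norm 1: its horizontal part is a multiple of a unit
    vector for [Psi], and what remains is a gradient of the dual of [Phi]. *)
Lemma support_point_le x m : fst x <> zero ->
  dot3 (support_point n phi x) m <= dual3 (norm_HV Psi Phi) m.
Proof.
  intros Hx. rewrite dual3_HV by trivial.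
  assert (K := dot3_HV_le Psi Phi NPsi NPhi m (support_point n phi x)).
  assert (E1 : norm_HV Psi Phi (support_point n phi x) = 1).
  { unfold norm_HV, support_point.
    change (Phi (pt2 (Psi (scal (fst (grad2 phi (height_point n x))) (grad2 n (fst x)))) (snd (grad2 phi (height_point n x)))) = 1).
    rewrite (nrm_scal Psi NPsi).
    destruct (dual_norm_C2 Psi (proj1 HPsi) (proj2 HPsi) (fst x) Hx) as (E0 & _). fold n in E0. rewrite E0.
    rewrite Rmult_1_r, (even_fst_abs Phi Hev), pt2_eta.
    apply (dual_norm_C2 Phi (proj1 HPhi) (proj2 HPhi)). now apply height_point_neq0. }
  rewrite E1, Rmult_1_r in K.
  replace (dot3 (support_point n phi x) m) with (dot3 m (support_point n phi x)). exact K.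
  unfold dot3. rewrite dot2_sym. toR; ring.
Qed.

Lemma grad2_continuous (f : R2 -> R) p : C2_norm f -> p <> zero ->
  continuous (fun q => fst (grad2 f q)) p /\ continuous (fun q => snd (grad2 f q)) p.
Proof.
  intros Hf Hp. destruct (proj2 Hf p Hp) as (_ & H1 & H2).
  split; now apply C1_at_continuous.
Qed.

Lemma support_point_continuous x : fst x <> zero ->
  continuous (fun x => fst (fst (support_point n phi x))) x /\
  continuous (fun x => snd (fst (support_point n phi x))) x /\
  continuous (fun x => snd (support_point n phi x)) x.
Proof.
  intros Hx.
  assert (Cf : continuous (fun x : R3 => fst x) x) by (destruct x; apply continuous_fst).
  assert (Cs : continuous (fun x : R3 => snd x) x) by (destruct x; apply continuous_snd).
  assert (Ch : continuous (height_point n) x).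
  { apply (continuous_pt2 (fun x : R3 => n (fst x)) (fun x : R3 => snd x)); trivial.
    apply (continuous_comp (fun x : R3 => fst x) n); trivial. apply (nrm_continuous n (proj1 Hn)). }
  destruct (grad2_continuous phi _ Hphi (height_point_neq0 x Hx)) as [P1 P2].
  destruct (grad2_continuous n _ Hn Hx) as [N1 N2].
  assert (Q1 : continuous (fun x => fst (grad2 phi (height_point n x))) x)
    by now apply (continuous_comp (height_point n) (fun q => fst (grad2 phi q))).
  assert (Q2 : continuous (fun x => snd (grad2 phi (height_point n x))) x)
    by now apply (continuous_comp (height_point n) (fun q => snd (grad2 phi q))).
  assert (M1 : continuous (fun x : R3 => fst (grad2 n (fst x))) x)
    by now apply (continuous_comp (fun x : R3 => fst x) (fun q => fst (grad2 n q))).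
  assert (M2 : continuous (fun x : R3 => snd (grad2 n (fst x))) x)
    by now apply (continuous_comp (fun x : R3 => fst x) (fun q => snd (grad2 n q))).
  split; [|split]; trivial.
  - now apply (cont_mult (fun x => fst (grad2 phi (height_point n x))) (fun x : R3 => fst (grad2 n (fst x)))).
  - now apply (cont_mult (fun x => fst (grad2 phi (height_point n x))) (fun x : R3 => snd (grad2 n (fst x)))).
Qed.

Lemma dual3_continuous x : continuous (dual3 (norm_HV Psi Phi)) x.
Proof.
  apply (continuous_ext (fun x => phi (height_point n x))).
  { intros y. symmetry. now apply dual3_HV. }
  apply (continuous_comp (height_point n) phi).
  - apply (continuous_pt2 (fun x : R3 => n (fst x)) (fun x : R3 => snd x)).
    + apply (continuous_comp (fun x : R3 => fst x) n). destruct x; apply continuous_fst. apply (nrm_continuous n (proj1 Hn)).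
    + destruct x; apply continuous_snd.
  - apply (nrm_continuous phi (proj1 Hphi)).
Qed.

Hypothesis HJ : forall v, n (J v) = n v.
Variable c : R.
Hypothesis Hc : c <> 0.

Definition slope_u q := fst (inverse_square_field n c q).
Definition slope_v q := snd (inverse_square_field n c q).
Definition support1 q := - fst (flux n phi c q).
Definition support2 q := - snd (flux n phi c q).
Definition support3 q := snd (grad2 phi (slope_point n c q)).
Definition graph_normal q : R3 := pt3 (- slope_u q) (- slope_v q) 1.

Lemma graph_normal_fst_neq0 q : q <> zero -> fst (graph_normal q) <> zero.
Proof.
  intros Hq E. apply (inverse_square_neq0 n Hn HJ c Hc q Hq).
  assert (E1 := f_equal fst E). assert (E2 := f_equal snd E).
  change (- slope_u q = 0) in E1. change (- slope_v q = 0) in E2.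
  apply R2_eq; [change (slope_u q = 0)|change (slope_v q = 0)]; lra.
Qed.

(** The horizontal part of the support point is the opposite of the field of the dual
    equation. *)
Lemma support_graph_normal q : q <> zero -> support_point n phi (graph_normal q) = pt3 (support1 q) (support2 q) (support3 q).
Proof.
  intros Hq.
  assert (E : fst (graph_normal q) = scal (-1) (inverse_square_field n c q)).
  { unfold graph_normal, slope_u, slope_v. destruct (inverse_square_field n c q) as [x y]. change R in x, y.
    apply R2_eq; coords; ring. }
  assert (Eh : height_point n (graph_normal q) = slope_point n c q).
  { unfold height_point, slope_point. rewrite E, (nrm_scal n (proj1 Hn)), (inverse_square_norm n Hn HJ c q Hq).
    rewrite (Rabs_left (-1)) by lra.
    apply R2_eq; [|reflexivity]. coords; ring. }
  unfold support_point. rewrite Eh, E.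
  rewrite grad2_norm_scal; [|exact Hn|now apply inverse_square_neq0|lra].
  rewrite (inverse_square_grad n Hn HJ c Hc q Hq).
  unfold support1, support2, support3, flux.
  generalize (grad2 phi (slope_point n c q)). intros [g1 g2]. destruct (J (grad2 n q)) as [x y].
  change R in x, y, g1, g2. rewrite Rabs_left by lra. set (s := Rabs c / c).
  apply R3_eq; [apply R2_eq|reflexivity].
  - coords; field.
  - coords; field.
Qed.

Lemma support_C1 p : p <> zero -> C1_at support1 p /\ C1_at support2 p /\ C1_at support3 p.
Proof.
  intros Hp. destruct (flux_C1 n phi Hn Hphi c p Hp) as [F1 F2].
  split; [|split].
  - now apply C1_at_opp.
  - now apply C1_at_opp.
  - apply (slope_comp_C1 n Hn c (fun z => snd (grad2 phi z))); trivial.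
    apply (proj2 Hphi). apply slope_point_neq0.
Qed.

Lemma slope_uv_C1 p : p <> zero -> C1_at slope_u p /\ C1_at slope_v p.
Proof.
  intros Hp.
  assert (Ck : C1_at (fun q => c / (n q * n q)) p).
  { assert (P := nrm_pos n (proj1 Hn) p Hp).
    apply C1_at_div. apply C1_at_const. apply C1_at_mult; now apply norm_C1.
    apply Rgt_not_eq. now apply Rmult_lt_0_compat. }
  split.
  - apply (C1_at_mult (fun q => c / (n q * n q)) (fun q => - snd q)); trivial. apply C1_at_opp, C1_at_snd.
  - apply (C1_at_mult (fun q => c / (n q * n q)) (fun q => fst q)); trivial. apply C1_at_fst.
Qed.

Lemma grad2_opp f p : C1_at f p -> grad2 (fun q => - f q) p = opp (grad2 f p).
Proof.
  intros H. apply grad2_is_grad.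
  apply is_grad_ext_loc with (fun q => (-1) * f q).
  - apply filter_forall. intros; ring.
  - replace (opp (grad2 f p)) with (scal (-1) (grad2 f p)). apply is_grad_cmult. now apply C1_at_grad.
    destruct (grad2 f p) as [x y]. change R in x, y. apply R2_eq; coords; ring.
Qed.

Lemma support_div p : p <> zero -> fst (grad2 support1 p) + snd (grad2 support2 p) = 0.
Proof.
  intros Hp. destruct (flux_C1 n phi Hn Hphi c p Hp) as [F1 F2].
  assert (D := proj2 (flux_divergence_free n phi Hn Hphi c p Hp)). unfold div0 in D.
  unfold support1, support2. rewrite (grad2_opp _ _ F1), (grad2_opp _ _ F2).
  change (- dder (pt2 1 0) (fun q => fst (flux n phi c q)) p + - dder (pt2 0 1) (fun q => snd (flux n phi c q)) p = 0).
  lra.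
Qed.

(** The rotated field is curl free because the radial field is divergence free. *)
Lemma slope_curl p : p <> zero -> snd (grad2 slope_u p) = fst (grad2 slope_v p).
Proof.
  intros Hp. destruct (slope_uv_C1 p Hp) as [A1 A2].
  assert (P := nrm_pos n (proj1 Hn) p Hp).
  assert (K : divergence_free_at (radial_field n (fun r => c / (r * r))) p).
  { apply (radial_field_div n Hn); trivial. apply inverse_square_derive. lra. }
  assert (D := proj2 K). unfold div0 in D.
  assert (E1 : dder (pt2 1 0) (fun q => fst (radial_field n (fun r => c / (r * r)) q)) p = fst (grad2 slope_v p)) by reflexivity.
  assert (E2 : dder (pt2 0 1) (fun q => snd (radial_field n (fun r => c / (r * r)) q)) p = - snd (grad2 slope_u p)).
  { change (- snd (grad2 slope_u p)) with (snd (opp (grad2 slope_u p))). rewrite <- (grad2_opp slope_u p A1).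
    apply (dder_ext_loc (pt2 0 1)). apply filter_forall. intros q.
    change (c / (n q * n q) * snd q = - (c / (n q * n q) * - snd q)). toR; ring. }
  rewrite E1, E2 in D. toR. lra.
Qed.

(** The pairing of the support point at q with the normal at p is maximal at q = p, so
    its gradient in q vanishes there. *)
Lemma support_tangent p : p <> zero ->
  - slope_u p * fst (grad2 support1 p) - slope_v p * fst (grad2 support2 p) + fst (grad2 support3 p) = 0 /\
  - slope_u p * snd (grad2 support1 p) - slope_v p * snd (grad2 support2 p) + snd (grad2 support3 p) = 0.
Proof.
  intros Hp. destruct (support_C1 p Hp) as (C1 & C2 & C3).
  assert (Hg := is_grad_plus _ _ _ _ _ (is_grad_plus _ _ _ _ _
     (is_grad_cmult (- slope_u p) _ _ _ (C1_at_grad _ _ C1)) (is_grad_cmult (- slope_v p) _ _ _ (C1_at_grad _ _ C2))) (C1_at_grad _ _ C3)).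
  apply is_grad_local_max in Hg.
  - assert (E1 := f_equal fst Hg). assert (E2 := f_equal snd Hg). clear Hg. revert E1 E2.
    destruct (grad2 support1 p) as [x1 y1], (grad2 support2 p) as [x2 y2], (grad2 support3 p) as [x3 y3]. change R in x1, x2, x3, y1, y2, y3.
    intros E1 E2. change (- slope_u p * x1 + - slope_v p * x2 + x3 = 0) in E1. change (- slope_u p * y1 + - slope_v p * y2 + y3 = 0) in E2.
    change (- slope_u p * x1 - slope_v p * x2 + x3 = 0 /\ - slope_u p * y1 - slope_v p * y2 + y3 = 0). lra.
  - apply filter_imp with (2 := open_nonzero p Hp). intros q Hq.
    assert (L := support_point_le _ (graph_normal p) (graph_normal_fst_neq0 q Hq)).
    rewrite <- (support_point_eq _ (graph_normal_fst_neq0 p Hp)), !support_graph_normal in L by trivial.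
    change (support1 q * - slope_u p + support2 q * - slope_v p + support3 q * 1 <= support1 p * - slope_u p + support2 p * - slope_v p + support3 p * 1) in L.
    lra.
Qed.

(** Coordinates of X_v x S and S x X_u, where X is the graph, S its field of support
    points, X_u = (1, 0, slope_u) and X_v = (0, 1, slope_v).  These fields pair with the
    derivatives D_u and D_v of a displacement in the first variation. *)
Definition tension_u1 q := support3 q + slope_v q * - support2 q.
Definition tension_v1 q := slope_u q * support2 q.
Definition tension_u2 q := slope_v q * support1 q.
Definition tension_v2 q := support3 q + slope_u q * - support1 q.
Definition tension_u3 q := - support1 q.
Definition tension_v3 q := - support2 q.

Definition div_free_pair (A B : R2 -> R) (p : R2) : Prop :=
  C1_at A p /\ C1_at B p /\ fst (grad2 A p) + snd (grad2 B p) = 0.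

Lemma grad2_plus f g p : C1_at f p -> C1_at g p -> grad2 (fun q => f q + g q) p = plus (grad2 f p) (grad2 g p).
Proof. intros. apply grad2_is_grad, is_grad_plus; now apply C1_at_grad. Qed.
Lemma grad2_mult f g p : C1_at f p -> C1_at g p -> grad2 (fun q => f q * g q) p =
  pt2 (g p * fst (grad2 f p) + f p * fst (grad2 g p)) (g p * snd (grad2 f p) + f p * snd (grad2 g p)).
Proof. intros. apply grad2_is_grad, is_grad_mult; now apply C1_at_grad. Qed.

(** The divergence is X_v x S_u - X_u x S_v.  Its third coordinate is minus the
    divergence of the horizontal part of S, which is 0 by the dual equation; the first
    two reduce to it because S_u and S_v are orthogonal to the normal and the slopes are
    curl free. *)
Lemma div_free_rows p : p <> zero ->
  div_free_pair tension_u1 tension_v1 p /\ div_free_pair tension_u2 tension_v2 p /\ div_free_pair tension_u3 tension_v3 p.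
Proof.
  intros Hp. destruct (support_C1 p Hp) as (C1 & C2 & C3). destruct (slope_uv_C1 p Hp) as [D1 D2].
  assert (N1 := C1_at_opp _ _ C1). assert (N2 := C1_at_opp _ _ C2).
  destruct (support_tangent p Hp) as [T1 T2]. assert (S := support_div p Hp). assert (K := slope_curl p Hp).
  unfold tension_u1, tension_u2, tension_u3, tension_v1, tension_v2, tension_v3.
  split; [|split]; (split; [|split]).
  - now apply C1_at_plus; [|apply C1_at_mult].
  - now apply C1_at_mult.
  - rewrite grad2_plus, !grad2_mult, grad2_opp; trivial. 2: now apply C1_at_mult.
    revert T1 T2 S K. destruct (grad2 support1 p) as [x1 y1], (grad2 support2 p) as [x2 y2], (grad2 support3 p) as [x3 y3],
     (grad2 slope_u p) as [u1 v1], (grad2 slope_v p) as [u2 v2]. change R in x1,x2,x3,y1,y2,y3,u1,u2,v1,v2.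
    cbn [fst snd]. intros T1 T2 S K. rewrite <- K in *.
    change (x3 + (- support2 p * v1 + slope_v p * - x2) + (support2 p * v1 + slope_u p * y2) = 0).
    replace y2 with (- x1) by lra. lra.
  - now apply C1_at_mult.
  - now apply C1_at_plus; [|apply C1_at_mult].
  - rewrite grad2_plus, !grad2_mult, grad2_opp; trivial. 2: now apply C1_at_mult.
    revert T1 T2 S K. destruct (grad2 support1 p) as [x1 y1], (grad2 support2 p) as [x2 y2], (grad2 support3 p) as [x3 y3],
     (grad2 slope_u p) as [u1 v1], (grad2 slope_v p) as [u2 v2]. change R in x1,x2,x3,y1,y2,y3,u1,u2,v1,v2.
    cbn [fst snd]. intros T1 T2 S K. rewrite <- K in *.
    change ((support1 p * v1 + slope_v p * x1) + (y3 + (- support1 p * v1 + slope_u p * - y1)) = 0).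
    replace x1 with (- y2) by lra. lra.
  - trivial.
  - trivial.
  - rewrite !grad2_opp by trivial.
    revert S. destruct (grad2 support1 p) as [x1 y1], (grad2 support2 p) as [x2 y2]. change R in x1,x2,y1,y2.
    intros S. change (x1 + y2 = 0) in S. change (- x1 + - y2 = 0). lra.
Qed.
End SupportPoint.

Lemma divergence_mult_scalar (D A B : R2 -> R) p : C1_at D p -> div_free_pair A B p ->
  dder (pt2 1 0) (fun q => D q * A q) p + dder (pt2 0 1) (fun q => D q * B q) p =
  dder (pt2 1 0) D p * A p + dder (pt2 0 1) D p * B p.
Proof.
  intros HD (HA & HB & H0).
  assert (GA := is_grad_mult _ _ _ _ _ (C1_at_grad _ _ HD) (C1_at_grad _ _ HA)).
  assert (GB := is_grad_mult _ _ _ _ _ (C1_at_grad _ _ HD) (C1_at_grad _ _ HB)).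
  rewrite (dder_grad _ _ _ (pt2 1 0) GA), (dder_grad _ _ _ (pt2 0 1) GB).
  rewrite (dder_grad _ _ _ (pt2 1 0) (C1_at_grad _ _ HD)), (dder_grad _ _ _ (pt2 0 1) (C1_at_grad _ _ HD)).
  revert H0. destruct (grad2 A p) as [x1 y1], (grad2 B p) as [x2 y2], (grad2 D p) as [x3 y3]. change R in x1,x2,x3,y1,y2,y3.
  intros H0. change (x1 + y2 = 0) in H0.
  change ((A p * x3 + D p * x1) * 1 + (A p * y3 + D p * y1) * 0 + ((B p * x3 + D p * x2) * 0 + (B p * y3 + D p * y2) * 1) =
    (x3 * 1 + y3 * 0) * A p + (x3 * 0 + y3 * 1) * B p).
  replace y2 with (- x1) by lra. ring.
Qed.

Lemma enorm3_zero x : enorm3 x = 0 -> x = zero.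
Proof.
  unfold enorm3. destruct x as [[x y] z]. change R in x, y, z.
  intros H. apply sqrt_eq_0 in H.
  - change (x * x + y * y + z * z = 0) in H.
    assert (x = 0) by nra. assert (y = 0) by nra. assert (z = 0) by nra. subst. reflexivity.
  - change (0 <= x * x + y * y + z * z). nra.
Qed.

Lemma homogeneous_unit_normal (gamma : R3 -> R) X p : (forall t x, gamma (scal t x) = Rabs t * gamma x) ->
  gamma (unit_normal X p) * enorm3 (normal_vec X p) = gamma (normal_vec X p).
Proof.
  intros Hg. unfold unit_normal. set (v := normal_vec X p). rewrite Hg.
  assert (P : 0 <= enorm3 v) by apply sqrt_pos.
  destruct (Req_dec (enorm3 v) 0) as [Z|Z].
  - rewrite Z. apply enorm3_zero in Z. rewrite Z.
    assert (E : gamma zero = 0).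
    { assert (K := Hg 0 zero). rewrite Rabs_R0, Rmult_0_l in K.
      refine (eq_trans (f_equal gamma _) K). symmetry. apply (scal_zero_l (zero : R3)). }
    rewrite E. ring.
  - rewrite Rabs_inv, Rabs_pos_eq by trivial. field. trivial.
Qed.

(** * First variation of the energy *)

Definition du (F : RxR2 -> R) : RxR2 -> R := dder (zpt 0 (pt2 1 0)) F.
Definition dv (F : RxR2 -> R) : RxR2 -> R := dder (zpt 0 (pt2 0 1)) F.
(** Contribution of one coordinate of the surface to the part of first order in the
    displacement [F z - F (flat z)]. *)
Definition first_order (F : RxR2 -> R) (A B : R2 -> R) (z : RxR2) : R :=
  (du F z - du F (flat z)) * A (snd z) + (dv F z - dv F (flat z)) * B (snd z).

Definition domain (delta : R) (U : R2 -> Prop) (z : RxR2) : Prop := Rabs (fst z) < delta /\ U (snd z).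

Lemma domain_open delta U z : open U -> domain delta U z -> locally z (domain delta U).
Proof.
  intros HU [H1 H2].
  assert (Cf : continuous (fun z : RxR2 => fst z) z) by (destruct z; apply continuous_fst).
  assert (Cs : continuous (fun z : RxR2 => snd z) z) by (destruct z; apply continuous_snd).
  apply filter_and.
  - apply (cont_lt (fun z : RxR2 => Rabs (fst z))); trivial. now apply cont_abs.
  - apply Cs. now apply HU.
Qed.

Section Coordinate.
Variables (U : R2 -> Prop) (delta : R) (F : RxR2 -> R).
Hypothesis HU : open U.
Hypothesis Hdelta : 0 < delta.
Hypothesis HF : smooth_on (domain delta U) F.

Lemma du_class : class_C 1 (domain delta U) (du F).
Proof. apply class_C_dder. apply (HF 2%nat). Qed.
Lemma dv_class : class_C 1 (domain delta U) (dv F).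
Proof. apply class_C_dder. apply (HF 2%nat). Qed.

Lemma du_continuous e p : Rabs e < delta -> U p -> continuous (fun q => du F (zpt e q)) p.
Proof.
  intros He Hp. apply (continuous_comp (fun q : R2 => zpt e q) (du F)). apply zpt_continuous.
  apply (class_C_continuous 1 (domain delta U)). apply du_class. now split.
Qed.
Lemma dv_continuous e p : Rabs e < delta -> U p -> continuous (fun q => dv F (zpt e q)) p.
Proof.
  intros He Hp. apply (continuous_comp (fun q : R2 => zpt e q) (dv F)). apply zpt_continuous.
  apply (class_C_continuous 1 (domain delta U)). apply dv_class. now split.
Qed.

Lemma slice_C1 e p : Rabs e < delta -> U p -> C1_at (fun q => F (zpt e q)) p.
Proof.
  intros He Hp. apply class_C_C1_at with U.
  - apply (slice_class_C (domain delta U)). apply (HF 1%nat). intros q Hq. now split.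
  - now apply HU.
Qed.

Lemma Rabs_0_lt : Rabs 0 < delta.
Proof. now rewrite Rabs_R0. Qed.

Variables (a b c d eta e : R) (A B : R2 -> R).
Hypothesis Hab : a < b.
Hypothesis Hcd : c < d.
Hypothesis Heta : 0 < eta.
Hypothesis He : Rabs e < delta.
Hypothesis Hrect : forall u v, a <= u <= b -> c <= v <= d -> U (pt2 u v).
Hypothesis HAB : forall p, U p -> div_free_pair A B p.
Hypothesis Hfix : forall p, U p -> ~ inner_rect a b c d eta p -> F (zpt e p) = F (zpt 0 p).

Lemma first_order_continuous : continuous_on_rect a b c d (fun p => first_order F A B (zpt e p)).
Proof.
  intros u v Hu Hv. assert (Hp := Hrect u v Hu Hv).
  destruct (HAB _ Hp) as (CA & CB & _). apply C1_at_continuous in CA. apply C1_at_continuous in CB.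
  assert (X1 := du_continuous e _ He Hp). assert (X2 := du_continuous 0 _ Rabs_0_lt Hp).
  assert (X3 := dv_continuous e _ He Hp). assert (X4 := dv_continuous 0 _ Rabs_0_lt Hp).
  apply (cont_plus (fun q => (du F (zpt e q) - du F (zpt 0 q)) * A q) (fun q => (dv F (zpt e q) - dv F (zpt 0 q)) * B q)).
  - apply (cont_mult (fun q => du F (zpt e q) - du F (zpt 0 q)) A); trivial.
    apply (cont_minus (fun q => du F (zpt e q)) (fun q => du F (zpt 0 q)) _ X1 X2).
  - apply (cont_mult (fun q => dv F (zpt e q) - dv F (zpt 0 q)) B); trivial.
    apply (cont_minus (fun q => dv F (zpt e q)) (fun q => dv F (zpt 0 q)) _ X3 X4).
Qed.

(** For a divergence free pair (A, B) the integrand is the divergence of (D A, D B),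
    where the displacement D vanishes near the boundary. *)
Lemma first_order_integral : rect_integral a b c d (fun p => first_order F A B (zpt e p)) = 0.
Proof.
  set (D := fun q => F (zpt e q) + (-1) * F (zpt 0 q)).
  assert (HD : forall p, U p -> C1_at D p).
  { intros p Hp. apply C1_at_plus. now apply slice_C1.
    apply C1_at_mult. apply C1_at_const. apply slice_C1; trivial. apply Rabs_0_lt. }
  assert (HR : forall p, open_rect a b c d p -> U p).
  { intros p [H1 H2]. rewrite <- (pt2_eta p). apply Hrect; lra. }
  assert (ED : forall p v, U p -> dder v D p = dder (zpt 0 v) F (zpt e p) - dder (zpt 0 v) F (zpt 0 p)).
  { intros p v Hp.
    assert (g1 := C1_at_grad _ _ (slice_C1 e p He Hp)).
    assert (g2 := C1_at_grad _ _ (slice_C1 0 p Rabs_0_lt Hp)).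
    rewrite <- !slice_dder, (dder_grad _ _ _ v g1), (dder_grad _ _ _ v g2).
    rewrite (dder_grad D p _ v (is_grad_plus _ _ _ _ _ g1 (is_grad_cmult (-1) _ _ _ g2))).
    rewrite dot2_plus_l, dot2_scal_l. ring. }
  transitivity (rect_integral a b c d (fun p => dder (pt2 1 0) (fun q => D q * A q) p + dder (pt2 0 1) (fun q => D q * B q) p)).
  - apply rect_integral_ext; trivial. intros u v Hu Hv.
    assert (Hp : U (pt2 u v)) by (apply Hrect; lra).
    rewrite divergence_mult_scalar; auto. rewrite !ED by trivial. reflexivity.
  - apply rect_integral_divergence_compact with eta; trivial.
    + intros p Hp. apply HR in Hp. destruct (HAB p Hp) as (CA & CB & _).
      split; apply C1_at_mult; auto.
    + intros p Hp Hi. apply HR in Hp. unfold D. rewrite Hfix by trivial. split; ring.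
Qed.
End Coordinate.

Section FirstVariation.
Variables Psi Phi : R2 -> R.
Hypothesis HPsi : strict_C2_norm Psi.
Hypothesis HPhi : strict_C2_norm Phi.
Hypothesis Hev : even_fst Phi.
Let n := dual2 Psi.
Let phi := dual2 Phi.
Hypothesis HJ : forall v, n (J v) = n v.
Variable k : R.
Hypothesis Hk : k <> 0.
Let gamma : R3 -> R := dual3 (norm_HV Psi Phi).
Let g1 := support1 Psi Phi k.
Let g2 := support2 Psi Phi k.
Let g3 := support3 Psi Phi k.

Variables (U : R2 -> Prop) (alpha : R2 -> R).
Hypothesis HU : open U.
Hypothesis Hnz : forall p, U p -> p <> zero.
Hypothesis Ha : forall p, U p -> is_grad alpha p (inverse_square_field n k p).

Section Family.
Variables (delta : R) (Y : R -> R2 -> R3).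
Hypothesis Hdelta : 0 < delta.
Hypothesis HY0 : forall p, U p -> Y 0 p = graph_param alpha p.
Let F1 (z : RxR2) : R := fst (fst (Y (fst z) (snd z))).
Let F2 (z : RxR2) : R := snd (fst (Y (fst z) (snd z))).
Let F3 (z : RxR2) : R := snd (Y (fst z) (snd z)).
Hypothesis HF1 : smooth_on (domain delta U) F1.
Hypothesis HF2 : smooth_on (domain delta U) F2.
Hypothesis HF3 : smooth_on (domain delta U) F3.

Definition minor (f g h l : RxR2 -> R) (z : RxR2) : R := f z * g z - h z * l z.
Let W1 := minor (du F2) (dv F3) (du F3) (dv F2).
Let W2 := minor (du F3) (dv F1) (du F1) (dv F3).
Let W3 := minor (du F1) (dv F2) (du F2) (dv F1).
Let w (z : RxR2) : R3 := pt3 (W1 z) (W2 z) (W3 z).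

Lemma normal_vec_family e p : normal_vec (Y e) p = w (zpt e p).
Proof.
  unfold w, W1, W2, W3, minor, du, dv. rewrite <- !slice_dder. reflexivity.
Qed.

Lemma graph_derivatives p : U p ->
  du F1 (zpt 0 p) = 1 /\ du F2 (zpt 0 p) = 0 /\ du F3 (zpt 0 p) = slope_u Psi k p /\
  dv F1 (zpt 0 p) = 0 /\ dv F2 (zpt 0 p) = 1 /\ dv F3 (zpt 0 p) = slope_v Psi k p.
Proof.
  intros Hp. assert (L := HU p Hp).
  assert (E1 : forall v, dder (zpt 0 v) F1 (zpt 0 p) = dot2 (pt2 1 0) v).
  { intros v. rewrite <- slice_dder, <- (dder_grad _ p _ v (is_grad_fst p)). apply dder_ext_loc.
    apply filter_imp with (2 := L). intros q Hq. unfold F1. simpl. now rewrite HY0. }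
  assert (E2 : forall v, dder (zpt 0 v) F2 (zpt 0 p) = dot2 (pt2 0 1) v).
  { intros v. rewrite <- slice_dder, <- (dder_grad _ p _ v (is_grad_snd p)). apply dder_ext_loc.
    apply filter_imp with (2 := L). intros q Hq. unfold F2. simpl. now rewrite HY0. }
  assert (E3 : forall v, dder (zpt 0 v) F3 (zpt 0 p) = dot2 (inverse_square_field n k p) v).
  { intros v. rewrite <- slice_dder, <- (dder_grad _ p _ v (Ha p Hp)). apply dder_ext_loc.
    apply filter_imp with (2 := L). intros q Hq. unfold F3. simpl. now rewrite HY0. }
  unfold du, dv. rewrite !E1, !E2, !E3. unfold slope_u, slope_v. fold n.
  destruct (inverse_square_field n k p) as [x y]. change R in x, y.
  change (1 * 1 + 0 * 0 = 1 /\ 0 * 1 + 1 * 0 = 0 /\ x * 1 + y * 0 = x /\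
    1 * 0 + 0 * 1 = 0 /\ 0 * 0 + 1 * 1 = 1 /\ x * 0 + y * 1 = y). repeat split; ring.
Qed.

Lemma normal_at_0 p : U p -> w (zpt 0 p) = graph_normal Psi k p.
Proof.
  intros Hp. destruct (graph_derivatives p Hp) as (e1 & e2 & e3 & e4 & e5 & e6).
  unfold w, W1, W2, W3, minor, graph_normal. rewrite e1, e2, e3, e4, e5, e6.
  f_equal; ring.
Qed.

Let Lin (z : RxR2) : R := first_order F1 (tension_u1 Psi Phi k) (tension_v1 Psi Phi k) z +
  (first_order F2 (tension_u2 Psi Phi k) (tension_v2 Psi Phi k) z + first_order F3 (tension_u3 Psi Phi k) (tension_v3 Psi Phi k) z).

(** By calibration the increment of gamma is S . (N - N') up to o(e).  Expanding the
    cross products, S . (N - N') differs from the first order part by S . (D_u x D_v),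
    which is quadratic in the displacement. *)
Lemma expansion_small p : U p ->
  small_e p (fun z => gamma (w z) - gamma (w (flat z)) - Lin z).
Proof.
  intros Hp. assert (Hp0 := Hnz p Hp).
  assert (LD : locally (zpt 0 p) (domain delta U)).
  { apply domain_open; trivial. split; trivial. simpl. now rewrite Rabs_R0. }
  assert (Lu : forall F, smooth_on (domain delta U) F -> lip_e p (du F)).
  { intros F HF. apply class_C_lip_e with (domain delta U); trivial. now apply du_class. }
  assert (Lv : forall F, smooth_on (domain delta U) F -> lip_e p (dv F)).
  { intros F HF. apply class_C_lip_e with (domain delta U); trivial. now apply dv_class. }
  assert (L1 := Lu F1 HF1). assert (L2 := Lu F2 HF2). assert (L3 := Lu F3 HF3).
  assert (M1 := Lv F1 HF1). assert (M2 := Lv F2 HF2). assert (M3 := Lv F3 HF3). clear Lu Lv.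
  assert (LW1 : lip_e p W1) by (apply lip_e_minus; apply lip_e_mult; trivial).
  assert (LW2 : lip_e p W2) by (apply lip_e_minus; apply lip_e_mult; trivial).
  assert (LW3 : lip_e p W3) by (apply lip_e_minus; apply lip_e_mult; trivial).
  assert (Cal : small_e p (fun z => gamma (w z) - gamma (w (flat z)) - dot3 (support_point n phi (w (flat z))) (minus (w z) (w (flat z))))).
  { apply (calibration_small p gamma (support_point n phi) (fun x : R3 => fst x <> zero)); trivial.
    - intros x Hx. assert (Cf : continuous (fun x : R3 => fst x) x) by (destruct x; apply continuous_fst).
      apply (Cf (fun y => y <> zero)). now apply open_nonzero.
    - intros x m Hx. now apply support_point_le.
    - intros x Hx. now apply support_point_eq.
    - intros x Hx. now apply (support_point_continuous Psi Phi HPsi HPhi x Hx).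
    - intros x Hx. now apply (support_point_continuous Psi Phi HPsi HPhi x Hx).
    - intros x Hx. now apply (support_point_continuous Psi Phi HPsi HPhi x Hx).
    - change (fst (w (zpt 0 p)) <> zero). rewrite (normal_at_0 p Hp). now apply graph_normal_fst_neq0. }
  (* terms quadratic in the displacement *)
  assert (Quad : forall g f h, continuous g p -> lip_e p f -> lip_e p h ->
    small_e p (fun z => (g (snd z) * (f z - f (flat z))) * (h z - h (flat z)))).
  { intros g f h Cg [Cf _] [_ Hh]. apply small_e_prod; trivial.
    - apply cont_mult.
      + apply (continuous_comp (fun z : RxR2 => snd z) g); trivial. apply continuous_snd.
      + apply cont_minus; trivial. now apply comp_flat_continuous.
    - change (g p * (f (zpt 0 p) - f (zpt 0 p)) = 0). ring. }
  destruct (support_C1 Psi Phi HPsi HPhi k p Hp0) as (C1 & C2 & C3).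
  apply C1_at_continuous in C1. apply C1_at_continuous in C2. apply C1_at_continuous in C3.
  fold g1 in C1. fold g2 in C2. fold g3 in C3.
  assert (C1' := cont_opp _ _ C1). assert (C2' := cont_opp _ _ C2). assert (C3' := cont_opp _ _ C3).
  apply small_e_le with (2 := small_e_plus _ _ _ Cal (small_e_plus _ _ _
    (small_e_plus _ _ _ (Quad _ _ _ C1 L2 M3) (Quad _ _ _ C1' L3 M2))
    (small_e_plus _ _ _
    (small_e_plus _ _ _ (Quad _ _ _ C2 L3 M1) (Quad _ _ _ C2' L1 M3))
    (small_e_plus _ _ _ (Quad _ _ _ C3 L1 M2) (Quad _ _ _ C3' L2 M1))))).
  apply filter_imp with (2 := LD). intros [e q] [_ Hq]. simpl in Hq.
  change (flat (e, q)) with (zpt 0 q). change (e, q) with (zpt e q). change (snd (zpt e q)) with q.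
  rewrite (normal_at_0 q Hq). unfold n, phi. rewrite (support_graph_normal Psi Phi HPsi HJ k Hk q (Hnz q Hq)).
  fold g1 g2 g3. right. f_equal.
  generalize (gamma (w (zpt e q))) (gamma (graph_normal Psi k q)). intros ga gb.
  unfold Lin, first_order, graph_normal, w, W1, W2, W3, minor, tension_u1, tension_u2, tension_u3, tension_v1, tension_v2, tension_v3. fold g1 g2 g3.
  change (flat (zpt e q)) with (zpt 0 q). change (snd (zpt e q)) with q.
  destruct (graph_derivatives q Hq) as (e1 & e2 & e3 & e4 & e5 & e6).
  rewrite e1, e2, e3, e4, e5, e6.
  generalize (du F1 (zpt e q)) (du F2 (zpt e q)) (du F3 (zpt e q)) (dv F1 (zpt e q)) (dv F2 (zpt e q)) (dv F3 (zpt e q)).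
  generalize (g1 q) (g2 q) (g3 q) (slope_u Psi k q) (slope_v Psi k q).
  intros x1 x2 x3 y1 y2 u1 u2 u3 v1 v2 v3.
  match goal with |- ?l = ?r => match r with context [dot3 ?s ?t] =>
   change (dot3 s t) with (x1 * ((u2 * v3 - u3 * v2) + - (- y1)) + x2 * ((u3 * v1 - u1 * v3) + - (- y2)) + x3 * ((u1 * v2 - u2 * v1) + - (1))) end end.
  ring.
Qed.
End Family.

(** The first order part of the integrand integrates to 0, and the remainder is o(e)
    uniformly on the rectangle. *)
Theorem zero_mean_curvature :
  is_aniso_mean_curvature gamma U (graph_param alpha) (fun _ => 0).
Proof.
  intros a b c d Hab Hcd Hrect Y delta eta Hdelta Heta (HF1 & HF2 & HF3) HY0 Hfix.
  set (F1 := fun z : RxR2 => fst (fst (Y (fst z) (snd z)))).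
  set (F2 := fun z : RxR2 => snd (fst (Y (fst z) (snd z)))).
  set (F3 := fun z : RxR2 => snd (Y (fst z) (snd z))).
  change (smooth_on (domain delta U) F1) in HF1. change (smooth_on (domain delta U) F2) in HF2.
  change (smooth_on (domain delta U) F3) in HF3.
  assert (Hhom : forall t x, gamma (scal t x) = Rabs t * gamma x).
  { intros t x. apply dual3_HV_scal; trivial; [apply (proj1 (proj1 HPsi))|apply (proj1 (proj1 HPhi))]. }
  assert (EE : forall e, aniso_energy gamma (Y e) a b c d = rect_integral a b c d (fun p => gamma (normal_vec (Y e) p))).
  { intros e.
    change (rect_integral a b c d (fun p => gamma (unit_normal (Y e) p) * enorm3 (normal_vec (Y e) p)) =
      rect_integral a b c d (fun p => gamma (normal_vec (Y e) p))).
    apply rect_integral_ext; [exact Hab|exact Hcd|]. intros u v _ _. exact (homogeneous_unit_normal gamma (Y e) (pt2 u v) Hhom). }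
  assert (E0 : surface_integral (graph_param alpha) a b c d
     (fun p => 0 * dot3 (velocity Y p) (unit_normal (graph_param alpha) p)) = 0).
  { transitivity (rect_integral a b c d (fun _ => 0)); [|exact (rect_integral_0 a b c d)].
    change (rect_integral a b c d (fun p => 0 * dot3 (velocity Y p) (unit_normal (graph_param alpha) p) *
      enorm3 (normal_vec (graph_param alpha) p)) = rect_integral a b c d (fun _ => 0)).
    apply rect_integral_ext; [exact Hab|exact Hcd|]. intros u v _ _. ring. }
  rewrite E0, Ropp_0. apply derive_0_criterion. intros eps Heps.
  set (K := (b - a) * (d - c)). assert (HK : 0 < K) by (apply Rmult_lt_0_compat; lra).
  assert (HeK : 0 < eps / K) by now apply Rdiv_lt_0_compat.
  set (Lin := fun z => first_order F1 (tension_u1 Psi Phi k) (tension_v1 Psi Phi k) z +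
    (first_order F2 (tension_u2 Psi Phi k) (tension_v2 Psi Phi k) z + first_order F3 (tension_u3 Psi Phi k) (tension_v3 Psi Phi k) z)).
  destruct (rect_uniform (fun e p => Rabs (gamma (normal_vec (Y e) p) - gamma (normal_vec (Y 0) p) - Lin (zpt e p)) <= eps / K * Rabs e) a b c d) as (et & Pet & Het).
  { intros u v Hu Hv. assert (Hp := Hrect u v Hu Hv).
    assert (S := expansion_small delta Y Hdelta HY0 HF1 HF2 HF3 _ Hp _ HeK).
    apply filter_imp with (2 := S). intros [e p] H. simpl. rewrite !normal_vec_family. exact H. }
  exists (Rmin et delta). split. { now apply Rmin_glb_lt. }
  intros e He. assert (He1 : Rabs e < et) by (eapply Rlt_le_trans; [exact He|apply Rmin_l]).
  assert (He2 : Rabs e < delta) by (eapply Rlt_le_trans; [exact He|apply Rmin_r]).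
  rewrite !EE.
  assert (Hfix' : forall p, U p -> ~ inner_rect a b c d eta p -> Y e p = Y 0 p).
  { intros p Hp Hi. rewrite (HY0 p Hp), <- (pt2_eta p). apply Hfix; trivial. rewrite pt2_eta. exact Hp. }
  assert (Hrows : forall p, U p -> div_free_pair (tension_u1 Psi Phi k) (tension_v1 Psi Phi k) p /\
     div_free_pair (tension_u2 Psi Phi k) (tension_v2 Psi Phi k) p /\ div_free_pair (tension_u3 Psi Phi k) (tension_v3 Psi Phi k) p).
  { intros p Hp. apply div_free_rows; auto. }
  assert (Cn : forall e, Rabs e < delta -> continuous_on_rect a b c d (fun p => gamma (normal_vec (Y e) p))).
  { intros e' He' u v Hu Hv. assert (Hp := Hrect u v Hu Hv).
    apply (continuous_comp (fun p => normal_vec (Y e') p) gamma); [|now apply dual3_continuous].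
    apply (continuous_ext (fun p => pt3 (minor (du F2) (dv F3) (du F3) (dv F2) (zpt e' p))
      (minor (du F3) (dv F1) (du F1) (dv F3) (zpt e' p)) (minor (du F1) (dv F2) (du F2) (dv F1) (zpt e' p)))).
    { intros p. symmetry. apply normal_vec_family. }
    assert (Cc : forall f g h l : RxR2 -> R, continuous (fun q => f (zpt e' q)) (pt2 u v) -> continuous (fun q => g (zpt e' q)) (pt2 u v) ->
      continuous (fun q => h (zpt e' q)) (pt2 u v) -> continuous (fun q => l (zpt e' q)) (pt2 u v) ->
      continuous (fun q => minor f g h l (zpt e' q)) (pt2 u v)).
    { intros. apply (cont_minus (fun q => f (zpt e' q) * g (zpt e' q)) (fun q => h (zpt e' q) * l (zpt e' q))); now apply cont_mult. }
    assert (X1 := du_continuous U delta F1 HF1 e' _ He' Hp). assert (X2 := du_continuous U delta F2 HF2 e' _ He' Hp).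
    assert (X3 := du_continuous U delta F3 HF3 e' _ He' Hp). assert (Y1 := dv_continuous U delta F1 HF1 e' _ He' Hp).
    assert (Y2 := dv_continuous U delta F2 HF2 e' _ He' Hp). assert (Y3 := dv_continuous U delta F3 HF3 e' _ He' Hp).
    apply (continuous_comp_2 (fun p => pt2 (minor (du F2) (dv F3) (du F3) (dv F2) (zpt e' p)) (minor (du F3) (dv F1) (du F1) (dv F3) (zpt e' p)))
      (fun p => minor (du F1) (dv F2) (du F2) (dv F1) (zpt e' p)) (fun x y => (x, y) : R3)).
    - apply (continuous_pt2 (fun p => minor (du F2) (dv F3) (du F3) (dv F2) (zpt e' p)) (fun p => minor (du F3) (dv F1) (du F1) (dv F3) (zpt e' p))); now apply Cc.
    - now apply Cc.
    - apply (continuous_ext (fun x : R3 => x)). intros [x y]; reflexivity. apply continuous_id. }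
  assert (R0 : Rabs 0 < delta) by now rewrite Rabs_R0.
  assert (I : forall F A B, smooth_on (domain delta U) F -> (forall p, U p -> div_free_pair A B p) ->
     (forall p, U p -> ~ inner_rect a b c d eta p -> F (zpt e p) = F (zpt 0 p)) ->
     continuous_on_rect a b c d (fun p => first_order F A B (zpt e p)) /\ rect_integral a b c d (fun p => first_order F A B (zpt e p)) = 0).
  { intros F A B HF HAB Hf. split.
    - apply (first_order_continuous U delta F Hdelta HF); trivial.
    - apply (first_order_integral U delta F HU Hdelta HF) with eta; trivial. }
  destruct (I F1 _ _ HF1 (fun p Hp => proj1 (Hrows p Hp))) as [I1c I1z].
  { intros p Hp Hi. unfold F1. simpl. now rewrite Hfix'. }
  destruct (I F2 _ _ HF2 (fun p Hp => proj1 (proj2 (Hrows p Hp)))) as [I2c I2z].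
  { intros p Hp Hi. unfold F2. simpl. now rewrite Hfix'. }
  destruct (I F3 _ _ HF3 (fun p Hp => proj2 (proj2 (Hrows p Hp)))) as [I3c I3z].
  { intros p Hp Hi. unfold F3. simpl. now rewrite Hfix'. }
  assert (Cl : continuous_on_rect a b c d (fun p => first_order F2 (tension_u2 Psi Phi k) (tension_v2 Psi Phi k) (zpt e p) + 1 * first_order F3 (tension_u3 Psi Phi k) (tension_v3 Psi Phi k) (zpt e p))).
  { intros u v Hu Hv. apply (cont_plus (fun p => first_order F2 (tension_u2 Psi Phi k) (tension_v2 Psi Phi k) (zpt e p))). now apply I2c.
    apply (cont_mult (fun _ => 1)). apply continuous_const. now apply I3c. }
  eapply Rle_trans.
  - apply (rect_integral_estimate a b c d Hab Hcd _ _ (fun p => Lin (zpt e p)) (eps / K * Rabs e)).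
    + now apply Cn.
    + now apply Cn.
    + intros u v Hu Hv. apply (cont_plus (fun p => first_order F1 (tension_u1 Psi Phi k) (tension_v1 Psi Phi k) (zpt e p))). now apply I1c.
      apply (cont_plus (fun p => first_order F2 (tension_u2 Psi Phi k) (tension_v2 Psi Phi k) (zpt e p))). now apply I2c. now apply I3c.
    + transitivity (rect_integral a b c d (fun p => first_order F1 (tension_u1 Psi Phi k) (tension_v1 Psi Phi k) (zpt e p) + 1 *
        (first_order F2 (tension_u2 Psi Phi k) (tension_v2 Psi Phi k) (zpt e p) + 1 * first_order F3 (tension_u3 Psi Phi k) (tension_v3 Psi Phi k) (zpt e p)))).
      { apply rect_integral_ext; trivial. intros u v _ _. unfold Lin. ring. }
      rewrite !rect_integral_lin by trivial. rewrite I1z, I2z, I3z. ring.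
    + intros u v Hu Hv. now apply Het.
  - right. unfold K. field. lra.
Qed.
End FirstVariation.

(** * The theorem *)

Theorem theorem4p1 :
  forall (Psi Phi : R2 -> R) (r0 : R) (r1 : Rbar) (w : R -> R),
  smooth_norm Psi -> smooth_norm Phi ->
  smooth_norm (norm_HV Psi Phi) ->
  uniformly_positive_curvature (norm_HV Psi Phi) ->
  0 <= r0 -> Rbar_lt r0 r1 ->
  aniso_solution Psi Phi (annulus (dual2 Psi) r0 r1) (fun p => w (dual2 Psi p)) ->
  (forall v : R2, dual2 Psi (J v) = dual2 Psi v) ->
  (forall p, annulus (dual2 Psi) r0 r1 p ->
     divergence_free_at (radial_field (dual2 Psi) (catenoid_g Phi w)) p) /\
  (exists g, extends_catenoid_g (dual2 Psi) Phi w r0 r1 g) /\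
  (forall g, extends_catenoid_g (dual2 Psi) Phi w r0 r1 g ->
     (forall p : R2, p <> zero ->
        exists (U : R2 -> Prop) (alpha : R2 -> R), open U /\ U p /\
          has_gradient_on U alpha (rotated_field (dual2 Psi) g)) /\
     (forall (U : R2 -> Prop) (alpha : R2 -> R),
        open U -> (forall p, U p -> p <> zero) ->
        has_gradient_on U alpha (rotated_field (dual2 Psi) g) ->
        aniso_solution (dual2 Psi) (dual2 Phi) U alpha /\
        is_aniso_mean_curvature (dual3 (norm_HV Psi Phi)) U (graph_param alpha)
          (fun _ => 0) /\
        ruled_by_horizontal_lines U alpha) /\
     (forall O : R2 -> Prop, locally (zero : R2) O ->
        multivalued_in (fun p => O p /\ p <> zero)
          (rotated_field (dual2 Psi) g))).
Proof.
  intros Psi Phi r0 r1 w HPsi HPhi HN HK Hr0 Hr Hw HJ.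
  assert (gPsi : strict_C2_norm Psi).
  { split. now apply smooth_norm_C2. now apply Psi_curved with Phi. }
  assert (gPhi : strict_C2_norm Phi).
  { split. now apply smooth_norm_C2. now apply Phi_curved with Psi. }
  assert (Hev : even_fst Phi) by now apply Phi_even with Psi.
  assert (Hn : C2_norm (dual2 Psi)) by (apply dual_is_C2_norm; apply gPsi).
  assert (Hphi : C2_norm (dual2 Phi)) by (apply dual_is_C2_norm; apply gPhi).
  destruct (catenoid_g_formula Psi Phi gPsi gPhi Hev w r0 r1 Hr0 Hr Hw) as (c & Hc & Hg).
  split; [|split].
  - intros p Hp. now apply (catenoid_solution Psi Phi gPsi gPhi Hev w r0 r1).
  - exists (fun r => c / (r * r)). now apply extension_exists.
  - intros g Hext.
    assert (Eg : forall p, p <> zero -> rotated_field (dual2 Psi) g p = inverse_square_field (dual2 Psi) c p).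
    { intros p Hp. unfold rotated_field, inverse_square_field. f_equal.
      apply (extension_formula Psi Phi gPsi w r0 r1 g c); trivial. apply nrm_pos; trivial. apply Hn. }
    split; [|split].
    + intros p Hp. destruct (local_potential (dual2 Psi) (proj1 Hn) c p Hp) as [alpha Ha].
      exists (fun q => 0 < dot2 p q), alpha. split; [|split].
      * apply half_plane_open.
      * now apply dot2_self_pos.
      * intros q Hq. assert (Hq0 : q <> zero).
        { intros ->. rewrite dot2_sym, dot2_zero_l in Hq. lra. }
        specialize (Ha q Hq). rewrite Eg by trivial.
        split. now apply is_grad_differentiable with (1 := Ha). now apply grad2_is_grad.
    + intros U alpha HU Hnz Hgrad.
      assert (Ha : forall p, U p -> is_grad alpha p (inverse_square_field (dual2 Psi) c p)).
      { intros p Hp. destruct (Hgrad p Hp) as [H1 H2].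
        rewrite <- Eg, <- H2 by auto. now apply differentiable_is_grad. }
      split; [|split].
      * now apply inverse_square_solution with c.
      * now apply zero_mean_curvature with c.
      * now apply inverse_square_ruled with (dual2 Psi) c.
    + intros O HO. now apply (inverse_square_multivalued (dual2 Psi) (proj1 Hn) c).
Qed.
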